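(* For every $(V,g)\in\mathcal{C}$ there exists a unique solution $F$ to the kinetic layer problem with data $(V,g)$ (both $\mathcal{C}$ and the layer problem are defined in the context). Let $u_\infty\ge0$ be such that $V=u_\infty^2/2$. Then there are two cases. (a) If $V=\int_0^L\xi g(\xi)\,d\xi$, then $F(y,\xi)=0$ for every $\xi\le0$ (and every $y$), and $\lim_{y\to\infty}F(y,\cdot)=M(u_\infty,\cdot)$ in $L^1(\mathbb{R})$. (b) If $V>\int_0^L\xi g(\xi)\,d\xi$, then $\lim_{y\to\infty}F(y,\cdot)=M(-u_\infty,\cdot)$ in $L^1(\mathbb{R})$.
   Context: Fix $L>0$. All functions of the velocity $\xi$ are supported in $[-L,L]$ (extended by $0$ outside). Equilibrium operator: for $u\in[-L,L]$, $M(u,\xi)=\mathrm{sign}(u)\mathbf{1}_{\{0<\xi\,\mathrm{sign}(u)<|u|\}}$; for $F(y,\xi)$ with $0\le\mathrm{sign}(\xi)F\le1$, $\mathcal{M}F(y,\xi)=M\big(\int_{-L}^{L}F(y,\zeta)\,d\zeta,\xi\big)$. Admissible data: $\mathcal{C}=\{(V,g)\in[0,L^2/2]\times L^1(\mathbb{R}^+):\ 0\le g(\xi)\le1,\ V\ge\int_0^L\xi g(\xi)\,d\xi\}$, with $g$ supported in $[0,L]$. Kinetic layer problem with data $(V,g)\in\mathcal{C}$: a solution is $F\in L^\infty(\mathbb{R}^+\times\mathbb{R})$ (supported in $\xi\in[-L,L]$) with $0\le\mathrm{sign}(\xi)F(y,\xi)\le1$ such that $$\xi\partial_yF=\mathcal{M}F-F\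 \text{ for } y\in\mathbb{R}^+,\ \xi\in(-L,L);\qquad F(0,\xi)=g(\xi)\ \text{ for } \xi\in(0,L);\qquad \int_{-L}^{L}\xi F(y,\xi)\,d\xi=V\ \text{ for } y\in\mathbb{R}^+,$$ the equation being understood in the sense of distributions and $F(0,\cdot)$ as the trace at $y=0$. *)

(* Defs.v *)
From HB Require Import structures.
From mathcomp Require Import all_boot all_order all_algebra.
From mathcomp Require Import all_classical all_reals all_analysis.
Import Order.TTheory GRing.Theory Num.Theory.
Import numFieldNormedType.Exports.

Set Implicit Arguments.
Unset Strict Implicit.
Unset Printing Implicit Defensive.

Local Open Scope classical_set_scope.
Local Open Scope ring_scope.

(* Points of R * R are pairs (y, xi) of a position y and a velocity xi. *)

Section Layer.
Context {R : realType}.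

Local Notation leb := (@lebesgue_measure R).

Definition leb2 := (leb \x leb)%E.

Definition half_plane : set (R * R) := `]0, +oo[ `*` [set: R].

Definition equilibrium (u xi : R) : R :=
  Num.sg u * (0 < xi * Num.sg u < `|u|)%R%:R.

(* The sign constraint on F keeps the first argument of [equilibrium] in
   [-L, L] for almost every y. *)
Definition equilibrium_op (L : R) (F : R * R -> R) (p : R * R) : R :=
  equilibrium (\int[leb]_(zeta in `[-L, L]) F (p.1, zeta)) p.2.

(* g is a class in L^1(0, +oo): the pointwise constraints hold a.e. *)
Definition admissible (L V : R) (g : R -> R) : Prop :=
  [/\ 0 <= V <= L ^+ 2 / 2,
      g \_ `]0, +oo[ \in Lfun leb 1,
      {ae leb, forall xi, 0 < xi -> 0 <= g xi <= 1},
      {ae leb, forall xi, L < xi -> g xi = 0} &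
      \int[leb]_(xi in `[0, L]) (xi * g xi) <= V].

Definition iter_derive (vs : seq (R * R)) (phi : R * R -> R) : R * R -> R :=
  foldr (fun v f => 'D_v f) phi vs.

Definition smooth (phi : R * R -> R) : Prop :=
  forall vs, continuous (iter_derive vs phi) /\
    forall p v, derivable (iter_derive vs phi) p v.

Definition test_function (Omega : set (R * R)) (phi : R * R -> R) : Prop :=
  let supp := closure [set p | phi p != 0] in
  [/\ smooth phi, compact supp & supp `<=` Omega].

(* xi * d_y F = N F - F in the sense of distributions on
   (0, +oo) x (-L, L), N F being the equilibrium associated with F. *)
Definition kinetic_equation (L : R) (F : R * R -> R) : Prop :=
  forall phi, test_function (`]0, +oo[ `*` `]-L, L[) phi ->
    - (\int[leb2]_(p in `]0, +oo[ `*` `]-L, L[)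
        (p.2 * F p * 'D_((1, 0) : R * R) phi p)) =
    \int[leb2]_(p in `]0, +oo[ `*` `]-L, L[)
        ((equilibrium_op L F p - F p) * phi p).

(* The trace of F at y = 0 is g on D: ess lim_{y -> 0+} F(y, .) = g in
   L^1(D).  The limit is essential because F is only defined a.e. *)
Definition trace0_on (D : set R) (F : R * R -> R) (g : R -> R) : Prop :=
  forall e : R, 0 < e -> exists2 d : R, 0 < d &
    {ae leb, forall y, 0 < y < d ->
      (\int[leb]_(xi in D) `|F (y, xi) - g xi|%:E < e%:E)%E}.

(* F represents a class in L^infty((0, +oo) x R); its values at y <= 0 are
   irrelevant. *)
Definition layer_solution (L V : R) (g : R -> R) (F : R * R -> R) : Prop :=
  [/\ F \_ half_plane \in Lfun leb2 +oo%E,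
      {ae leb2, forall p, half_plane p -> L < `|p.2| -> F p = 0} /\
      {ae leb2, forall p, half_plane p -> 0 <= Num.sg p.2 * F p <= 1},
      kinetic_equation L F,
      trace0_on `]0, L[ F g &
      {ae leb, forall y, 0 < y ->
        \int[leb]_(xi in `[-L, L]) (xi * F (y, xi)) = V}].

Definition L1_dist (f h : R -> R) : \bar R := ('N[leb]_1[EFin \o (f \- h)%R])%E.

(* Ft is the representative of F for which y |-> Ft (y, .) belongs to
   C([0, +oo); L^1(R)); it gives a meaning to F(y, .) for every y >= 0, and
   each Ft (y, .) is determined by F up to a null set of velocities. *)
Definition L1_continuous_version (F Ft : R * R -> R) : Prop :=
  [/\ {ae leb2, forall p, half_plane p -> F p = Ft p},
      forall y, 0 <= y -> (fun xi => Ft (y, xi)) \in Lfun leb 1 &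
      forall y, 0 <= y ->
        L1_dist (fun xi => Ft (z, xi)) (fun xi => Ft (y, xi))
          @[z --> within `[0, +oo[ (nbhs y)] --> 0%E].

End Layer.

(* Main.v *)
Require Import Defs.
From mathcomp Require Import all_boot all_order all_algebra.
From mathcomp Require Import all_classical all_reals all_analysis.
From mathcomp Require Import measurable_realfun.
From mathcomp Require Import lra ring.
Import Order.TTheory GRing.Theory Num.Theory.
Import numFieldNormedType.Exports.

Local Open Scope classical_set_scope.
Local Open Scope ring_scope.

Set Implicit Arguments.
Unset Strict Implicit.
Unset Printing Implicit Defensive.

(** For a given bounded state [u] the equation [xi * d_y F = M(u) - F] is, for
    each velocity, a scalar linear ODE in [y] with rate [1 / xi].  For
    [0 < xi < L] the incoming datum selects one solution (Duhamel's formula).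
    For [- L < xi < 0] the homogeneous solutions grow exponentially, so that
    exactly one solution is bounded, and it is an integral over [y, +oo[.
    These solutions form [relax u], and the layer problem becomes the scalar
    fixed point problem [mild]: the state is the velocity integral of
    [relax u].  The map from [u] to [relax u] is monotone, because the
    equilibrium is monotone in [u].

    Behaviour at infinity.  Let [u] be mild, [F = relax u], and let [V] be the
    flux of [F] at 0.
    - Conservation: the flux is [V] at every position ([mild_flux]).
    - Entropy: among the kinetic densities of integral [u] the equilibrium has
      the least flux; the excess [V - u^2 / 2] is the integral of
      [|xi - u| |F - M(u)|] ([flux_defect]).  In particular [u^2 <= 2 V].
    - Dissipation: the balance of the moment of weight [xi^2] bounds the
      integral of the excess over the half line ([mild_defect_integral]).
    Each [F(., xi)] is Lipschitz with constant [1 / |xi|], hence [u] is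
    uniformly continuous and the excess tends to 0 ([mild_defect_to0]).  So,
    with [V = c^2 / 2], [|u|] tends to [c] and [F - M(u)] tends to 0 in L^1.

    Sign of the limit.  If [u] is nonnegative beyond [y], then [F = 0] there
    for [xi <= 0] and [V <= L u(y)]; thus [u] stays above [V / L], and by
    uniform continuity an eventual positivity propagates back to [y = 0].
    Hence either [u >= 0] everywhere, and then [V] is the incoming flux, or [u]
    tends to [- c] ([mild_dichotomy], [mild_nonneg_flux]).  Conversely, if [V]
    is the incoming flux, then the outgoing flux at 0 vanishes, so [F = 0] for
    [xi < 0] at [y = 0], hence at every later position since [F(0, xi)]
    averages nonpositive values over the whole half line; thus [u >= 0]
    ([min_flux_nonneg]).

    Existence.  Iterating the map from [u] to the integral of [relax u] from
    the constant [- c] gives a nondecreasing bounded sequence, and its limit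
    is the least mild state above [- c].  Each iterate has limit [- c] at
    infinity, which forces its flux at 0 to be at least [c^2 / 2]; the limit
    inherits this bound, and the dichotomy gives the opposite one
    ([limit_state_flux]).

    Uniqueness.  A mild state of flux [c^2 / 2] is at least [- c], hence above
    the least one.  The two densities are ordered, have the same fluxes and
    the same incoming data; comparing fluxes at 0 they agree for [xi < 0] at 0,
    then later, and comparing fluxes at [y] they agree for [xi > 0]
    ([mild_eq_limit_state]).

    Distributional solutions are of the form [relax u]: testing against
    products of smooth functions gives, for almost every velocity, the
    integrated equation up to a constant ([weak_integral]); the constant is
    identified by the trace at 0 for [xi > 0] and by boundedness for [xi < 0]
    ([weak_mild]).  Conversely [relax u] solves the equation by integration by
    parts ([relax_layer_solution]). *)

(** * Bounded measurable functions and Fubini's theorem *)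
Section BoundedMeasurable.
Context d (T : measurableType d) {R : realType}.

(** Closed under all pointwise operations below and integrable on sets of
    finite measure: this class removes every integrability side condition. *)
Definition bmf (f : T -> R) :=
  measurable_fun setT f /\ exists C, forall x, `|f x| <= C.

Lemma bmf_cst c : bmf (fun=> c).
Proof. by split; [exact: measurable_cst | exists `|c|]. Qed.

Lemma bmfD f g : bmf f -> bmf g -> bmf (fun x => f x + g x).
Proof.
move=> [mf [C hC]] [mg [C' hC']]; split; first exact: measurable_funD.
by exists (C + C') => x; rewrite (le_trans (ler_normD _ _))// lerD.
Qed.

Lemma bmfN f : bmf f -> bmf (fun x => - f x).
Proof.
move=> [mf [C hC]]; split; first exact: measurableT_comp.
by exists C => x; rewrite normrN.
Qed.

Lemma bmfB f g : bmf f -> bmf g -> bmf (fun x => f x - g x).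
Proof. by move=> bf bg; exact: (bmfD bf (bmfN bg)). Qed.

Lemma bmfM f g : bmf f -> bmf g -> bmf (fun x => f x * g x).
Proof.
move=> [mf [C hC]] [mg [C' hC']]; split; first exact: measurable_funM.
by exists (C * C') => x; rewrite normrM ler_pM.
Qed.

Lemma bmfMl c f : bmf f -> bmf (fun x => c * f x).
Proof. by move=> bf; apply: bmfM => //; exact: bmf_cst. Qed.

Lemma bmf_norm f : bmf f -> bmf (fun x => `|f x|).
Proof.
move=> [mf [C hC]]; split; first exact: measurableT_comp.
by exists C => x; rewrite normr_id.
Qed.

Lemma bmf_integrable (mu : {measure set T -> \bar R}) D f :
  measurable D -> (mu D < +oo)%E -> bmf f -> mu.-integrable D (EFin \o f).
Proof.
move=> mD Doo [mf [C hC]]; apply: measurable_bounded_integrable => //.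
  exact: measurable_funTS.
exists C; split; first by rewrite num_real.
by move=> x xC y _ /=; exact: le_trans (hC y) (ltW xC).
Qed.

Lemma bmf_norm_integral_le (mu : {measure set T -> \bar R}) D f C :
  measurable D -> (mu D < +oo)%E -> bmf f -> (forall x, D x -> `|f x| <= C) ->
  `|\int[mu]_(x in D) f x| <= C * fine (mu D).
Proof.
move=> mD Doo bf hC; have intf := bmf_integrable mD Doo bf.
apply: (le_trans (le_normr_Rintegral mD intf)).
rewrite -(Rintegral_cst _ mD); apply: le_Rintegral => //.
- by have := bmf_integrable mD Doo (bmf_norm bf).
- exact: (bmf_integrable mD Doo (bmf_cst C)).
Qed.

Lemma bmf_bool (b : T -> bool) : measurable_fun setT b -> bmf (fun x => (b x)%:R).
Proof.
move=> mb; split; last first.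
  by exists 1 => x; case: (b x); rewrite ?normr1 ?normr0.
have -> : (fun x => (b x)%:R) = (fun x => if b x then 1 else 0) :> (T -> R).
  by apply/funext => x; case: (b x).
apply: measurable_fun_ifT => //; exact: measurable_cst.
Qed.

Lemma measurable_set_bool (b : T -> bool) : measurable_fun setT b -> measurable [set x | b x].
Proof. by move=> mb; have := mb measurableT [set true] I; rewrite setTI. Qed.

End BoundedMeasurable.
Arguments bmf_integrable {d T R mu D f}.
Arguments bmf_cst {d T R} c.

Lemma bmf_comp d d' (T : measurableType d) (T' : measurableType d') {R : realType}
  (f : T' -> R) (h : T -> T') :
  measurable_fun setT h -> bmf f -> bmf (f \o h).
Proof.
move=> mh [mf [C hC]]; split; first exact: measurableT_comp.
by exists C => x /=.
Qed.

Section AlmostEverywhere.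
Context d (T : measurableType d) {R : realType}.
Variable mu : {measure set T -> \bar R}.

Lemma aeS (P Q : T -> Prop) : {ae mu, forall x, P x} -> (forall x, P x -> Q x) ->
  {ae mu, forall x, Q x}.
Proof. by move=> aP PQ; apply: filterS aP => x; exact: PQ. Qed.

Lemma aeI (P Q S : T -> Prop) : {ae mu, forall x, P x} -> {ae mu, forall x, Q x} ->
  (forall x, P x -> Q x -> S x) -> {ae mu, forall x, S x}.
Proof. by move=> aP aQ PQ; apply: filterS2 aP aQ => x; exact: PQ. Qed.

End AlmostEverywhere.

Section BmfPair.
Context {R : realType}.
Local Notation mu := (@lebesgue_measure R).

Lemma bmf_pair1 (f : R * R -> R) y : bmf f -> bmf (fun x => f (x, y)).
Proof.
by move=> bf; apply: (bmf_comp (h := fun x => (x, y))) => //; exact: pair2_measurable.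
Qed.

Lemma bmf_pair2 (f : R * R -> R) x : bmf f -> bmf (fun y => f (x, y)).
Proof.
by move=> bf; apply: (bmf_comp (h := pair x)) => //; exact: pair1_measurable.
Qed.

Lemma bmf_swap (f : R * R -> R) : bmf f -> bmf (fun p => f (p.2, p.1)).
Proof. by move=> bf; apply: (bmf_comp (h := fun p => (p.2, p.1))) => //; exact: measurable_swap. Qed.

Definition finite_mset (D : set R) := measurable D /\ (mu D < +oo)%E.

Lemma finite_mset_itv b c (x y : R) : finite_mset [set` Interval (BSide b x) (BSide c y)].
Proof.
split => //; rewrite lebesgue_measure_itv /=.
by case: ifP => // _; rewrite -EFinB ltry.
Qed.

Lemma bmf_indic (D : set R) : measurable D -> bmf (\1_D : R -> R).
Proof.
move=> mD; split; first exact: measurable_indic.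
by exists 1 => x; rewrite indicE; case: (_ \in _); rewrite ?normr1 ?normr0.
Qed.

Let integral_indicM (D : set R) (f : R -> R) : finite_mset D -> bmf f ->
  (\int[mu]_x (\1_D x * f x)%:E = (\int[mu]_(x in D) f x)%:E)%E.
Proof.
move=> [mD Doo] bf; rewrite /Rintegral fineK; last first.
  by apply: integrable_fin_num => //; exact: bmf_integrable.
rewrite [RHS]integral_mkcond; apply: eq_integral => x _.
by rewrite /patch indicE; case: (_ \in _); rewrite ?mul1r ?mul0r.
Qed.

Section Rectangle.
Variables (f : R * R -> R) (A B : set R).
Hypothesis bf : bmf f.
Hypotheses (fA : finite_mset A) (fB : finite_mset B).
Let mA : measurable A. Proof. by case: fA. Qed.
Let mB : measurable B. Proof. by case: fB. Qed.

Let h : R * R -> R := fun p => \1_A p.1 * (\1_B p.2 * f p).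

Let bh : bmf h.
Proof.
apply: bmfM; first exact: (bmf_comp measurable_fst (bmf_indic mA)).
by apply: bmfM => //; exact: (bmf_comp measurable_snd (bmf_indic mB)).
Qed.

Let mAB : measurable (A `*` B). Proof. exact: measurableX. Qed.

Let ABoo : ((@leb2 R) (A `*` B) < +oo)%E.
Proof.
rewrite /leb2 product_measure1E//.
by apply: lte_mul_pinfty => //; [rewrite ge0_fin_numE//; case: fA | case: fB].
Qed.

Let hE : h = (f \_ (A `*` B)).
Proof.
apply/funext => -[x y]; rewrite /h /patch /= !indicE.
case: ifPn => [|].
  by rewrite inE => -[/= /mem_set -> /mem_set ->]; rewrite !mul1r.
have [xA|_] := boolP (x \in A); last by rewrite mul0r.
have [yB|_] := boolP (y \in B); last by rewrite mul0r mulr0.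
by move=> /negP; case; rewrite inE; split; exact: set_mem.
Qed.

Let ih : (@leb2 R).-integrable setT (EFin \o h).
Proof.
rewrite hE -restrict_EFin; apply/integrable_restrict => //.
by rewrite setTI; exact: bmf_integrable.
Qed.

Let FE x : fubini_F mu (EFin \o h) x = (\1_A x * \int[mu]_(y in B) f (x, y))%:E.
Proof.
have bfx := bmf_pair2 x bf; rewrite /fubini_F /= /h /=.
under eq_integral do rewrite mulrCA.
rewrite integral_indicM ?RintegralZl//; last exact: bmfMl.
by apply: bmf_integrable => //; case: fB.
Qed.

Let GE y : fubini_G mu (EFin \o h) y = (\1_B y * \int[mu]_(x in A) f (x, y))%:E.
Proof.
have bfy := bmf_pair1 y bf; rewrite /fubini_G /= /h /=.
rewrite integral_indicM ?RintegralZl//; last exact: bmfMl.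
by apply: bmf_integrable => //; case: fA.
Qed.

Lemma Rintegral_leb2_1 :
  \int[@leb2 R]_(p in A `*` B) f p = \int[mu]_(x in A) \int[mu]_(y in B) f (x, y).
Proof.
rewrite Rintegral_mkcond -hE [LHS]/Rintegral -[X in fine X = _]/(\int[@leb2 R]_x (EFin \o h) x)%E.
rewrite /leb2 -(integral12_prod_meas1 ih) [in RHS]/Rintegral [in RHS]integral_mkcond.
congr fine; apply: eq_integral => x _; move: (FE x); rewrite /fubini_F => -> .
by rewrite /patch indicE; case: (_ \in _); rewrite ?mul1r ?mul0r.
Qed.

Lemma Rintegral_leb2_2 :
  \int[@leb2 R]_(p in A `*` B) f p = \int[mu]_(y in B) \int[mu]_(x in A) f (x, y).
Proof.
rewrite Rintegral_mkcond -hE [LHS]/Rintegral -[X in fine X = _]/(\int[@leb2 R]_x (EFin \o h) x)%E.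
rewrite /leb2 -(integral21_prod_meas1 ih) [in RHS]/Rintegral [in RHS]integral_mkcond.
congr fine; apply: eq_integral => x _; move: (GE x); rewrite /fubini_G => -> .
by rewrite /patch indicE; case: (_ \in _); rewrite ?mul1r ?mul0r.
Qed.

Lemma Rintegral_exchange :
  \int[mu]_(x in A) \int[mu]_(y in B) f (x, y) =
  \int[mu]_(y in B) \int[mu]_(x in A) f (x, y).
Proof. by rewrite -Rintegral_leb2_1 Rintegral_leb2_2. Qed.

End Rectangle.

(** The positive and negative parts are integrated separately, so that the
    sections of [f] may fail to be integrable. *)
Lemma measurable_Rintegral2 (f : R * R -> R) (B : set R) : measurable_fun setT f ->
  measurable B -> measurable_fun setT (fun x => \int[mu]_(y in B) f (x, y)).
Proof.
move=> mf mB.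
pose h : R * R -> \bar R := fun p => (\1_B p.2 * f p)%:E.
have mh : measurable_fun setT h.
  apply/measurable_EFinP; apply: measurable_funM => //.
  exact: (measurableT_comp (measurable_indic mB) measurable_snd).
have mp : measurable_fun setT (fun x => \int[mu]_y h^\+ (x, y))%E.
  apply: (measurable_fun_fubini_tonelli_F (m2 := mu) (h^\+)%E) => //.
  exact: measurable_funepos.
have mn : measurable_fun setT (fun x => \int[mu]_y h^\- (x, y))%E.
  apply: (measurable_fun_fubini_tonelli_F (m2 := mu) (h^\-)%E) => //.
  exact: measurable_funeneg.
have -> : (fun x => \int[mu]_(y in B) f (x, y)) =
  (fun x => fine (\int[mu]_y h^\+ (x, y) - \int[mu]_y h^\- (x, y))%E).
  apply/funext => x; rewrite /Rintegral integral_mkcond; congr fine.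
  rewrite integralE; congr (_ - _)%E; apply: eq_integral => y _.
    by rewrite !funeposE /h /patch indicE; case: (y \in B); rewrite ?mul1r ?mul0r.
  by rewrite !funenegE /h /patch indicE; case: (y \in B); rewrite ?mul1r ?mul0r.
by apply: measurableT_comp => //; exact: emeasurable_funB.
Qed.

Lemma bmf_Rintegral2 (f : R * R -> R) (B : set R) : bmf f -> finite_mset B ->
  bmf (fun x => \int[mu]_(y in B) f (x, y)).
Proof.
move=> bf [mB Boo]; have [mf [C hC]] := bf; split; first exact: measurable_Rintegral2.
exists (C * fine (mu B)) => x; apply: bmf_norm_integral_le => //.
exact: bmf_pair2.
Qed.

Lemma bmf_Rintegral1 (f : R * R -> R) (A : set R) : bmf f -> finite_mset A ->
  bmf (fun y => \int[mu]_(x in A) f (x, y)).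
Proof. by move=> bf fA; have := bmf_Rintegral2 (bmf_swap bf) fA. Qed.

End BmfPair.

(** * Integrals of locally bounded functions over intervals *)
Section IntervalIntegrals.
Context {R : realType}.
Local Notation mu := (@lebesgue_measure R).
Local Notation "'int' a b f" := (Rintegral mu [set` `[(a : R), (b : R)]] f)
  (at level 10, a, b, f at level 9).

(** Contains the unbounded weights [xi] and [expR (k * s)], and still ensures
    integrability over bounded intervals. *)
Definition lbmf (f : R -> R) :=
  measurable_fun setT f /\
  forall y, exists C, forall x, `|x| <= y -> `|f x| <= C.

Lemma bmf_lbmf f : bmf f -> lbmf f.
Proof. by move=> [mf [C hC]]; split => // y; exists C. Qed.

Lemma lbmfD f g : lbmf f -> lbmf g -> lbmf (fun x => f x + g x).
Proof.
move=> [mf hf] [mg hg]; split; first exact: measurable_funD.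
move=> y; have [C hC] := hf y; have [C' hC'] := hg y.
by exists (C + C') => x xy; rewrite (le_trans (ler_normD _ _))// lerD ?hC ?hC'.
Qed.

Lemma lbmfM f g : lbmf f -> lbmf g -> lbmf (fun x => f x * g x).
Proof.
move=> [mf hf] [mg hg]; split; first exact: measurable_funM.
move=> y; have [C hC] := hf y; have [C' hC'] := hg y.
by exists (C * C') => x xy; rewrite normrM ler_pM ?hC ?hC'.
Qed.

Lemma lbmf_cst c : lbmf (fun=> c).
Proof. exact/bmf_lbmf/bmf_cst. Qed.

Lemma lbmfMl c f : lbmf f -> lbmf (fun x => c * f x).
Proof. by move=> lf; apply: lbmfM => //; exact: lbmf_cst. Qed.

Lemma lbmfN f : lbmf f -> lbmf (fun x => - f x).
Proof.
move=> [mf hf]; split; first exact: measurableT_comp.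
by move=> y; have [C hC] := hf y; exists C => x xy; rewrite normrN hC.
Qed.

Lemma lbmf_norm f : lbmf f -> lbmf (fun x => `|f x|).
Proof.
move=> [mf hf]; split; first exact: measurableT_comp.
by move=> y; have [C hC] := hf y; exists C => x xy; rewrite normr_id hC.
Qed.

Lemma lbmfB f g : lbmf f -> lbmf g -> lbmf (fun x => f x - g x).
Proof. by move=> bf bg; exact: (lbmfD bf (lbmfN bg)). Qed.

Lemma continuous_lbmf f : continuous f -> lbmf f.
Proof.
move=> cf; split; first exact: continuous_measurable_fun.
move=> y; have [y0|y0] := ltP y 0.
  by exists 0 => x /(le_lt_trans)/(_ y0); rewrite ltNge normr_ge0.
have : {within `[-y, y], continuous (fun x => `|f x|)}.
  apply: continuous_subspaceT => x.
  exact: (continuous_comp (cf x) (@norm_continuous _ _ _)).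
move=> /EVT_max; rewrite ge0_cp// => /(_ isT) [c _ hc].
by exists `|f c| => x; rewrite ler_norml => xy; apply: hc; rewrite in_itv.
Qed.

Definition trunc (y : R) (f : R -> R) : R -> R := fun x => \1_(`[-y, y]) x * f x.

Lemma trunc_bmf y f : lbmf f -> bmf (trunc y f).
Proof.
move=> [mf hf]; have [C hC] := hf y; split.
  by apply: measurable_funM => //; exact: measurable_indic.
exists `|C| => x; rewrite /trunc indicE; case: (boolP (x \in _)) => h.
  rewrite mul1r (le_trans (hC _ _)) ?ler_norm//.
  by rewrite ler_norml; move: h; rewrite inE /= in_itv.
by rewrite mul0r normr0.
Qed.

Lemma truncE y f x : - y <= x <= y -> trunc y f x = f x.
Proof. by move=> xy; rewrite /trunc indicE mem_set ?mul1r//= in_itv. Qed.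

Lemma norm_le_max (a b x : R) : a <= x <= b -> `|x| <= Num.max `|a| `|b|.
Proof.
move=> /andP[ax xb]; rewrite ler_norml le_max lerNl le_max.
have := ler_norm (- a); rewrite normrN => ha; have hb := ler_norm b.
by rewrite (le_trans _ ha) ?lerN2// (le_trans xb hb) orbT.
Qed.

Lemma lbmf_integrable f b c (x y : R) : lbmf f ->
  mu.-integrable [set` Interval (BSide b x) (BSide c y)] (EFin \o f).
Proof.
move=> lf; set M := Num.max `|x| `|y|.
have [mD Doo] := finite_mset_itv b c x y.
apply: (@eq_integrable _ _ _ mu _ mD (EFin \o trunc M f)); last first.
  by apply: bmf_integrable => //; exact: trunc_bmf.
move=> z; rewrite inE /= => zxy; rewrite truncE// -ler_norml norm_le_max//.
move: zxy; rewrite in_itv /= => /andP[h1 h2]; apply/andP; split.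
  by case: b {mD Doo} h1 => //= /ltW.
by case: c {mD Doo} h2 => //= /ltW.
Qed.

Lemma int_eq a b f g : (forall x, a <= x <= b -> f x = g x) -> int a b f = int a b g.
Proof. by move=> h; apply: eq_Rintegral => x; rewrite inE /= in_itv /=; exact: h. Qed.

Lemma int_eq0 a b f : (forall x, a <= x <= b -> f x = 0) -> int a b f = 0.
Proof.
move=> h; rewrite (@eq_Rintegral _ _ _ _ _ (fun=> 0)) ?Rintegral_cst ?mul0r//.
by move=> x; rewrite inE /= in_itv /=; exact: h.
Qed.

Lemma intD a b f g : lbmf f -> lbmf g -> int a b (fun x => f x + g x) = int a b f + int a b g.
Proof. by move=> lf lg; apply: RintegralD => //; exact: lbmf_integrable. Qed.

Lemma intB a b f g : lbmf f -> lbmf g -> int a b (fun x => f x - g x) = int a b f - int a b g.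
Proof. by move=> lf lg; apply: RintegralB => //; exact: lbmf_integrable. Qed.

Lemma intZ a b c f : lbmf f -> int a b (fun x => c * f x) = c * int a b f.
Proof. by move=> lf; apply: RintegralZl => //; exact: lbmf_integrable. Qed.

Lemma int_le a b f g : lbmf f -> lbmf g -> (forall x, a <= x <= b -> f x <= g x) ->
  int a b f <= int a b g.
Proof.
move=> lf lg h; apply: le_Rintegral => //; exact: lbmf_integrable.
Qed.

Lemma int_cst a b c : a <= b -> int a b (fun=> c) = c * (b - a).
Proof.
move=> ab; rewrite Rintegral_cst//= lebesgue_measure_itv /= lte_fin.
case: ltP => //= ba; have -> : a = b by apply/eqP; rewrite eq_le ab.
by rewrite subrr mulr0.
Qed.

Lemma int_le_cst a b f c : a <= b -> lbmf f -> (forall x, a <= x <= b -> f x <= c) ->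
  int a b f <= c * (b - a).
Proof. by move=> ab lf h; rewrite -int_cst//; apply: int_le => //; exact: lbmf_cst. Qed.

Lemma int_ge_cst a b f c : a <= b -> lbmf f -> (forall x, a <= x <= b -> c <= f x) ->
  c * (b - a) <= int a b f.
Proof. by move=> ab lf h; rewrite -int_cst//; apply: int_le => //; exact: lbmf_cst. Qed.

Lemma int_norm_le a b f C : a <= b -> lbmf f -> (forall x, a <= x <= b -> `|f x| <= C) ->
  `|int a b f| <= C * (b - a).
Proof.
move=> ab lf h; apply: (le_trans (le_normr_Rintegral _ _)) => //; first exact: lbmf_integrable.
rewrite -int_cst//; apply: le_Rintegral => //.
- exact/lbmf_integrable/lbmf_norm.
- exact/lbmf_integrable/lbmf_cst.
Qed.

Lemma int_xx a f : int a a f = 0.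
Proof. by rewrite set_itv1 Rintegral_set1. Qed.

Lemma int_oc a b f : lbmf f -> \int[mu]_(s in `]a, b]) f s = int a b f.
Proof. by move=> lf; rewrite Rintegral_itv_obnd_cbnd//; exact: lbmf_integrable. Qed.

Lemma int_oo a b f : lbmf f -> \int[mu]_(s in `]a, b[) f s = int a b f.
Proof.
by move=> lf; rewrite Rintegral_itv_bndo_bndc ?int_oc//; exact: lbmf_integrable.
Qed.

Lemma int_oo0 (a b : R) f : lbmf f -> (forall x, a < x < b -> f x = 0) -> int a b f = 0.
Proof.
move=> lf h; rewrite -int_oo// (@eq_Rintegral _ _ _ _ _ (fun=> 0)) ?Rintegral_cst ?mul0r//.
by move=> x; rewrite inE /= in_itv /=; exact: h.
Qed.

Lemma int_chasles a b c f : a <= b -> b <= c -> lbmf f ->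
  int a c f = int a b f + int b c f.
Proof.
move=> ab bc lf; rewrite -(int_oc b c lf) -(@Rintegral_itvB _ _ (BLeft a) (BRight c) b) //.
- by rewrite addrC subrK.
- exact: lbmf_integrable.
Qed.

Lemma int_FTC2 (G g : R -> R) (a b : R) : (forall x : R, is_derive x (1 : R) G (g x)) ->
  continuous g -> a <= b -> int a b g = G b - G a.
Proof.
move=> dG cg; rewrite le_eqVlt => /predU1P[->|ab]; first by rewrite int_xx subrr.
have cG x : {for x, continuous G}.
  by apply/differentiable_continuous/derivable1_diffP; have [] := dG x.
rewrite /Rintegral (@continuous_FTC2 _ g G)//.
- exact: continuous_subspaceT.
- split; first by move=> x _; have [] := dG x.
  + by apply: cvg_at_right_filter; exact: cG.
  + by apply: cvg_at_left_filter; exact: cG.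
- by move=> x _; rewrite derive1E; have [_ ->] := dG x.
Qed.

Lemma continuous_expRM (k : R) : continuous (fun s : R => expR (k * s)).
Proof.
move=> x; apply: (continuous_comp (f := fun s => k * s)); last exact: continuous_expR.
exact: mulrl_continuous.
Qed.

Lemma is_derive_expRM (k x : R) : is_derive x (1 : R) (fun s : R => expR (k * s)) (k * expR (k * x)).
Proof.
have h : is_derive x (1 : R) (fun s : R => k * s) k.
  by apply: is_derive_eq; rewrite /= ?scaler0 ?add0r /GRing.scale /= mulr1.
apply: is_derive_eq; rewrite /= /GRing.scale /=; ring.
Qed.

Lemma int_expR (k a b : R) : a <= b ->
  int a b (fun s => k * expR (k * s)) = expR (k * b) - expR (k * a).
Proof.
move=> ab; apply: (@int_FTC2 (fun s => expR (k * s))) => //.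
  by move=> x; exact: is_derive_expRM.
move=> x; apply: (continuous_comp (f := fun s => expR (k * s))).
  exact: continuous_expRM.
exact: mulrl_continuous.
Qed.

Lemma lbmf_expR k : lbmf (fun s => expR (k * s)).
Proof. exact/continuous_lbmf/continuous_expRM. Qed.

Lemma bmf_ge_indic : bmf (fun p : R * R => (p.2 <= p.1)%R%:R : R).
Proof.
apply: bmf_bool; apply: measurable_fun_ler; [exact: measurable_snd|exact: measurable_fst].
Qed.

Lemma int_lt0 (a : R -> R) s : s <= 0 -> int 0 s a = 0.
Proof.
rewrite le_eqVlt => /predU1P[->|s0]; first exact: int_xx.
by rewrite set_itv_ge ?Rintegral_set0// bnd_simp -ltNge.
Qed.

Lemma prim_lip (a : R -> R) (y C s t : R) : lbmf a -> (forall x, `|x| <= y -> `|a x| <= C) ->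
  -y <= s -> s <= t -> t <= y -> `|int 0 t a - int 0 s a| <= C * (t - s).
Proof.
move=> la hC ys st ty.
have C0 : 0 <= C by apply: le_trans (hC s _) => //; rewrite ler_norml; lra.
have [t0|t0] := leP t 0.
  by rewrite !int_lt0 ?subrr ?normr0 ?mulr_ge0//; lra.
have [s0|s0] := leP s 0.
  rewrite (int_lt0 _ s0) subr0.
  apply: le_trans (int_norm_le (ltW t0) la (C := C) _) _.
    by move=> x /andP[x0 xt]; apply: hC; rewrite ler_norml; lra.
  by rewrite ler_wpM2l//; lra.
rewrite (@int_chasles 0 s t)//; last exact: ltW.
rewrite addrAC subrr add0r; apply: int_norm_le => // x /andP[sx xt].
by apply: hC; rewrite ler_norml; lra.
Qed.

Lemma continuous_prim (a : R -> R) : lbmf a -> continuous (fun s : R => int 0 s a).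
Proof.
move=> la x; have [_ /(_ (`|x| + 1))[C hC]] := la.
have C0 : 0 <= C by apply: le_trans (hC x _) => //; rewrite lerDl.
apply/cvgrPdist_le => e e0; near=> z.
have hz : `|x - z| <= Num.min 1 (e / (C + 1)).
  near: z; apply: (@cvgr_dist_le _ R^o _ _ _ id x); first exact: cvg_id.
  by rewrite lt_min ltr01 divr_gt0// ltr_wpDl.
have [hz1 hz2] : `|x - z| <= 1 /\ `|x - z| <= e / (C + 1).
  by move: hz; rewrite le_min => /andP[].
have h : C * `|x - z| <= e.
  rewrite (le_trans (ler_wpM2l C0 hz2))// mulrCA ger_pMr// ler_pdivrMr; lra.
have xl := ler_norm x; have xl' := ler_norm (- x); rewrite normrN in xl'.
move: hz1; rewrite ler_norml => /andP[h1 h2].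
have [xz|xz] := leP x z.
  rewrite distrC (le_trans (prim_lip la hC _ xz _))//; try lra.
  by rewrite -(ger0_norm (_ : 0 <= z - x)) ?subr_ge0// distrC.
rewrite (le_trans (prim_lip la hC _ (ltW xz) _))//; try lra.
by rewrite -(ger0_norm (_ : 0 <= x - z)) ?subr_ge0// ltW.
Unshelve. all: by end_near. Qed.

Lemma lbmf_prim (a : R -> R) : lbmf a -> lbmf (fun s => int 0 s a).
Proof. by move=> la; exact/continuous_lbmf/continuous_prim. Qed.

(** Fubini on the square of side [y], split along the diagonal; this covers
    the primitives of merely measurable functions. *)
Let ibp_bmf (a b : R -> R) (y : R) : 0 <= y -> bmf a -> bmf b ->
  int 0 y (fun s => a s * int 0 s b) + int 0 y (fun s => b s * int 0 s a)
  = int 0 y a * int 0 y b.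
Proof.
move=> y0 ba bb.
pose f (p : R * R) := a p.1 * (b p.2 * (p.2 <= p.1)%R%:R).
have bf : bmf f.
  apply: bmfM; first exact: (bmf_comp measurable_fst ba).
  apply: bmfM; first exact: (bmf_comp measurable_snd bb).
  exact: bmf_ge_indic.
have la := bmf_lbmf ba; have lb := bmf_lbmf bb.
have := Rintegral_exchange bf (finite_mset_itv true false 0 y) (finite_mset_itv true false 0 y).
rewrite /f /=.
have -> : int 0 y (fun s => a s * int 0 s b) =
   int 0 y (fun x => \int[mu]_(y0 in `[0, y]) (a x * (b y0 * (y0 <= x)%R%:R))).
  apply: int_eq => x /andP[x0 xy].
  have lbx : lbmf (fun r => b r * (r <= x)%R%:R).
    by have /bmf_lbmf := bmf_pair2 x (bmfM (bmf_comp measurable_snd bb) bmf_ge_indic).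
  rewrite intZ//; congr (_ * _); rewrite (int_chasles x0 xy)//.
  rewrite -[LHS]addr0; congr (_ + _).
    by apply: int_eq => r /andP[_ ->]; rewrite mulr1.
  by rewrite int_oo0// => r /andP[xr _]; rewrite leNgt xr mulr0.
move=> ->.
have -> : int 0 y (fun x => \int[mu]_(x0 in `[0, y]) (a x0 * (b x * (x <= x0)%R%:R))) =
   int 0 y (fun r => b r * int 0 y a - b r * int 0 r a).
  apply: int_eq => x /andP[x0 xy].
  have lax : lbmf (fun r => a r * (x <= r)%R%:R).
    have /bmf_lbmf := bmf_pair1 x (bmfM (bmf_comp measurable_fst ba) bmf_ge_indic).
    by [].
  under eq_Rintegral do rewrite mulrCA.
  rewrite intZ// -mulrBr; congr (_ * _); rewrite [LHS](int_chasles x0 xy)// (int_chasles x0 xy la).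
  rewrite addrAC subrr.
  congr (_ + _); last by apply: int_eq => r /andP[->]; rewrite mulr1.
  by rewrite int_oo0// => r /andP[_ rx]; rewrite leNgt rx mulr0.
have bA : bmf (trunc y (fun s => int 0 s a)) by exact/trunc_bmf/lbmf_prim.
have -> : int 0 y (fun r => b r * int 0 y a - b r * int 0 r a) =
   int 0 y (fun r => int 0 y a * b r - b r * trunc y (fun s => int 0 s a) r).
  apply: int_eq => x /andP[x0 xy]; rewrite mulrC truncE//; apply/andP; split => //.
  by rewrite (le_trans _ x0)// oppr_le0.
have -> : int 0 y (fun s => b s * int 0 s a) = int 0 y (fun r => b r * trunc y (fun s => int 0 s a) r).
  apply: int_eq => x /andP[x0 xy]; rewrite truncE//; apply/andP; split => //.
  by rewrite (le_trans _ x0)// oppr_le0.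
rewrite intB ?subrK ?intZ//.
- exact/bmf_lbmf/bmfMl.
- by apply/bmf_lbmf/bmfM.
Qed.

Lemma int_by_parts (a b : R -> R) (y : R) : 0 <= y -> lbmf a -> lbmf b ->
  int 0 y (fun s => a s * int 0 s b) + int 0 y (fun s => b s * int 0 s a)
  = int 0 y a * int 0 y b.
Proof.
move=> y0 la lb.
have E c s : 0 <= s <= y -> int 0 s c = int 0 s (trunc y c).
  move=> /andP[s0 sy]; apply: int_eq => x /andP[x0 xs]; rewrite truncE//.
  by apply/andP; split; lra.
rewrite (E a y) ?lexx ?y0// (E b y) ?lexx ?y0//.
rewrite -ibp_bmf//; try exact: trunc_bmf.
congr (_ + _); apply: int_eq => x x0y; rewrite -(E _ x)// truncE//;
  apply/andP; case/andP: x0y; split; lra.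
Qed.

End IntervalIntegrals.

(** * The linear equation along one velocity *)
Section Relaxation.
Context {R : realType}.
Local Notation mu := (@lebesgue_measure R).
Local Notation "'int' a b f" := (Rintegral mu [set` `[(a : R), (b : R)]] f)
  (at level 10, a, b, f at level 9).

Definition kexp (k : R) (m : R -> R) (s : R) := k * expR (k * s) * m s.

Lemma lbmf_kexpR (k : R) : lbmf (fun s : R => k * expR (k * s)).
Proof. by apply: lbmfMl; exact: lbmf_expR. Qed.

Lemma lbmf_kexp k m : lbmf m -> lbmf (kexp k m).
Proof.
move=> lm; apply: lbmfM => //; apply: lbmfM; [exact: lbmf_cst|exact: lbmf_expR].
Qed.

(** Solution of [f' = k (m - f)], [f 0 = c]; the rate [k] is [1 / xi]. *)
Definition duhamel (k c : R) (m : R -> R) (y : R) :=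
  expR (- (k * y)) * (c + int 0 y (kexp k m)).

Lemma lbmf_duhamel k c m : lbmf m -> lbmf (duhamel k c m).
Proof.
move=> lm; apply: lbmfM.
  by have := lbmf_expR (- k); under eq_fun do rewrite mulNr.
by apply: lbmfD; [exact: lbmf_cst|exact/lbmf_prim/lbmf_kexp].
Qed.

(** The equation is stated in integrated form because [m] is only measurable;
    it follows by parts from the primitives of [kexp k m] and of the
    exponential. *)
Lemma duhamel_ode k c m y : lbmf m -> 0 <= y ->
  duhamel k c m y - c = k * int 0 y (fun s => m s - duhamel k c m s).
Proof.
move=> lm y0.
have la : lbmf (fun s => - k * expR (- k * s)).
  by apply: lbmfM; [exact: lbmf_cst|exact: lbmf_expR].
have lk := lbmf_kexp k lm.
have := int_by_parts y0 la lk.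
rewrite int_expR// mulr0 expR0.
have lJ := lbmf_prim lk.
have lbJ : lbmf (fun s => - k * expR (- k * s) * int 0 s (kexp k m)).
  exact: lbmfM.
have -> : int 0 y (fun s => kexp k m s * int 0 s (fun r => - k * expR (- k * r))) =
    int 0 y (fun s => k * m s - kexp k m s).
  apply: int_eq => s /andP[s0 _]; rewrite int_expR// mulr0 expR0 /kexp.
  rewrite mulrBr mulr1; congr (_ - _).
  rewrite mulrAC -[RHS]mulr1; have := expRxMexpNx_1 (k * s); rewrite mulNr => <-.
  by ring.
rewrite (intB _ _ (lbmfMl k lm) lk) intZ// => H.
have -> : int 0 y (fun s => m s - duhamel k c m s) =
   int 0 y m - int 0 y (duhamel k c m).
  by rewrite intB//; exact: lbmf_duhamel.
have ld := lbmf_duhamel k c lm.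
have -> : k * (int 0 y m - int 0 y (duhamel k c m)) =
   k * int 0 y m + - k * int 0 y (duhamel k c m) by ring.
rewrite -[X in _ = _ + X](intZ _ _ (- k) ld).
have -> : int 0 y (fun s => - k * duhamel k c m s) =
   int 0 y (fun s => c * (- k * expR (- k * s)) + - k * expR (- k * s) * int 0 s (kexp k m)).
  by apply: int_eq => s _; rewrite /duhamel -mulNr; ring.
rewrite intD//; last by apply: lbmfMl; exact: (lbmf_kexpR (- k)).
rewrite (intZ _ _ c (lbmf_kexpR (- k))) int_expR// mulr0 expR0 /duhamel -mulNr.
move: H; set A := int 0 y (fun _ => _); set B := int 0 y _; set E := expR _.
set K := int 0 y m => H.
by lra.
Qed.

(** [expR (k * s) * f s] has derivative [kexp k m s]; integration by parts
    plays the part of the product rule. *)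
Lemma ode_duhamel k c m f y : lbmf m -> lbmf f ->
  (forall z, 0 <= z -> f z - c = k * int 0 z (fun s => m s - f s)) ->
  0 <= y -> f y = duhamel k c m y.
Proof.
move=> lm lf fE y0.
have la : lbmf (fun s => k * expR (k * s)).
  by apply: lbmfM; [exact: lbmf_cst|exact: lbmf_expR].
have lb : lbmf (fun s => k * (m s - f s)).
  by apply: lbmfM; [exact: lbmf_cst|exact: lbmfB].
have lmf := lbmfB lm lf.
have := int_by_parts y0 la lb.
rewrite int_expR// mulr0 expR0.
have lk := lbmf_kexp k lm.
have -> : int 0 y (fun s => k * expR (k * s) * int 0 s (fun s0 => k * (m s0 - f s0))) =
  int 0 y (fun s => k * expR (k * s) * f s - c * (k * expR (k * s))).
  by apply: int_eq => s /andP[s0 _]; rewrite intZ// -fE//; ring.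
have -> : int 0 y (fun s => k * (m s - f s) * int 0 s (fun s0 => k * expR (k * s0))) =
  int 0 y (fun s => (kexp k m s - k * expR (k * s) * f s) - k * (m s - f s)).
  by apply: int_eq => s /andP[s0 _]; rewrite int_expR// mulr0 expR0 /kexp; ring.
have laf : lbmf (fun s => k * expR (k * s) * f s) by exact: lbmfM.
rewrite intB//; last by apply: lbmfMl; rewrite //; exact: lbmf_kexpR.
rewrite intZ// int_expR// mulr0 expR0 intB//; last exact: lbmfB.
rewrite intB// intZ// -fE//.
set E := expR _; set B := int 0 y _; set A := int 0 y _ => H.
have : E * f y = c + A by lra.
rewrite /duhamel => <-; rewrite mulrA expRN mulVf ?mul1r//.
by rewrite gt_eqF// expR_gt0.
Qed.

Lemma duhamel_le k c c' m m' y : 0 <= k -> lbmf m -> lbmf m' -> c <= c' ->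
  (forall s, 0 <= s -> m s <= m' s) -> duhamel k c m y <= duhamel k c' m' y.
Proof.
move=> k0 lm lm' cc mm; rewrite /duhamel ler_wpM2l ?expR_ge0// lerD//.
apply: int_le; [exact: lbmf_kexp|exact: lbmf_kexp|].
by move=> x /andP[x0 _]; rewrite ler_wpM2l ?mulr_ge0 ?expR_ge0// mm.
Qed.

Lemma duhamel_cst k c y : 0 <= y -> duhamel k c (fun=> c) y = c.
Proof.
move=> y0; apply/esym/(@ode_duhamel k c (fun=> c) (fun=> c)) => //; try exact: lbmf_cst.
by move=> z z0; under eq_Rintegral do rewrite subrr; rewrite int_cst// mul0r mulr0 subrr.
Qed.

Definition tail (k : R) (m : R -> R) (y : R) := \int[mu]_(s in `[y, +oo[) kexp k m s.

Lemma cvg_expR_neg (k : R) : k < 0 -> expR (k * x) @[x --> +oo] --> (0 : R).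
Proof.
move=> k0.
have -> : (fun x => expR (k * x)) = (fun z : R => expR (- z)) \o (fun x => - k * x).
  by apply/funext => x /=; rewrite mulNr opprK.
apply: (@cvg_comp _ _ _ _ _ _ +oo); last exact: cvgr_expR.
by apply: gt0_cvgMry => //; rewrite oppr_gt0.
Qed.

Lemma int_expR_neg (k y : R) : k < 0 ->
  (\int[mu]_(s in `[y, +oo[) (- k * expR (k * s))%:E)%E = (expR (k * y))%:E.
Proof.
move=> k0.
rewrite (@ge0_continuous_FTC2y _ _ (fun s => - expR (k * s)) y 0).
- by rewrite EFinN sub0e oppeK.
- by move=> x _; rewrite mulr_ge0 ?expR_ge0// oppr_ge0 ltW.
- apply: continuous_subspaceT => x; apply: (continuous_comp (f := fun s => expR (k * s))).
    exact: continuous_expRM.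
  exact: mulrl_continuous.
- by rewrite -oppr0; apply: cvgN; exact: cvg_expR_neg.
- move=> x _; have h := is_derive_expRM k x.
  by apply: derivableN; case: h.
- apply: cvg_at_right_filter; apply: cvgN; exact: continuous_expRM.
- move=> x _; rewrite derive1E; have h := is_derive_expRM k x.
  by rewrite deriveN; case: h => // _ ->; rewrite mulNr.
Qed.

Lemma kexp_integrable (k y : R) m : k < 0 -> bmf m ->
  mu.-integrable `[y, +oo[ (EFin \o kexp k m).
Proof.
move=> k0 bm; have [mm [C hC]] := bm.
have C0 : 0 <= C by apply: le_trans (hC 0).
apply/integrableP; split.
  apply/measurable_EFinP; apply: measurable_funTS.
  by have [] := lbmf_kexp k (bmf_lbmf bm).
apply: (@le_lt_trans _ _ (\int[mu]_(s in `[y, +oo[) (C%:E * (- k * expR (k * s))%:E))%E).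
  apply: ge0_le_integral => //.
  - apply: measurableT_comp => //; apply/measurable_EFinP; apply: measurable_funTS.
    by have [] := lbmf_kexp k (bmf_lbmf bm).
  - apply/measurable_EFinP; apply: measurable_funTS.
    apply: measurable_funM => //; apply: measurable_funM => //.
    by have [] := @lbmf_expR R k.
  - move=> s _ /=; rewrite -EFinM lee_fin /kexp normrM normrM (ltr0_norm k0) ger0_norm ?expR_ge0//.
    by rewrite mulrC ler_wpM2r// mulr_ge0 ?expR_ge0// oppr_ge0 ltW.
rewrite ge0_integralZl//.
- by rewrite int_expR_neg// -EFinM ltry.
- apply/measurable_EFinP; apply: measurable_funTS; apply: measurable_funM => //.
  by have [] := @lbmf_expR R k.
- by move=> s _; rewrite lee_fin mulr_ge0 ?expR_ge0// oppr_ge0 ltW.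
Qed.

Lemma tail_split k m y z : k < 0 -> bmf m -> y <= z ->
  tail k m y = int y z (kexp k m) + tail k m z.
Proof.
move=> k0 bm yz.
have -> : tail k m z = \int[mu]_(s in `]z, +oo[) kexp k m s.
  rewrite Rintegral_itv_obnd_cbnd//.
  apply: integrableS (kexp_integrable z k0 bm) => //.
  by apply: subset_itvr; rewrite bnd_simp.
rewrite -(@Rintegral_itvB _ _ (BLeft y) +oo%O z)//.
  by rewrite addrC subrK.
exact: kexp_integrable.
Qed.

Lemma tail_le k (m m' : R -> R) (y : R) : k < 0 -> bmf m -> bmf m' -> (forall s, y <= s -> m s <= m' s) ->
  tail k m' y <= tail k m y.
Proof.
move=> k0 bm bm' mm; apply: le_Rintegral => //; try exact: kexp_integrable.
move=> s /=; rewrite in_itv /= andbT => ys.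
by rewrite /kexp ler_wnM2l ?mm// mulr_le0_ge0 ?expR_ge0// ltW.
Qed.

Lemma tail_cst k c y : k < 0 -> tail k (fun=> c) y = - c * expR (k * y).
Proof.
move=> k0; rewrite /tail.
have -> : \int[mu]_(s in `[y, +oo[) kexp k (fun=> c) s =
    \int[mu]_(s in `[y, +oo[) (- c * (- k * expR (k * s))).
  by apply: eq_Rintegral => s _; rewrite /kexp; ring.
rewrite RintegralZl//.
  by rewrite /Rintegral int_expR_neg.
have := @kexp_integrable k y (fun=> -1) k0 (bmf_cst _).
apply: eq_integrable => // s _; rewrite /= /kexp; congr EFin; ring.
Qed.

(** For [k < 0] the solution with initial value [- tail k m 0]: the growing
    factor [expR (- (k * y))] is compensated by the tail of the integral. *)
Definition backward (k : R) (m : R -> R) (y : R) := - (expR (- (k * y)) * tail k m y).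

Lemma backwardE k m y : k < 0 -> bmf m -> 0 <= y ->
  backward k m y = duhamel k (- tail k m 0) m y.
Proof.
by move=> k0 bm y0; rewrite /backward /duhamel (tail_split k0 bm y0); ring.
Qed.

Lemma backward_le k (m m' : R -> R) (y : R) : k < 0 -> bmf m -> bmf m' -> (forall s, y <= s -> m s <= m' s) ->
  backward k m y <= backward k m' y.
Proof.
by move=> k0 bm bm' mm; rewrite lerN2 ler_wpM2l ?expR_ge0// tail_le.
Qed.

Lemma backward_cst k c y : k < 0 -> backward k (fun=> c) y = c.
Proof.
move=> k0; rewrite /backward tail_cst// mulrCA mulrC -mulrN opprK -[RHS]mulr1 mulrC.
by congr (_ * _); rewrite mulrC expRxMexpNx_1.
Qed.

(** [backward k m y] averages [m] over [y, +oo[ with a positive density, so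
    equality for ordered sources at [y] leaves no room for a strict inequality
    later on. *)
Lemma backward_eq_later k (m m' : R -> R) (y z : R) : k < 0 -> bmf m -> bmf m' ->
  (forall s, y <= s -> m s <= m' s) -> y <= z ->
  backward k m y = backward k m' y -> backward k m z = backward k m' z.
Proof.
move=> k0 bm bm' mm yz /oppr_inj /mulfI.
rewrite gt_eqF ?expR_gt0// => /(_ isT).
rewrite (tail_split k0 bm yz) (tail_split k0 bm' yz) => H.
have h1 : int y z (kexp k m') <= int y z (kexp k m).
  apply: int_le; try exact/lbmf_kexp/bmf_lbmf.
  move=> s /andP[ys _].
  by rewrite /kexp ler_wnM2l ?mm// mulr_le0_ge0 ?expR_ge0// ltW.
have h2 : tail k m' z <= tail k m z.
  by apply: tail_le => // s zs; apply: mm; exact: le_trans zs.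
by rewrite /backward; congr (- (_ * _)); lra.
Qed.

(** The homogeneous solutions grow, so a solution that remains bounded along
    some sequence going to infinity has the initial value of [backward]. *)
Lemma bounded_duhamel k c (m : R -> R) (C : R) : k < 0 -> bmf m ->
  (forall n : nat, exists y, n%:R <= y /\ `|duhamel k c m y| <= C) ->
  c = - tail k m 0.
Proof.
move=> k0 bm h.
have [_ [D hD]] := bm.
have D0 : 0 <= D by apply: le_trans (hD 0).
have key y : 0 <= y -> `|duhamel k c m y| <= C -> `|c + tail k m 0| <= (C + D) * expR (k * y).
  move=> y0 hy; rewrite (tail_split k0 bm y0) addrA.
  have -> : c + int 0 y (kexp k m) = expR (k * y) * duhamel k c m y.
    by rewrite /duhamel mulrA expRxMexpNx_1 mul1r.
  rewrite (le_trans (ler_normD _ _))// mulrDl lerD//.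
    by rewrite normrM ger0_norm ?expR_ge0// mulrC ler_wpM2r ?expR_ge0.
  have hm s : - D <= m s <= D by rewrite -ler_norml.
  rewrite ler_norml; apply/andP; split.
    rewrite -mulNr -(tail_cst D y k0); apply: tail_le => //; first exact: bmf_cst.
    by move=> s _; case/andP: (hm s).
  rewrite -[D in leRHS]opprK -(tail_cst (- D) y k0); apply: tail_le => //; first exact: bmf_cst.
  by move=> s _; case/andP: (hm s).
have C0 : 0 <= C by have [y [_ hy]] := h 0%N; exact: le_trans hy.
apply/eqP; rewrite -subr_eq0 opprK -normr_le0; apply/ler_addgt0Pl => e e0.
rewrite addr0.
have e1 : 0 < e / (C + D + 1) by rewrite divr_gt0//; lra.
have /cvgrPdist_le/(_ _ e1)[M [_ hM]] := cvg_expR_neg k0.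
have [y [ny hy]] := h (Num.trunc (Num.max M 0)).+1.
have hMy : Num.max M 0 < y by apply: lt_le_trans ny; exact: truncnS_gt.
have y0 : 0 <= y by rewrite ltW// (le_lt_trans _ hMy)// le_max lexx orbT.
have /hM : M < y by rewrite (le_lt_trans _ hMy)// le_max lexx.
rewrite sub0r normrN ger0_norm ?expR_ge0// => hE.
apply: (le_trans (key y y0 hy)).
rewrite (le_trans (ler_wpM2l _ hE))//; first by lra.
rewrite mulrCA ger_pMr// ler_pdivrMr; lra.
Qed.

End Relaxation.

(** * The equilibrium *)
Section Equilibrium.
Context {R : realType}.
Local Notation mu := (@lebesgue_measure R).
Local Notation "'int' a b f" := (Rintegral mu [set` `[(a : R), (b : R)]] f)
  (at level 10, a, b, f at level 9).

Definition kinetic_range (xi x : R) : bool :=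
  if 0 < xi then 0 <= x <= 1 else if xi < 0 then -1 <= x <= 0 else x == 0.

Lemma equilibriumE (u xi : R) :
  equilibrium u xi = (0 < xi < u)%R%:R - (u < xi < 0)%R%:R.
Proof.
rewrite /equilibrium; have [u0|u0|->] := ltgtP u 0.
- rewrite ltr0_sg// ltr0_norm// mulN1r mulrN1 oppr_gt0 ltrN2 andbC.
  have -> : (0 < xi < u) = false by apply/negbTE/negP => /andP[]; lra.
  by rewrite sub0r.
- rewrite gtr0_sg// gtr0_norm// mul1r mulr1.
  have -> : (u < xi < 0) = false by apply/negbTE/negP => /andP[]; lra.
  by rewrite subr0.
- rewrite sgr0 mul0r.
  have -> : (0 < xi < 0) = false by apply/negbTE/negP => /andP[]; lra.
  by rewrite subrr.
Qed.

Lemma equilibrium_pos (u xi : R) : 0 < xi -> equilibrium u xi = (xi < u)%R%:R.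
Proof.
move=> xi0; rewrite equilibriumE xi0 /=.
have -> : (u < xi < 0) = false by apply/negbTE/negP => /andP[]; lra.
by rewrite subr0.
Qed.

Lemma equilibrium_neg (u xi : R) : xi < 0 -> equilibrium u xi = - (u < xi)%R%:R.
Proof.
move=> xi0; rewrite equilibriumE xi0 /= andbT.
have -> : (0 < xi < u) = false by apply/negbTE/negP => /andP[]; lra.
by rewrite sub0r.
Qed.

Lemma equilibrium_zero (u : R) : equilibrium u 0 = 0.
Proof. by rewrite equilibriumE ltxx /= andbF subrr. Qed.

Lemma equilibrium_range (u xi : R) : kinetic_range xi (equilibrium u xi).
Proof.
rewrite /kinetic_range; have [xi0|xi0|<-] := ltgtP 0 xi.
- by rewrite equilibrium_pos//; case: (_ < _); rewrite ?lexx ?ler01.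
- by rewrite equilibrium_neg//; case: (_ < _); rewrite /= ?oppr0 ?lexx ?lerN10.
- by rewrite equilibrium_zero.
Qed.

Lemma equilibrium_le (u v xi : R) : u <= v -> equilibrium u xi <= equilibrium v xi.
Proof.
move=> uv; have [xi0|xi0|<-] := ltgtP 0 xi.
- by rewrite !equilibrium_pos// ler_nat; case: ltP => // h; rewrite (lt_le_trans h).
- rewrite !equilibrium_neg// lerN2 ler_nat.
  by case: (ltP v) => // h; rewrite (le_lt_trans uv h).
- by rewrite !equilibrium_zero.
Qed.

Lemma kinetic_range_norm (xi x : R) : kinetic_range xi x -> `|x| <= 1.
Proof.
rewrite /kinetic_range ler_norml; case: ifP => _; last case: ifP => _; last move/eqP ->;
  by move=> *; apply/andP; split; lra.
Qed.

Lemma kinetic_range_dist (xi x y : R) : kinetic_range xi x -> kinetic_range xi y ->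
  `|x - y| <= 1.
Proof.
rewrite /kinetic_range ler_norml; case: ifP => _; last case: ifP => _; last move=> /eqP-> /eqP->;
  by move=> *; apply/andP; split; lra.
Qed.

(** The signs of [xi - u] and of [x - M(u, xi)] agree since [M(u, xi)] sits at an
    end of the kinetic range, the upper one if [xi < u] and the lower one if
    [u < xi]. *)
Lemma bathtub (u xi x : R) : kinetic_range xi x ->
  (xi - u) * (x - equilibrium u xi) = `|xi - u| * `|x - equilibrium u xi|.
Proof.
move=> hx; rewrite -normrM ger0_norm//; move: hx; rewrite /kinetic_range.
have [xi0|xi0|<-] := ltgtP 0 xi.
- rewrite equilibrium_pos//; case: ltP => /= h hx.
    by rewrite -mulrNN mulr_ge0//; lra.
  by rewrite mulr_ge0//; lra.
- rewrite equilibrium_neg//; case: ltP => /= h hx.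
    by rewrite mulr_ge0//; lra.
  by rewrite -mulrNN mulr_ge0//; lra.
- by move=> /eqP ->; rewrite equilibrium_zero subrr mulr0.
Qed.

Lemma equilibrium_out (L u xi : R) : `|u| <= L -> ~~ (`|xi| < L) -> equilibrium u xi = 0.
Proof.
rewrite ler_norml -leNgt => /andP[h1 h2] h3; rewrite equilibriumE.
have -> : (0 < xi < u) = false.
  by apply/negbTE/negP => /andP[h4 h5]; move: h3; rewrite gtr0_norm//; lra.
have -> : (u < xi < 0) = false.
  by apply/negbTE/negP => /andP[h4 h5]; move: h3; rewrite ltr0_norm//; lra.
by rewrite subrr.
Qed.

Lemma bmf_equilibrium d (T : measurableType d) (u w : T -> R) :
  measurable_fun setT u -> measurable_fun setT w ->
  bmf (fun p => equilibrium (u p) (w p)).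
Proof.
move=> mu_ mw.
have -> : (fun p => equilibrium (u p) (w p)) =
  (fun p => ((0 < w p) && (w p < u p))%R%:R - ((u p < w p) && (w p < 0))%R%:R).
  by apply/funext => p; rewrite equilibriumE.
apply: bmfB; apply: bmf_bool; apply: measurable_and; apply: measurable_fun_ltr => //.
Qed.

Lemma bmf_equilibrium1 (u : R) : bmf (equilibrium u).
Proof. by apply: (@bmf_equilibrium _ _ (fun=> u) id); [exact: measurable_cst|exact: measurable_id]. Qed.

Lemma bmf_equilibrium2 (u : R -> R) (xi : R) : measurable_fun setT u ->
  bmf (fun s => equilibrium (u s) xi).
Proof. by move=> mu_; apply: (@bmf_equilibrium _ _ u (fun=> xi)); [|exact: measurable_cst]. Qed.

Lemma lbmf_id : lbmf (@id R).
Proof. by apply: continuous_lbmf => x; exact: cvg_id. Qed.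

Lemma is_derive_sqr_half (x : R) : is_derive x (1 : R) (fun s : R => s ^+ 2 / 2) x.
Proof.
have -> : (fun s : R => s ^+ 2 / 2) = 2^-1 \*: (id : R -> R) ^+ 2.
  by apply/funext => s; rewrite /= /GRing.scale /= mulrC.
have := is_deriveZ (2^-1 : R) (is_deriveX 2 (is_derive_id x (1 : R))).
set d := (X in is_derive _ _ _ X -> _); have -> // : d = x.
by rewrite /d /GRing.scale /= expr1 mulr1 mulrA mulVf ?mul1r.
Qed.

Lemma int_id (a b : R) : a <= b -> int a b id = b ^+ 2 / 2 - a ^+ 2 / 2.
Proof.
move=> ab; apply: (@int_FTC2 _ (fun s : R => s ^+ 2 / 2)) => //.
- exact: is_derive_sqr_half.
- by move=> x; exact: cvg_id.
Qed.

Lemma int_equilibrium (L u : R) (f : R -> R) : `|u| <= L -> lbmf f ->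
  int (- L) L (fun xi => f xi * equilibrium u xi) =
  if 0 <= u then int 0 u f else - int u 0 f.
Proof.
rewrite ler_norml => /andP[Lu uL] lf.
have lfe : lbmf (fun xi => f xi * equilibrium u xi).
  by apply: lbmfM => //; exact/bmf_lbmf/bmf_equilibrium1.
have zero (a b : R) : (forall x, a < x < b -> equilibrium u x = 0) -> int a b (fun xi => f xi * equilibrium u xi) = 0.
  by move=> h; apply: int_oo0 => // x /h ->; rewrite mulr0.
case: ifPn => [u0|]; last rewrite -ltNge => u0.
- rewrite (@int_chasles _ (- L) 0 L)//; [|lra..].
  rewrite (@int_chasles _ 0 u L)// zero ?add0r; last first.
    move=> x /andP[_ x0]; rewrite equilibrium_neg// (_ : _ < _ = false) ?oppr0//.
    by apply/negbTE; rewrite -leNgt ltW// (lt_le_trans x0).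
  rewrite [X in _ + X]zero ?addr0.
    rewrite -int_oo// -[RHS]int_oo//; apply: eq_Rintegral => x; rewrite inE /= in_itv /=.
    by move=> /andP[x0 xu]; rewrite equilibrium_pos// xu mulr1.
  move=> x /andP[ux xL]; rewrite equilibrium_pos ?(le_lt_trans u0)//.
  by rewrite ltNge ltW.
- rewrite (@int_chasles _ (- L) 0 L)//; [|lra..].
  rewrite (@int_chasles _ (- L) u 0)//; last exact: ltW.
  rewrite zero ?add0r; last first.
    move=> x /andP[_ xu]; rewrite equilibrium_neg ?(lt_trans xu)//.
    by rewrite ltNge ltW//= oppr0.
  rewrite [X in _ + X]zero ?addr0; last first.
    by move=> x /andP[x0 xL]; rewrite equilibrium_pos// ltNge (ltW (lt_trans u0 x0)).
  rewrite -mulN1r -intZ// -int_oo// -[RHS]int_oo//; last by apply: lbmfMl.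
  apply: eq_Rintegral => x; rewrite inE /= in_itv /=.
  by move=> /andP[ux x0]; rewrite equilibrium_neg// ux mulrC.
Qed.

Lemma int_equilibrium0 (L u : R) : `|u| <= L -> int (- L) L (equilibrium u) = u.
Proof.
move=> uL; have := int_equilibrium uL (lbmf_cst 1).
under eq_Rintegral do rewrite mul1r.
move=> ->; case: ifPn => [u0|]; last rewrite -ltNge => u0.
  by rewrite int_cst// mul1r subr0.
by rewrite int_cst ?ltW// mul1r sub0r opprK.
Qed.

Lemma int_equilibrium1 (L u : R) : `|u| <= L ->
  int (- L) L (fun xi => xi * equilibrium u xi) = u ^+ 2 / 2.
Proof.
move=> uL; rewrite (int_equilibrium uL lbmf_id).
case: ifPn => [u0|]; last rewrite -ltNge => u0.
  by rewrite int_id// expr0n mul0r subr0.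
by rewrite int_id ?ltW// expr0n mul0r sub0r opprK.
Qed.

(** Among the kinetic densities of integral [u] the equilibrium minimizes the
    flux: integrate [bathtub], the multiple of [u] disappears because both
    densities have integral [u]. *)
Lemma flux_defect (L u : R) (f : R -> R) : `|u| <= L -> bmf f ->
  (forall xi, kinetic_range xi (f xi)) -> int (- L) L f = u ->
  int (- L) L (fun xi => `|xi - u| * `|f xi - equilibrium u xi|) =
  int (- L) L (fun xi => xi * f xi) - u ^+ 2 / 2.
Proof.
move=> uL bf rf fu.
have be := bmf_equilibrium1 u.
have le := bmf_lbmf be; have lf := bmf_lbmf bf.
have lxf := lbmfM lbmf_id lf; have lxe := lbmfM lbmf_id le.
transitivity (int (- L) L (fun xi => (xi * f xi - xi * equilibrium u xi) -
   u * (f xi - equilibrium u xi))).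
  by apply: int_eq => x _; rewrite -bathtub//; ring.
rewrite intB; [|exact: lbmfB|by apply: lbmfMl; exact: lbmfB].
rewrite intB// int_equilibrium1// intZ ?intB//; last exact: lbmfB.
by rewrite fu int_equilibrium0// subrr mulr0 subr0.
Qed.

Lemma measurable_inv : measurable_fun setT (fun x : R => x^-1).
Proof.
rewrite -(setvU [set (0 : R)]); apply/measurable_funU => //; first exact: measurableC.
split; last exact: measurable_fun_set1.
apply: open_continuous_measurable_fun.
  by apply: closed_openC; exact: closed_eq.
by move=> x; rewrite inE /= => /eqP x0; exact: inv_continuous.
Qed.

End Equilibrium.

(** * Relaxation towards a given state *)
Section KineticOperator.
Context {R : realType}.
Local Notation mu := (@lebesgue_measure R).
Local Notation "'int' a b f" := (Rintegral mu [set` `[(a : R), (b : R)]] f)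
  (at level 10, a, b, f at level 9).
Variables (L : R) (g : R -> R).
Hypothesis L0 : 0 < L.
Hypothesis mg : measurable_fun setT g.
Hypothesis g01 : forall xi, 0 <= g xi <= 1.

(** Bounded solution of [xi * d_y f = M(u) - f] with datum [g] for [xi > 0].
    Positions [y < 0] get the value at 0, which makes every statement that is
    continuous or measurable in [y] hold on the whole line. *)
Definition relax (u : R -> R) (p : R * R) : R :=
  if 0 < p.2 < L then
    duhamel p.2^-1 (g p.2) (fun s => equilibrium (u s) p.2) (Num.max p.1 0)
  else if - L < p.2 < 0 then
    backward p.2^-1 (fun s => equilibrium (u s) p.2) (Num.max p.1 0)
  else 0.

Implicit Types u v : R -> R.

Lemma relax_pos u xi y : 0 < xi < L -> 0 <= y ->
  relax u (y, xi) = duhamel xi^-1 (g xi) (fun s => equilibrium (u s) xi) y.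
Proof. by move=> h y0; rewrite /relax /= h max_l. Qed.

Lemma relax_neg u xi y : - L < xi < 0 -> 0 <= y ->
  relax u (y, xi) = backward xi^-1 (fun s => equilibrium (u s) xi) y.
Proof.
move=> h y0; rewrite /relax /= h max_l// ifF//.
by apply/negbTE/negP => /andP[]; lra.
Qed.

Lemma relax_out u xi y : ~~ (0 < `|xi| < L) -> relax u (y, xi) = 0.
Proof.
move=> h; rewrite /relax /=; case: ifPn => [/andP[h1 h2]|_].
  by move: h; rewrite gtr0_norm// h1 h2.
case: ifPn => [/andP[h1 h2]|//].
by move: h; rewrite ltr0_norm// oppr_gt0 h2 ltrNl h1.
Qed.

Lemma relax_max u y xi : relax u (y, xi) = relax u (Num.max y 0, xi).
Proof. by rewrite /relax /= -maxA maxxx. Qed.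

Lemma velocityP (xi : R) : [\/ 0 < xi < L, - L < xi < 0 | ~~ (0 < `|xi| < L)].
Proof.
case: (boolP (0 < xi < L)) => h1; first by constructor 1.
case: (boolP (- L < xi < 0)) => h2; first by constructor 2.
constructor 3; apply: contra h1 => /andP[h3 h4].
have [xi0|xi0|xi0] := ltgtP 0 xi.
- by move: h4; rewrite gtr0_norm.
- by exfalso; move: h2 h4; rewrite ltr0_norm// xi0 ltrNl andbT => /negP.
- by exfalso; move: h3; rewrite -xi0 normr0 ltxx.
Qed.

Lemma relax_le u v y xi : measurable_fun setT u -> measurable_fun setT v ->
  (forall s, 0 <= s -> u s <= v s) ->
  relax u (y, xi) <= relax v (y, xi).
Proof.
move=> mu_ mv uv; rewrite relax_max [leRHS]relax_max.
set z := Num.max y 0; have z0 : 0 <= z by rewrite /z le_max lexx orbT.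
have bu := bmf_equilibrium2 xi mu_; have bv := bmf_equilibrium2 xi mv.
have [h|h|h] := velocityP xi.
- rewrite !relax_pos//; apply: duhamel_le => //; [|exact: bmf_lbmf|exact: bmf_lbmf|].
    by case/andP: h => h _; rewrite invr_ge0 ltW.
  by move=> s s0; apply: equilibrium_le; exact: uv.
- rewrite !relax_neg//; apply: backward_le => //.
    by case/andP: h => _ h; rewrite invr_lt0.
  by move=> s zs; apply/equilibrium_le/uv; exact: le_trans zs.
- by rewrite !relax_out.
Qed.

Lemma relax_ext u v : measurable_fun setT u -> measurable_fun setT v ->
  (forall s, 0 <= s -> u s = v s) -> relax u = relax v.
Proof.
move=> mu_ mv uv; apply/funext => -[y xi]; apply: le_anti.
by rewrite !relax_le// => s s0; rewrite uv.
Qed.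

Lemma relax_range u y xi : measurable_fun setT u -> kinetic_range xi (relax u (y, xi)).
Proof.
move=> mu_; rewrite relax_max.
set z := Num.max y 0; have z0 : 0 <= z by rewrite /z le_max lexx orbT.
have bu := bmf_equilibrium2 xi mu_.
have := equilibrium_range _ xi; rewrite /kinetic_range => er.
have [h|h|h] := velocityP xi.
- have [xi0 _] := andP h; rewrite xi0 in er *; have k0 : 0 <= xi^-1 by rewrite invr_ge0 ltW.
  rewrite relax_pos//; apply/andP; split.
    rewrite -[leLHS](@duhamel_cst _ xi^-1 0 z)//; apply: duhamel_le => //.
    + exact: lbmf_cst.
    + exact: bmf_lbmf.
    + by case/andP: (g01 xi).
    + by move=> s _; case/andP: (er (u s)).
  rewrite -[leRHS](@duhamel_cst _ xi^-1 1 z)//; apply: duhamel_le => //.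
  + exact: bmf_lbmf.
  + exact: lbmf_cst.
  + by case/andP: (g01 xi).
  + by move=> s _; case/andP: (er (u s)).
- have [_ xi0] := andP h; have k0 : xi^-1 < 0 by rewrite invr_lt0.
  rewrite ltNge (ltW xi0) /= xi0 in er *; rewrite relax_neg//; apply/andP; split.
    rewrite -[leLHS](@backward_cst _ xi^-1 (-1) z)//; apply: backward_le => //.
    + exact: bmf_cst.
    + by move=> s _; case/andP: (er (u s)).
  rewrite -[leRHS](@backward_cst _ xi^-1 0 z)//; apply: backward_le => //.
  + exact: bmf_cst.
  + by move=> s _; case/andP: (er (u s)).
- rewrite relax_out//; case: ifP => _; first by rewrite lexx ler01.
  by case: ifP => _ //; rewrite lerN10 lexx.
Qed.

Lemma relax_bound u p : measurable_fun setT u -> `|relax u p| <= 1.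
Proof. by case: p => y xi mu_; exact: (kinetic_range_norm (relax_range y xi mu_)). Qed.

(** For each sign of [xi] the factors [xi^-1] and [equilibrium (u s) xi] have the
    same sign, so Tonelli's theorem gives measurability in the parameters
    without any integrability. *)
Lemma kexp_ge0 u xi s : 0 <= kexp xi^-1 (fun s => equilibrium (u s) xi) s.
Proof.
rewrite /kexp mulrAC mulr_ge0 ?expR_ge0//.
have := equilibrium_range (u s) xi; rewrite /kinetic_range.
case: ltgtP => [xi0|xi0|<-].
- by move=> /andP[h _]; rewrite mulr_ge0// invr_ge0 ltW.
- by move=> /andP[_ h]; rewrite mulr_le0// invr_le0 ltW.
- by rewrite invr0 mul0r.
Qed.

Lemma measurable_integral_param (b : (R * R) * R -> bool) u :
  measurable_fun setT u -> measurable_fun setT b ->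
  measurable_fun setT (fun p : R * R =>
    \int[mu]_(s in [set s | b (p, s)]) kexp p.2^-1 (fun s => equilibrium (u s) p.2) s).
Proof.
move=> mu_ mb.
have mh : measurable_fun setT (fun q : (R * R) * R => (b q)%:R *
    kexp q.1.2^-1 (fun s => equilibrium (u s) q.1.2) q.2).
  apply: measurable_funM; first by have [] := @bmf_bool _ _ R b mb.
  have m1 : measurable_fun setT (fun q : (R * R) * R => q.1.2).
    by apply: (measurableT_comp measurable_snd); exact: measurable_fst.
  have m2 : measurable_fun setT (fun q : (R * R) * R => q.1.2^-1).
    exact: (measurableT_comp measurable_inv).
  have m3 : measurable_fun setT (fun q : (R * R) * R => u q.2).
    exact: (measurableT_comp mu_ measurable_snd).
  have m4 : measurable_fun setT (fun q : (R * R) * R => expR (q.1.2^-1 * q.2)).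
    apply: (measurableT_comp (@measurable_expR R)).
    exact: (measurable_funM m2 measurable_snd).
  have [m5 _] := bmf_equilibrium m3 m1.
  exact: (measurable_funM (measurable_funM m2 m4) m5).
have mF : measurable_fun setT (fun p : R * R => \int[mu]_s ((b (p, s))%:R *
    kexp p.2^-1 (fun s => equilibrium (u s) p.2) s)%:E)%E.
  apply: (@measurable_fun_fubini_tonelli_F _ _ _ _ R mu
     (fun q : (R * R) * R => ((b q)%:R * kexp q.1.2^-1 (fun s => equilibrium (u s) q.1.2) q.2)%:E)).
    exact/measurable_EFinP.
  by move=> q; rewrite lee_fin mulr_ge0// kexp_ge0.
have -> : (fun p : R * R =>
    \int[mu]_(s in [set s | b (p, s)]) kexp p.2^-1 (fun s => equilibrium (u s) p.2) s) =
  (fun p => fine (\int[mu]_s ((b (p, s))%:R *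
    kexp p.2^-1 (fun s => equilibrium (u s) p.2) s)%:E)%E).
  apply/funext => p; rewrite /Rintegral integral_mkcond; congr fine.
  apply: eq_integral => s _; rewrite /patch /=; case: ifPn => [|/negP hs].
    by rewrite inE /= => ->; rewrite mul1r.
  have /negbTE-> : ~~ b (p, s) by apply/negP => bs; apply: hs; rewrite inE.
  by rewrite mul0r.
exact: measurableT_comp.
Qed.

Lemma measurable_relax u : measurable_fun setT u -> measurable_fun setT (relax u).
Proof.
move=> mu_.
have m1 : measurable_fun setT (fun p : R * R => p.1) by exact: measurable_fst.
have m2 : measurable_fun setT (fun p : R * R => p.2) by exact: measurable_snd.
have mm : measurable_fun setT (fun p : R * R => Num.max p.1 0).
  by apply: (measurable_maxr (f := fun p : R * R => p.1) (g := fun=> 0)) => //; exact: measurable_cst.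
have mi : measurable_fun setT (fun p : R * R => p.2^-1).
  exact: (measurableT_comp measurable_inv).
have me : measurable_fun setT (fun p : R * R => expR (- (p.2^-1 * Num.max p.1 0))).
  apply: (measurableT_comp (@measurable_expR R)).
  by apply: measurableT_comp => //; exact: measurable_funM.
have mq : measurable_fun setT (fun q : (R * R) * R => Num.max q.1.1 0).
  by apply: (measurableT_comp mm); exact: measurable_fst.
rewrite /relax; apply: measurable_fun_ifT.
- by apply: measurable_and; apply: measurable_fun_ltr => //; exact: measurable_cst.
- rewrite /duhamel; apply: measurable_funM => //; apply: measurable_funD.
    exact: (measurableT_comp mg).
  have mb : measurable_fun setT (fun q : (R * R) * R => (0 <= q.2) && (q.2 <= Num.max q.1.1 0)).
    by apply: measurable_and; apply: measurable_fun_ler => //;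
      first [exact: measurable_cst|exact: measurable_snd].
  have := measurable_integral_param mu_ mb.
  by congr measurable_fun; apply/funext => p; congr Rintegral; apply/seteqP; split => s /=;
    rewrite in_itv.
- apply: measurable_fun_ifT; last exact: measurable_cst.
    by apply: measurable_and; apply: measurable_fun_ltr => //; exact: measurable_cst.
  rewrite /backward; apply: measurableT_comp => //; apply: measurable_funM => //.
  have mb : measurable_fun setT (fun q : (R * R) * R => Num.max q.1.1 0 <= q.2).
    by apply: measurable_fun_ler => //; exact: measurable_snd.
  have := measurable_integral_param mu_ mb.
  by congr measurable_fun; apply/funext => p; congr Rintegral; apply/seteqP; split => s /=;
    rewrite in_itv /= andbT.
Qed.

Lemma bmf_relax u : measurable_fun setT u -> bmf (relax u).
Proof.
by move=> mu_; split; [exact: measurable_relax|exists 1 => p; exact: relax_bound].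
Qed.

End KineticOperator.

(** * Regularity and balance laws of the relaxation operator *)
Section RelaxDynamics.
Context {R : realType}.
Local Notation mu := (@lebesgue_measure R).
Local Notation "'int' a b f" := (Rintegral mu [set` `[(a : R), (b : R)]] f)
  (at level 10, a, b, f at level 9).
Variables (L : R) (g : R -> R).
Hypothesis L0 : 0 < L.
Hypothesis mg : measurable_fun setT g.
Hypothesis g01 : forall xi, 0 <= g xi <= 1.
Implicit Types u v : R -> R.
Let Lge0 : 0 <= L. Proof. exact: ltW. Qed.
Let Lle0 : - L <= 0. Proof. by rewrite oppr_le0. Qed.
Let LL : - L <= L. Proof. exact: le_trans Lle0 Lge0. Qed.

Notation relax := (relax L g).

Lemma int_bool_near (a b c d : R) : 0 < d ->
  int a b (fun x => (`|x - c| < d)%R%:R) <= 2 * d.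
Proof.
move=> d0; pose I : set R := [set` `]c - d, c + d[].
have -> : int a b (fun x => (`|x - c| < d)%R%:R) = int a b (\1_I).
  apply: int_eq => x _; rewrite indicE /I; congr (nat_of_bool _)%:R.
  rewrite ltr_norml; apply/idP/idP.
    by move=> /andP[h1 h2]; rewrite inE /= in_itv /=; apply/andP; split; lra.
  by rewrite inE /= in_itv /= => /andP[h1 h2]; apply/andP; split; lra.
rewrite /Rintegral integral_indic//; last exact: measurable_itv.
have h : (mu (I `&` `[a, b]) <= (2 * d)%:E)%E.
  apply: (@le_trans _ _ (mu I)).
    have mI : measurable I by exact: measurable_itv.
    have mab : measurable (I `&` `[a, b]) by apply: measurableI.
    by apply: le_measure; [exact: mem_set|exact: mem_set|exact: subIsetl].
  rewrite lebesgue_measure_itv /= lte_fin; case: ifP => _.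
    by rewrite -EFinB lee_fin; lra.
  by rewrite lee_fin mulr_ge0// ltW.
rewrite -lee_fin fineK// ge0_fin_numE//; apply: le_lt_trans h _; exact: ltry.
Qed.

Lemma lbmf_near (c d : R) : lbmf (fun x : R => (`|x - c| < d)%R%:R : R).
Proof.
apply/bmf_lbmf/bmf_bool; apply: measurable_fun_ltr; last exact: measurable_cst.
by apply: measurableT_comp => //; apply: measurable_funB => //; exact: measurable_cst.
Qed.

Lemma int_range (f : R -> R) : bmf f -> (forall xi, kinetic_range xi (f xi)) ->
  `|int (- L) L f| <= L.
Proof.
move=> bf rf; have lf := bmf_lbmf bf.
rewrite (@int_chasles _ (- L) 0 L)//.
have h1 : - L <= int (- L) 0 f <= 0.
  have le1 (x : R) : - L <= x <= 0 -> -1 <= f x <= 0.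
    move=> /andP[_ x0]; have := rf x; rewrite /kinetic_range ltNge x0 /=.
    by case: ifP => // _ /eqP ->; rewrite lexx lerN10.
  have := @int_le_cst _ (- L) 0 f 0 Lle0 lf (fun x xL => (andP (le1 x xL)).2).
  have := @int_ge_cst _ (- L) 0 f (-1) Lle0 lf (fun x xL => (andP (le1 x xL)).1).
  by rewrite mul0r sub0r opprK mulN1r => -> ->.
have h2 : 0 <= int 0 L f <= L.
  have le1 (x : R) : 0 <= x <= L -> 0 <= f x <= 1.
    move=> /andP[x0 _]; have := rf x; rewrite /kinetic_range.
    case: ifP => // _; rewrite ltNge x0 /=.
    by move=> /eqP ->; rewrite lexx ler01.
  have := @int_le_cst _ 0 L f 1 Lge0 lf (fun x xL => (andP (le1 x xL)).2).
  have := @int_ge_cst _ 0 L f 0 Lge0 lf (fun x xL => (andP (le1 x xL)).1).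
  by rewrite mul0r subr0 mul1r => -> ->.
by rewrite ler_norml; lra.
Qed.

Lemma relax0 u xi : 0 < xi < L -> relax u (0, xi) = g xi.
Proof.
move=> h; rewrite relax_pos// /duhamel mulr0 oppr0 expR0 mul1r.
by rewrite int_xx addr0.
Qed.

Lemma relax_ode u y xi : measurable_fun setT u -> (forall s, `|u s| <= L) -> 0 <= y ->
  xi * (relax u (y, xi) - relax u (0, xi)) =
  int 0 y (fun s => equilibrium (u s) xi - relax u (s, xi)).
Proof.
move=> mu_ uL y0.
have be := bmf_equilibrium2 xi mu_; have le := bmf_lbmf be.
have [h|h|h] := velocityP L xi.
- have xi0 : xi != 0 by case/andP: h => h _; rewrite gt_eqF.
  rewrite relax0// relax_pos// duhamel_ode// mulrA divff// mul1r.
  by apply: int_eq => s /andP[s0 _]; rewrite relax_pos.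
- have k0 : xi^-1 < 0 by case/andP: h => _ h; rewrite invr_lt0.
  have xi0 : xi != 0 by case/andP: h => _ h; rewrite lt_eqF.
  rewrite !relax_neg//.
  have -> : backward xi^-1 (fun s => equilibrium (u s) xi) 0 =
     - tail xi^-1 (fun s => equilibrium (u s) xi) 0.
    by rewrite /backward mulr0 oppr0 expR0 mul1r.
  rewrite backwardE// duhamel_ode// mulrA divff// mul1r.
  by apply: int_eq => s /andP[s0 _]; rewrite relax_neg// backwardE.
- rewrite !relax_out// subrr mulr0.
  rewrite int_eq0// => s _; rewrite relax_out// subr0.
  move: h; rewrite negb_and -leNgt normr_le0 => /orP[/eqP->|h].
    exact: equilibrium_zero.
  exact: (equilibrium_out (uL s)).
Qed.

(** The rate is [1 / xi] and both [relax u] and the equilibrium stay in the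
    kinetic range, whose length is 1. *)
Lemma relax_lip u y z xi : measurable_fun setT u -> (forall s, `|u s| <= L) ->
  `|xi| * `|relax u (y, xi) - relax u (z, xi)| <= `|y - z|.
Proof.
move=> mu_ uL.
have lr : lbmf (fun s => equilibrium (u s) xi - relax u (s, xi)).
  apply: lbmfB; apply: bmf_lbmf; first exact: bmf_equilibrium2.
  exact: (bmf_pair1 xi (bmf_relax L mg g01 mu_)).
wlog yz : y z / y <= z.
  move=> H; have [/H//|/ltW/H] := leP y z.
  by rewrite distrC [`|z - y|]distrC.
rewrite relax_max [relax u (z, _)]relax_max.
have : `|Num.max y 0 - Num.max z 0| <= `|y - z|.
  rewrite ler_distl; have h : `|y - z| = z - y by rewrite distrC ger0_norm// subr_ge0.
  rewrite h; case: (leP y 0) => ?; case: (leP z 0) => ?; apply/andP; split; lra.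
apply: le_trans.
have : Num.max y 0 <= Num.max z 0 by rewrite le_max2.
have : 0 <= Num.max y 0 by rewrite le_max lexx orbT.
move: (Num.max y 0) (Num.max z 0) => {yz}y {}z y0 yz.
rewrite -normrM.
have -> : xi * (relax u (y, xi) - relax u (z, xi)) =
  xi * (relax u (y, xi) - relax u (0, xi)) - xi * (relax u (z, xi) - relax u (0, xi)) by ring.
rewrite !relax_ode ?(le_trans y0 yz)// (@int_chasles _ 0 y z)//.
rewrite opprD addrA subrr sub0r normrN.
have := @int_norm_le _ y z (fun s => equilibrium (u s) xi - relax u (s, xi)) 1 yz lr.
rewrite mul1r distrC (ger0_norm (_ : 0 <= z - y)) ?subr_ge0//; apply.
move=> x _; apply: (@kinetic_range_dist _ xi); first exact: equilibrium_range.
exact: relax_range.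
Qed.

Lemma bmf_relax_y u y : measurable_fun setT u -> bmf (fun xi => relax u (y, xi)).
Proof. by move=> mu_; exact: (bmf_pair2 y (bmf_relax L mg g01 mu_)). Qed.

(** Velocities with [|xi| < d] cost at most [2 * d]; for the others
    [relax_lip] applies. *)
Lemma relax_dist u y z d : measurable_fun setT u -> (forall s, `|u s| <= L) -> 0 < d ->
  int (- L) L (fun xi => `|relax u (y, xi) - relax u (z, xi)|) <=
  2 * d + 2 * L * `|y - z| / d.
Proof.
move=> mu_ uL d0.
have -> : 2 * L * `|y - z| / d = int (- L) L (fun=> `|y - z| / d) by rewrite int_cst//; ring.
apply: (@le_trans _ _ (int (- L) L (fun x => (`|x - 0| < d)%R%:R + `|y - z| / d))).
  apply: int_le.
  - by apply/bmf_lbmf/bmf_norm/bmfB; exact: bmf_relax_y.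
  - by apply: lbmfD; [exact: lbmf_near|exact: lbmf_cst].
  move=> xi _; rewrite subr0; case: ltP => h /=.
    apply: ler_wpDr; first by rewrite divr_ge0// ltW.
    by apply: (@kinetic_range_dist _ xi); exact: relax_range.
  rewrite add0r ler_pdivlMr// mulrC.
  by apply: le_trans (relax_lip y z xi mu_ uL); rewrite ler_wpM2r.
rewrite intD ?lerD//; [exact: int_bool_near|exact: lbmf_near|exact: lbmf_cst].
Qed.

Definition mean u y := int (- L) L (fun xi => relax u (y, xi)).
Definition flux u y := int (- L) L (fun xi => xi * relax u (y, xi)).

Lemma measurable_mean u : measurable_fun setT u -> measurable_fun setT (mean u).
Proof.
move=> mu_; have bk := bmf_relax L mg g01 mu_.
by have [] := bmf_Rintegral2 bk (finite_mset_itv true false (- L) L).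
Qed.

Lemma mean_bound u y : measurable_fun setT u -> `|mean u y| <= L.
Proof.
by move=> mu_; apply: int_range; [exact: bmf_relax_y|move=> xi; exact: relax_range].
Qed.

Lemma mean_le u v y : measurable_fun setT u -> measurable_fun setT v ->
  (forall s, 0 <= s -> u s <= v s) -> mean u y <= mean v y.
Proof.
move=> mu_ mv uv; apply: int_le; try exact/bmf_lbmf/bmf_relax_y.
by move=> xi _; exact: relax_le.
Qed.

Lemma mean_modulus u y z d : measurable_fun setT u -> (forall s, `|u s| <= L) -> 0 < d ->
  `|mean u y - mean u z| <= 2 * d + 2 * L * `|y - z| / d.
Proof.
move=> mu_ uL d0; rewrite /mean -intB; try exact/bmf_lbmf/bmf_relax_y.
apply: le_trans (relax_dist y z mu_ uL d0).
apply: le_normr_Rintegral => //.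
by apply: lbmf_integrable; apply: lbmfB; exact/bmf_lbmf/bmf_relax_y.
Qed.

(** Integrate [relax_ode] against [w] and exchange the integrals.  The weight
    [1] gives conservation of mass, the weight [xi] the dissipation. *)
Lemma moment_balance u y w : measurable_fun setT u -> (forall s, `|u s| <= L) -> 0 <= y ->
  lbmf w ->
  int (- L) L (fun xi => w xi * (xi * (relax u (y, xi) - relax u (0, xi)))) =
  int 0 y (fun s => int (- L) L (fun xi => w xi * (equilibrium (u s) xi - relax u (s, xi)))).
Proof.
move=> mu_ uL y0 lw.
have bw := trunc_bmf L lw.
have be : bmf (fun p : R * R => equilibrium (u p.1) p.2).
  apply: bmf_equilibrium; last exact: measurable_snd.
  exact: (measurableT_comp mu_ measurable_fst).
have bh : bmf (fun p : R * R => trunc L w p.2 * (equilibrium (u p.1) p.2 - relax u p)).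
  apply: bmfM; first exact: (bmf_comp measurable_snd bw).
  by apply: bmfB => //; exact: bmf_relax.
transitivity (int (- L) L (fun xi => int 0 y (fun s =>
   trunc L w xi * (equilibrium (u s) xi - relax u (s, xi))))).
  apply: int_eq => xi xiL; rewrite relax_ode// intZ ?truncE//.
  apply: lbmfB; apply: bmf_lbmf; first exact: bmf_equilibrium2.
  exact: (bmf_pair1 xi (bmf_relax L mg g01 mu_)).
rewrite -(Rintegral_exchange bh (finite_mset_itv true false 0 y) (finite_mset_itv true false (- L) L)).
by apply: int_eq => s _; apply: int_eq => xi xiL; rewrite /= truncE.
Qed.

Lemma lbmf_xrelax u y : measurable_fun setT u -> lbmf (fun xi => xi * relax u (y, xi)).
Proof. by move=> mu_; apply: lbmfM; [exact: lbmf_id|exact/bmf_lbmf/bmf_relax_y]. Qed.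

Lemma flux_balance u y : measurable_fun setT u -> (forall s, `|u s| <= L) -> 0 <= y ->
  flux u y - flux u 0 = int 0 y (fun s => u s - mean u s).
Proof.
move=> mu_ uL y0; have := moment_balance mu_ uL y0 (lbmf_cst 1).
rewrite /flux -intB; try exact: lbmf_xrelax.
under eq_Rintegral do rewrite mul1r mulrBr.
move=> ->; apply: int_eq => s _.
under eq_Rintegral do rewrite mul1r.
rewrite intB ?int_equilibrium0//; apply: bmf_lbmf; [exact: bmf_equilibrium1|exact: bmf_relax_y].
Qed.

Lemma flux_moment_balance u y : measurable_fun setT u -> (forall s, `|u s| <= L) -> 0 <= y ->
  int (- L) L (fun xi => xi * (xi * (relax u (y, xi) - relax u (0, xi)))) =
  int 0 y (fun s => u s ^+ 2 / 2 - flux u s).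
Proof.
move=> mu_ uL y0; rewrite (moment_balance mu_ uL y0 (@lbmf_id R)).
apply: int_eq => s _; rewrite /flux -(int_equilibrium1 (uL s)).
rewrite -intB; last exact: lbmf_xrelax.
  by apply: int_eq => xi _; rewrite mulrBr.
by apply: lbmfM; [exact: lbmf_id|exact/bmf_lbmf/bmf_equilibrium1].
Qed.

End RelaxDynamics.

(** * Nonnegative functions of zero integral *)
Section AeZero.
Context {R : realType}.
Local Notation mu := (@lebesgue_measure R).
Local Notation "'int' a b f" := (Rintegral mu [set` `[(a : R), (b : R)]] f)
  (at level 10, a, b, f at level 9).

Lemma int_ge0 (a b : R) f : (forall x, a <= x <= b -> 0 <= f x) -> 0 <= int a b f.
Proof. by move=> h; apply: Rintegral_ge0 => x /=; rewrite in_itv; exact: h. Qed.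

Lemma int_eq0_ae (a b : R) f : lbmf f -> (forall x, a <= x <= b -> 0 <= f x) ->
  int a b f = 0 -> {ae mu, forall x, a <= x <= b -> f x = 0}.
Proof.
move=> lf f0 fz.
have mD : measurable (`[a, b] : set R) by exact: measurable_itv.
have mf : measurable_fun `[a, b] (EFin \o f).
  by apply/measurable_EFinP; apply: measurable_funTS; case: lf.
have := (ae_eq_integral_abs mu mD mf).1.
move=> H; have {}H := H _.
have : ae_eq mu (`[a, b]%classic : set R) (EFin \o f) (cst 0%E).
  apply: H.
  have -> : (\int[mu]_(x in `[a, b]) `|(EFin \o f) x| = \int[mu]_(x in `[a, b]) (f x)%:E)%E.
    apply: eq_integral => x; rewrite inE /= in_itv /= => xab.
    by rewrite ger0_norm// f0.
  have fi : (\int[mu]_(x in `[a, b]) (f x)%:E)%E \is a fin_num.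
    by apply: integrable_fin_num => //; exact: (lbmf_integrable true false a b lf).
  by rewrite -(fineK fi) -[fine _]/(int a b f) fz.
apply: filterS => x /= h xab.
have : (f x)%:E = 0%E by apply: h; rewrite /= in_itv.
by case.
Qed.

Lemma int_ae_eq (a b : R) f h : lbmf f -> lbmf h ->
  {ae mu, forall x, a <= x <= b -> f x = h x} -> int a b f = int a b h.
Proof.
move=> lf lh fh; have fh' : {ae mu, forall x, (`[a, b]%classic : set R) x -> (EFin \o f) x = (EFin \o h) x}.
  by apply: (aeS fh) => x fhx; rewrite /= in_itv /= => /fhx ->.
rewrite /Rintegral; congr fine; apply: ae_eq_integral => //.
- by apply/measurable_EFinP; apply: measurable_funTS; case: lf.
- by apply/measurable_EFinP; apply: measurable_funTS; case: lh.
Qed.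

End AeZero.

(** * Mild states: constant flux and behaviour at infinity *)
Section MildSolutions.
Context {R : realType}.
Local Notation mu := (@lebesgue_measure R).
Local Notation "'int' a b f" := (Rintegral mu [set` `[(a : R), (b : R)]] f)
  (at level 10, a, b, f at level 9).
Variables (L : R) (g : R -> R).
Hypothesis L0 : 0 < L.
Hypothesis mg : measurable_fun setT g.
Hypothesis g01 : forall xi, 0 <= g xi <= 1.
Implicit Types u v : R -> R.
Let Lge0 : 0 <= L. Proof. exact: ltW. Qed.
Let Lle0 : - L <= 0. Proof. by rewrite oppr_le0. Qed.
Let LL : - L <= L. Proof. exact: le_trans Lle0 Lge0. Qed.

Notation relax := (relax L g).
Notation mean := (mean L g).
Notation flux := (flux L g).

Definition mild u := measurable_fun setT u /\ forall y, u y = mean u y.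

Variables (u : R -> R) (mildu : mild u).
Let mu_ : measurable_fun setT u. Proof. by case: mildu. Qed.
Let uE y : u y = mean u y. Proof. by case: mildu => _; exact. Qed.

Lemma mild_bound y : `|u y| <= L.
Proof. by rewrite uE; exact: mean_bound. Qed.
Let uL := mild_bound.

Lemma mild_flux y : 0 <= y -> flux u y = flux u 0.
Proof.
move=> y0; apply/eqP; rewrite -subr_eq0 flux_balance//; apply/eqP.
by apply: int_eq0 => s _; rewrite -uE subrr.
Qed.

Let V := flux u 0.
Let D y := V - u y ^+ 2 / 2.

Lemma mild_defect y : 0 <= y ->
  int (- L) L (fun xi => `|xi - u y| * `|relax u (y, xi) - equilibrium (u y) xi|) = D y.
Proof.
move=> y0; rewrite /D /V -(mild_flux y0); apply: flux_defect => //.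
- exact: bmf_relax_y.
- by move=> xi; exact: relax_range.
- by rewrite [RHS]uE.
Qed.

Lemma mild_defect_ge0 y : 0 <= y -> u y ^+ 2 / 2 <= V.
Proof.
move=> y0; rewrite -subr_ge0 -/(D y) -mild_defect//.
by apply: int_ge0 => x _; rewrite mulr_ge0.
Qed.

(** Where [|xi - u y| < d] the difference is at most 1; elsewhere it is at most
    [d^-1] times the integrand of the defect. *)
Lemma mild_dist_equilibrium y d : 0 <= y -> 0 < d ->
  int (- L) L (fun xi => `|relax u (y, xi) - equilibrium (u y) xi|) <= 2 * d + D y / d.
Proof.
move=> y0 d0.
have bd : bmf (fun xi => `|relax u (y, xi) - equilibrium (u y) xi|).
  by apply/bmf_norm/bmfB; [exact: bmf_relax_y|exact: bmf_equilibrium1].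
have ld := bmf_lbmf bd.
have lx : lbmf (fun xi : R => `|xi - u y|).
  by apply: continuous_lbmf => x; apply: cvg_norm; apply: cvgB; [exact: cvg_id|exact: cvg_cst].
have lxd := lbmfM lx ld.
have := @int_le _ (- L) L (fun xi => `|relax u (y, xi) - equilibrium (u y) xi|)
  (fun xi => (`|xi - u y| < d)%R%:R +
     d^-1 * (`|xi - u y| * `|relax u (y, xi) - equilibrium (u y) xi|)) ld.
move=> /(_ (lbmfD (lbmf_near (u y) d) (lbmfMl _ lxd))) H.
apply: (le_trans (H _)).
  move=> xi _; case: ltP => h /=.
    apply: ler_wpDr; first by rewrite !mulr_ge0// invr_ge0 ltW.
    by apply: (@kinetic_range_dist _ xi); [exact: relax_range|exact: equilibrium_range].
  by rewrite add0r mulrA ler_peMl// mulrC ler_pdivlMr// mul1r.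
rewrite intD ?intZ ?mild_defect//; [|exact: lbmf_near|exact: lbmfMl].
by rewrite mulrC lerD// int_bool_near.
Qed.

Lemma mild_modulus y z d : 0 < d -> `|u y - u z| <= 2 * d + 2 * L * `|y - z| / d.
Proof. by move=> d0; rewrite [u y]uE [u z]uE; exact: mean_modulus. Qed.

Lemma mild_unif_continuous e : 0 < e ->
  exists2 h, 0 < h & forall y z, `|y - z| <= h -> `|u y - u z| <= e.
Proof.
move=> e0; pose d := e / 4; have d0 : 0 < d by rewrite divr_gt0.
exists (d * e / (4 * L)); first by rewrite divr_gt0 ?mulr_gt0.
move=> y z yz; apply: (le_trans (mild_modulus y z d0)).
have -> : e = 2 * d + e / 2 by rewrite /d; field.
rewrite lerD2l ler_pdivrMr//.
have := ler_wpM2l (_ : 0 <= 2 * L) yz.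
rewrite mulr_ge0// => /(_ isT); move/le_trans; apply.
suff -> : 2 * L * (d * e / (4 * L)) = e / 2 * d by [].
by field; rewrite gt_eqF.
Qed.

Lemma mild_continuous : continuous u.
Proof.
move=> x; apply/cvgrPdist_le => e e0.
have [h h0 H] := mild_unif_continuous e0.
near=> z; apply: H; near: z.
by apply: (@cvgr_dist_le _ R^o _ _ _ id x); first exact: cvg_id.
Unshelve. all: by end_near. Qed.

Lemma mild_lbmf : lbmf u.
Proof. exact/continuous_lbmf/mild_continuous. Qed.

Let lD : lbmf D.
Proof.
apply: lbmfB; first exact: lbmf_cst.
by apply: (lbmfM (g := fun=> _)); [|exact: lbmf_cst];
  under eq_fun do rewrite expr2; exact/lbmfM/mild_lbmf/mild_lbmf.
Qed.

Let D_ge0 y : 0 <= y -> 0 <= D y.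
Proof. by move=> y0; rewrite subr_ge0 mild_defect_ge0. Qed.

(** The moment of weight [xi^2] is bounded uniformly in [y], and its
    variation is the integral of the defect. *)
Lemma mild_defect_integral y : 0 <= y -> int 0 y D <= 2 * L ^+ 3.
Proof.
move=> y0.
have := flux_moment_balance mg g01 mu_ uL y0.
have -> : int 0 y (fun s => u s ^+ 2 / 2 - flux u s) = - int 0 y D.
  rewrite -mulN1r -intZ//; apply: int_eq => s /andP[s0 _].
  by rewrite mild_flux// /D mulN1r opprB.
move=> H; rewrite -[leLHS]opprK -H.
have lh : lbmf (fun xi : R => xi * (xi * (relax u (y, xi) - relax u (0, xi)))).
  by do 2 (apply: lbmfM; first exact: lbmf_id); apply: lbmfB; exact/bmf_lbmf/bmf_relax_y.
apply: (le_trans (ler_norm _)); rewrite normrN.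
have -> : 2 * L ^+ 3 = L ^+ 2 * (L - - L) by ring.
apply: int_norm_le => // x; rewrite -ler_norml => xL.
rewrite !normrM mulrA -expr2 -[leRHS]mulr1 ler_pM ?sqr_ge0//.
  by rewrite ler_sqr.
by apply: (@kinetic_range_dist _ x); exact: relax_range.
Qed.

(** Barbalat's lemma: a nonnegative function with bounded primitive and
    uniformly continuous tends to 0, since each point where it is at least [e]
    contributes at least [h * (e / 2)] to the integral. *)
Lemma mild_defect_to0 e : 0 < e -> exists2 Y, 0 <= Y & forall y, Y <= y -> D y < e.
Proof.
move=> e0; apply: contrapT => hN.
have {}hN Y : 0 <= Y -> exists2 y, Y <= y & e <= D y.
  move=> Y0; apply: contrapT => hn; apply: hN; exists Y => // y Yy.
  by rewrite ltNge; apply/negP => ey; apply: hn; exists y.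
have eL : 0 < e / (2 * L) by rewrite divr_gt0 ?mulr_gt0.
have [h h0 uh] := mild_unif_continuous eL.
have Dh y z : `|y - z| <= h -> D y - e / 2 <= D z.
  move=> /uh H.
  have h1 : `|(u z - u y) * (u z + u y)| <= e.
    rewrite normrM distrC (le_trans (ler_pM _ _ H (_ : _ <= 2 * L)))//.
      by rewrite (le_trans (ler_normD _ _))// mulr_natl mulr2n lerD.
    by rewrite -mulrA mulVf ?mulr1// gt_eqF ?mulr_gt0.
  have := le_trans (ler_norm _) h1; rewrite /D; set a := u z; set b := u y => h2.
  have : (a - b) * (a + b) = a ^+ 2 - b ^+ 2 by ring.
  by lra.
have step n : exists2 Y, 0 <= Y & n%:R * (h * (e / 2)) <= int 0 Y D.
  elim: n => [|n [Y Y0 HY]]; first by exists 0; rewrite // mul0r int_xx.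
  have [y Yy ey] := hN Y Y0; have y0 := le_trans Y0 Yy.
  have yh : y <= y + h by rewrite lerDl ltW.
  exists (y + h); first exact: le_trans yh.
  rewrite (@int_chasles _ 0 y)// (@int_chasles _ 0 Y)//.
  have h1 : 0 <= int Y y D.
    by apply: int_ge0 => x /andP[Yx _]; apply: D_ge0; exact: le_trans Yx.
  have h2 : h * (e / 2) <= int y (y + h) D.
    have := @int_ge_cst _ y (y + h) D (e / 2) yh lD.
    rewrite (_ : e / 2 * (y + h - y) = h * (e / 2)); last by ring.
    apply => x /andP[yx xyh].
    have : D y - e / 2 <= D x.
      by apply: Dh; rewrite distrC ger0_norm ?subr_ge0// lerBlDl.
    by lra.
  by rewrite -natr1 mulrDl mul1r; lra.
have he : 0 < h * (e / 2) by rewrite mulr_gt0// divr_gt0.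
have [Y Y0] := step (Num.trunc (2 * L ^+ 3 / (h * (e / 2)))).+1.
apply/negP; rewrite -ltNge.
apply: (le_lt_trans (mild_defect_integral Y0)).
by rewrite -ltr_pdivrMr// truncnS_gt.
Qed.

(** Velocities [xi <= 0] only see the future, where [M(u, xi) = 0]. *)
Lemma relax_nonneg_zero y xi : 0 <= y -> (forall s, y <= s -> 0 <= u s) -> xi <= 0 ->
  relax u (y, xi) = 0.
Proof.
move=> y0 us; rewrite le_eqVlt => /predU1P[->|xi0].
  by rewrite relax_out// normr0 ltxx.
have [h|h|h] := velocityP L xi; last by rewrite relax_out.
  by case/andP: h => /lt_trans/(_ xi0); rewrite ltxx.
rewrite relax_neg//; apply: le_anti.
have k0 : xi^-1 < 0 by rewrite invr_lt0.
have be := bmf_equilibrium2 xi mu_.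
apply/andP; split.
  rewrite -[leRHS](@backward_cst _ xi^-1 0 y)//; apply: backward_le => //.
    exact: bmf_cst.
  by move=> s _; rewrite equilibrium_neg// oppr_le0 ler0n.
rewrite -[leLHS](@backward_cst _ xi^-1 0 y)//; apply: backward_le => //.
  exact: bmf_cst.
move=> s ys; rewrite equilibrium_neg// ltNge (le_trans (ltW xi0) (us s ys)) /=.
by rewrite oppr0.
Qed.

Lemma flux_le_mean y : 0 <= y -> (forall s, y <= s -> 0 <= u s) -> V <= L * u y.
Proof.
move=> y0 us; rewrite /V -(mild_flux y0) uE -intZ; last exact/bmf_lbmf/bmf_relax_y.
apply: int_le; [exact: lbmf_xrelax|exact/lbmfMl/bmf_lbmf/bmf_relax_y|].
move=> xi /andP[_ xL]; have [x0|x0] := leP xi 0.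
  by rewrite relax_nonneg_zero// !mulr0.
rewrite ler_wpM2r//; have := relax_range L g01 y xi mu_.
by rewrite /kinetic_range x0 => /andP[].
Qed.

Lemma flux0_split : V = int (- L) 0 (fun xi => xi * relax u (0, xi)) + int 0 L (fun xi => xi * g xi).
Proof.
rewrite /V /flux (@int_chasles _ _ 0)//; last exact: lbmf_xrelax.
congr (_ + _).
have lg : lbmf (fun xi => xi * g xi).
  apply: lbmfM; first exact: lbmf_id.
  split=> // y; exists 1 => x _; have /andP[h1 h2] := g01 x.
  by rewrite ger0_norm.
rewrite -int_oo; last exact: lbmf_xrelax.
rewrite -[RHS]int_oo//; apply: eq_Rintegral => x; rewrite inE /= in_itv /= => h.
by rewrite relax0.
Qed.

Lemma mild_nonneg_flux : (forall s, 0 <= s -> 0 <= u s) -> V = int 0 L (fun xi => xi * g xi).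
Proof.
move=> us; rewrite flux0_split.
rewrite (@int_eq0 _ (- L) 0) ?add0r//.
by move=> x /andP[_ x0]; rewrite relax_nonneg_zero ?mulr0.
Qed.

(** [|u|] tends to [c > 0] and [u] is continuous, so [u] has eventually a
    constant sign. *)
Lemma mild_dichotomy c : 0 < c -> V = c ^+ 2 / 2 ->
  (forall s, 0 <= s -> 0 <= u s) \/
  (forall e, 0 < e -> exists2 Y, 0 <= Y & forall y, Y <= y -> `|u y + c| < e).
Proof.
move=> c0 Vc.
have near e : 0 < e -> exists2 Y, 0 <= Y & forall y, Y <= y -> c - `|u y| < e.
  move=> e0; have ce : 0 < e * c / 2 by rewrite divr_gt0 ?mulr_gt0.
  have [Y Y0 HY] := mild_defect_to0 ce; exists Y => // y Yy.
  have := HY y Yy; rewrite /D Vc -(real_normK (num_real (u y))).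
  set a := `|u y| => H.
  have a0 : 0 <= a by exact: normr_ge0.
  have H2 : (c - a) * (c + a) < e * c.
    have -> : (c - a) * (c + a) = c ^+ 2 - a ^+ 2 by ring.
    by lra.
  have [ca|ca] := leP c a; first by rewrite (le_lt_trans _ e0)// subr_le0.
  rewrite -(ltr_pM2r c0) (le_lt_trans _ H2)// ler_wpM2l ?subr_ge0 ?lerDl//.
  exact: ltW.
have c2 : 0 < c / 2 by rewrite divr_gt0.
have [Y Y0 HY] := near _ c2.
have big y : Y <= y -> c / 2 < `|u y| by move=> /HY; lra.
have nz y : Y <= y -> u y != 0 by move=> /big h; apply: contraTneq h => ->; rewrite normr0 -leNgt ltW.
have cu (a b : R) : {within `[a, b], continuous u}.
  by apply: continuous_subspaceT; exact: mild_continuous.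
have [uY|uY] := leP (u Y) 0.
- right => e e0; have [Z Z0 HZ] := near _ e0.
  exists (Num.max Y Z); first by rewrite le_max Y0.
  move=> y; rewrite ge_max => /andP[Yy Zy].
  have uy : u y < 0.
    rewrite ltNge; apply/negP => uy.
    have [//||x] := @IVT R u Y y 0 Yy.
      by rewrite ge_min uY le_max uy orbT.
    by rewrite in_itv /= => /andP[Yx _] ux; move: (nz x Yx); rewrite ux eqxx.
  have := HZ y Zy; rewrite ltr0_norm// opprK => H.
  have : u y ^+ 2 <= c ^+ 2.
    by have := mild_defect_ge0 (le_trans Y0 Yy); rewrite Vc; lra.
  rewrite -(real_normK (num_real (u y))) ler_sqr ?nnegrE// ?(ltW c0)// ltr0_norm// => H2.
  by rewrite ger0_norm; lra.
- left.
  have pos y : Y <= y -> 0 <= u y.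
    move=> Yy; rewrite leNgt; apply/negP => uy.
    have [//||x] := @IVT R u Y y 0 Yy.
      by rewrite ge_min (ltW uy) orbT le_max (ltW uY).
    by rewrite in_itv /= => /andP[Yx _] ux; move: (nz x Yx); rewrite ux eqxx.
  have VL : 0 < V / L by rewrite divr_gt0// Vc divr_gt0// exprn_gt0.
  have [h h0 uh] := mild_unif_continuous VL.
  (* By [flux_le_mean] u >= V / L wherever u >= 0 on the right; as u varies by
     at most V / L over a length h, positivity extends h further to the left. *)
  have step n s : Num.max 0 (Y - n%:R * h) <= s -> 0 <= u s.
    elim: n s => [|n IHn] s; first by rewrite mul0r subr0 ge_max => /andP[_ /pos].
    rewrite ge_max => /andP[s0 sY].
    set z := Num.max 0 (Y - n%:R * h) in IHn.
    have [zs|sz] := leP z s; first exact: IHn.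
    have z0 : 0 <= z by rewrite /z le_max lexx.
    have Vz : V <= L * u z by apply: flux_le_mean.
    have {}Vz : V / L <= u z by rewrite ler_pdivrMr// mulrC.
    have zh : z - s <= h.
      move: sY; rewrite /z -natr1 mulrDl mul1r => sY.
      by rewrite lerBlDr ge_max; apply/andP; split; lra.
    have : `|z - s| <= h by rewrite ger0_norm// subr_ge0 ltW.
    move=> /uh; rewrite ler_norml => /andP[_]; lra.
  move=> s s0; apply: (step (Num.trunc (Y / h)).+1); rewrite ge_max s0 /=.
  apply: le_trans s0; rewrite subr_le0 -ler_pdivrMr//; apply/ltW/truncnS_gt.
Qed.

(** All the flux is incoming, so nothing leaves at 0; for [xi < 0] the value
    at 0 is an average of nonpositive equilibria over the half line, which
    therefore vanish, and only the nonnegative part of [relax u] remains. *)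
Lemma min_flux_nonneg : V = int 0 L (fun xi => xi * g xi) ->
  forall s, 0 <= s -> 0 <= u s.
Proof.
move=> VE s s0.
have z0 : int (- L) 0 (fun xi => xi * relax u (0, xi)) = 0.
  by have := flux0_split; rewrite -VE => /eqP; rewrite -subr_eq subrr => /eqP <-.
have rng y xi : xi < 0 -> -1 <= relax u (y, xi) <= 0.
  by move=> x0; have := relax_range L g01 y xi mu_; rewrite /kinetic_range ltNge (ltW x0) x0.
have ae0 := int_eq0_ae (lbmf_xrelax L mg g01 0 mu_) _ z0.
have {}ae0 : {ae mu, forall x, - L <= x <= 0 -> relax u (s, x) = 0}.
  have {}ae0 : {ae mu, forall x, - L <= x <= 0 -> x * relax u (0, x) = 0}.
    apply: ae0 => x /andP[_]; rewrite le_eqVlt => /predU1P[->|x0]; first by rewrite mul0r.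
    by rewrite mulr_le0// ?(ltW x0)//; case/andP: (rng 0 x x0).
  apply: (aeS ae0) => x h xL; have {h} := h xL.
  case/andP: xL => Lx; rewrite le_eqVlt => /predU1P[->|x0].
    by move=> _; rewrite relax_out// normr0 ltxx.
  move/eqP; rewrite mulf_eq0 (lt_eqF x0) /= => /eqP.
  have [h|h|h] := velocityP L x; last by rewrite !relax_out.
    by case/andP: h => /lt_trans/(_ x0); rewrite ltxx.
  rewrite !relax_neg//; have k0 : x^-1 < 0 by rewrite invr_lt0.
  rewrite -[X in _ = X -> _](@backward_cst _ x^-1 0 0)// => H.
  rewrite -[RHS](@backward_cst _ x^-1 0 s)//.
  apply: (backward_eq_later k0 _ _ _ s0 H).
  - exact: bmf_equilibrium2.
  - exact: bmf_cst.
  - by move=> r _; rewrite equilibrium_neg// oppr_le0 ler0n.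
rewrite uE /mean (@int_chasles _ _ 0)//; last exact/bmf_lbmf/bmf_relax_y.
rewrite (int_ae_eq _ (lbmf_cst 0) ae0); last exact/bmf_lbmf/bmf_relax_y.
rewrite int_cst// mul0r add0r; apply: int_ge0 => x /andP[x0 _].
have := relax_range L g01 s x mu_; rewrite /kinetic_range.
by case: ifP => [_ /andP[]//|_]; rewrite ltNge x0 /= => /eqP ->.
Qed.

End MildSolutions.

(** * Null sets of the plane and dominated convergence *)
Section NullSets.
Context {R : realType}.
Local Notation mu := (@lebesgue_measure R).

Lemma leb2_xsection (A : set (R * R)) : measurable A ->
  @leb2 R A = (\int[mu]_x mu (xsection A x))%E.
Proof. by []. Qed.

Lemma leb2_ysection (A : set (R * R)) : measurable A ->
  @leb2 R A = (\int[mu]_y mu (ysection A y))%E.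
Proof.
move=> mA.
have mf : measurable_fun setT (EFin \o (\1_A : R * R -> R)).
  by apply/measurable_EFinP; exact: measurable_indic.
have f0 : forall z, (0 <= (EFin \o (\1_A : R * R -> R)) z)%E by move=> z; rewrite lee_fin.
have := @fubini_tonelli2 _ _ _ _ R mu mu (EFin \o (\1_A : R * R -> R)) mf f0.
rewrite integral_indic// setIT => H; rewrite /leb2 [LHS]H.
apply: eq_integral => y _; rewrite /fubini_G.
have -> : (fun x => (EFin \o (\1_A : R * R -> R)) (x, y)) = EFin \o \1_(ysection A y).
  apply/funext => x /=; rewrite !indicE; congr (nat_of_bool _)%:R%:E.
  by apply/idP/idP; rewrite ?inE /ysection /= inE.
by rewrite integral_indic ?setIT//; exact: measurable_ysection.
Qed.

Lemma integral_ge0_eq0 (f : R -> \bar R) : measurable_fun setT f ->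
  (forall x, (0 <= f x)%E) ->
  (\int[mu]_x f x = 0)%E <-> {ae mu, forall x, f x = 0%E}.
Proof.
move=> mf f0.
have H := ae_eq_integral_abs mu (@measurableT _ R) mf.
have E : (\int[mu]_x `|f x| = \int[mu]_x f x)%E.
  by apply: eq_integral => x _; rewrite gee0_abs.
rewrite E in H; split.
  by move=> /(H.1) h; apply: (aeS h) => x /(_ I).
by move=> h; apply: (H.2); apply: (aeS h) => x hx _.
Qed.

Lemma leb2_null1 (A : set (R * R)) : measurable A ->
  @leb2 R A = 0%E <-> {ae mu, forall x, mu (xsection A x) = 0%E}.
Proof.
by move=> mA; rewrite leb2_xsection//; apply: integral_ge0_eq0 => //; exact: measurable_fun_xsection.
Qed.

Lemma leb2_null2 (A : set (R * R)) : measurable A ->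
  @leb2 R A = 0%E <-> {ae mu, forall y, mu (ysection A y) = 0%E}.
Proof.
by move=> mA; rewrite leb2_ysection//; apply: integral_ge0_eq0 => //; exact: measurable_fun_ysection.
Qed.

Lemma ae_null (A : set R) : measurable A -> mu A = 0%E -> {ae mu, forall x, ~ A x}.
Proof. by move=> mA A0; exists A; split => // x /contrapT. Qed.

Lemma ae_leb2_1 (P : R * R -> Prop) : {ae @leb2 R, forall p, P p} ->
  {ae mu, forall x, {ae mu, forall y, P (x, y)}}.
Proof.
move=> [N [mN N0 PN]]; have h := (leb2_null1 mN).1 N0.
apply: (aeS h) => x hx; exists (xsection N x); split => //.
  exact: measurable_xsection.
by move=> y /= Pxy; rewrite /xsection /= inE; apply: PN.
Qed.

Lemma ae_mu0 (A : set R) : measurable A -> {ae mu, forall x, ~ A x} -> mu A = 0%E.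
Proof.
move=> mA [N [mN N0 AN]]; apply/eqP; rewrite -measure_le0 -N0.
by apply: le_measure; [exact: mem_set|exact: mem_set|move=> x Ax; apply: AN => /=; apply].
Qed.

Lemma ae2_leb2 (A : set (R * R)) : measurable A ->
  {ae mu, forall y, {ae mu, forall x, ~ A (x, y)}} -> {ae @leb2 R, forall p, ~ A p}.
Proof.
move=> mA h; exists A; split => //; last by move=> p /contrapT.
apply/(leb2_null2 mA); apply: (aeS h) => y hy.
apply: ae_mu0; first exact: measurable_ysection.
by apply: (aeS hy) => x; rewrite /ysection /= inE.
Qed.

(** The equilibrium is discontinuous in [u] only at [u = xi]; for almost every
    velocity this is avoided at almost every position. *)
Lemma graph_null (u : R -> R) : measurable_fun setT u ->
  {ae mu, forall xi, {ae mu, forall s, u s != xi}}.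
Proof.
move=> mu_.
pose A : set (R * R) := [set p | u p.1 == p.2].
have mA : measurable A.
  have mb : measurable_fun setT (fun p : R * R => u p.1 == p.2).
    by apply: measurable_fun_eqr => //; exact: (measurableT_comp mu_ measurable_fst).
  exact: measurable_set_bool mb.
have A0 : @leb2 R A = 0%E.
  apply/(leb2_null1 mA); apply: aeW => x.
  have -> : xsection A x = [set u x].
    apply/seteqP; split => y; rewrite /xsection /= inE /A /=; first by move=> /eqP ->.
    by move=> ->.
  exact: lebesgue_measure_set1.
have h := (leb2_null2 mA).1 A0; apply: (aeS h) => xi hxi.
have := ae_null (measurable_ysection xi mA) hxi.
move=> h2; apply: (aeS h2) => s; rewrite /ysection /= inE /A /= => /negP.
by [].
Qed.

End NullSets.

Section DCT.
Context {R : realType}.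
Local Notation mu := (@lebesgue_measure R).

Lemma Rintegral_dct (D : set R) (f_ : nat -> R -> R) (f G : R -> R) :
  measurable D -> (forall n, measurable_fun setT (f_ n)) -> measurable_fun setT f ->
  mu.-integrable D (EFin \o G) ->
  (forall n x, D x -> `|f_ n x| <= G x) ->
  {ae mu, forall x, D x -> f_ n x @[n --> \oo] --> f x} ->
  \int[mu]_(x in D) f_ n x @[n --> \oo] --> \int[mu]_(x in D) f x.
Proof.
move=> mD mf_ mf iG fG cvf.
have [] := @dominated_convergence _ _ _ mu D mD (fun n => EFin \o f_ n) (EFin \o f) (EFin \o G).
- by move=> n; apply/measurable_EFinP; apply: measurable_funTS; exact: mf_.
- by apply/measurable_EFinP; apply: measurable_funTS; exact: mf.
- by apply: (aeS cvf) => x h Dx; apply/fine_cvgP; split; [by near=> n|exact: h].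
- exact: iG.
- by apply: aeW => x n Dx /=; rewrite lee_fin; exact: fG.
move=> intf _ H; apply: fine_cvg; rewrite /Rintegral fineK; first exact: H.
exact: integrable_fin_num.
Unshelve. all: by end_near. Qed.

End DCT.

(** * The least mild state *)
Section Iteration.
Context {R : realType}.
Local Notation mu := (@lebesgue_measure R).
Local Notation "'int' a b f" := (Rintegral mu [set` `[(a : R), (b : R)]] f)
  (at level 10, a, b, f at level 9).
Variables (L : R) (g : R -> R).
Hypothesis L0 : 0 < L.
Hypothesis mg : measurable_fun setT g.
Hypothesis g01 : forall xi, 0 <= g xi <= 1.
Implicit Types u v : R -> R.
Let Lge0 : 0 <= L. Proof. exact: ltW. Qed.
Let Lle0 : - L <= 0. Proof. by rewrite oppr_le0. Qed.
Let LL : - L <= L. Proof. exact: le_trans Lle0 Lge0. Qed.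

Notation relax := (relax L g).
Notation mean := (mean L g).
Notation flux := (flux L g).
Notation mild := (mild L g).

Lemma equilibrium_cvg (v : nat -> R) (u xi : R) :
  v n @[n --> \oo] --> u -> u != xi ->
  equilibrium (v n) xi @[n --> \oo] --> equilibrium u xi.
Proof.
move=> vu uxi; apply: cvg_near_cst.
have [lt|gt|/eqP] := ltgtP u xi; last by rewrite (negbTE uxi).
- have : \forall n \near \oo, v n < xi by apply: (cvgr_lt u).
  apply: filterS => n h; rewrite !equilibriumE.
  by rewrite h lt (ltNge _ (v n)) (ltNge _ u) (ltW h) (ltW lt) /= !andbF.
- have : \forall n \near \oo, xi < v n by apply: (cvgr_gt u).
  apply: filterS => n h; rewrite !equilibriumE.
  by rewrite h gt (ltNge (v n)) (ltNge u) (ltW h) (ltW gt) /= !andbT.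
Qed.

Lemma kexp_bound k (w : R -> R) s : (forall s, `|w s| <= 1) ->
  `|kexp k w s| <= `|k| * expR (k * s).
Proof.
move=> w1; rewrite /kexp !normrM (ger0_norm (expR_ge0 _)).
by rewrite ler_piMr ?mulr_ge0 ?expR_ge0.
Qed.

(** Off the null set of [graph_null] the equilibria converge pointwise, and the
    exponential weights dominate. *)
Lemma relax_cvg (v : nat -> R -> R) u :
  (forall n, measurable_fun setT (v n)) -> measurable_fun setT u ->
  (forall s, 0 <= s -> v n s @[n --> \oo] --> u s) ->
  {ae mu, forall xi, forall y, relax (v n) (y, xi) @[n --> \oo] --> relax u (y, xi)}.
Proof.
move=> mv mu_ vu; apply: (aeS (graph_null mu_)) => xi hxi y.
have -> : (fun n => relax (v n) (y, xi)) = (fun n => relax (v n) (Num.max y 0, xi)).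
  by apply/funext => n; rewrite relax_max.
rewrite relax_max; set z := Num.max y 0.
have z0 : 0 <= z by rewrite /z le_max lexx orbT.
have e1 (w : R -> R) (s : R) : `|equilibrium (w s) xi| <= 1.
  exact: (kinetic_range_norm (equilibrium_range (w s) xi)).
have cvk k : {ae mu, forall s, 0 <= s -> kexp k (fun s => equilibrium (v n s) xi) s @[n --> \oo] -->
     kexp k (fun s => equilibrium (u s) xi) s}.
  apply: (aeS hxi) => s us s0; apply: cvgMr; apply: equilibrium_cvg => //.
  exact: vu.
have mk k w : measurable_fun setT w -> measurable_fun setT (kexp k (fun s => equilibrium (w s) xi)).
  by move=> mw; have [] := lbmf_kexp k (bmf_lbmf (bmf_equilibrium2 xi mw)).
have [h|h|h] := velocityP L xi.
- rewrite relax_pos//.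
  have -> : (fun n => relax (v n) (z, xi)) =
      (fun n => duhamel xi^-1 (g xi) (fun s => equilibrium (v n s) xi) z).
    by apply/funext => n; rewrite relax_pos.
  apply: cvgMr; apply: cvgD; first exact: cvg_cst.
  apply: (@Rintegral_dct _ _ (fun n => kexp xi^-1 (fun s => equilibrium (v n s) xi))
    (kexp xi^-1 (fun s => equilibrium (u s) xi)) (fun s => `|xi^-1| * expR (xi^-1 * s))) => //.
  + by move=> n; exact: mk.
  + exact: mk.
  + by apply: lbmf_integrable; apply: lbmfMl; exact: lbmf_expR.
  + by move=> n x _; apply: kexp_bound => s; exact: e1.
  + by apply: (aeS (cvk xi^-1)) => s hs /=; rewrite in_itv /= => /andP[s0 _]; exact: hs.
- rewrite relax_neg//.
  have -> : (fun n => relax (v n) (z, xi)) =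
      (fun n => backward xi^-1 (fun s => equilibrium (v n s) xi) z).
    by apply/funext => n; rewrite relax_neg.
  have k0 : xi^-1 < 0 by case/andP: h => _ h; rewrite invr_lt0.
  apply: cvgN; apply: cvgMr.
  apply: (@Rintegral_dct _ _ (fun n => kexp xi^-1 (fun s => equilibrium (v n s) xi))
    (kexp xi^-1 (fun s => equilibrium (u s) xi)) (fun s => kexp xi^-1 (fun=> -1) s)) => //.
  + by move=> n; exact: mk.
  + exact: mk.
  + exact: (kexp_integrable z k0 (bmf_cst (-1))).
  + move=> n x _; rewrite /kexp mulrN1 -mulNr -(ltr0_norm k0).
    exact: (@kexp_bound xi^-1 (fun s => equilibrium (v n s) xi) x (e1 (v n))).
  + by apply: (aeS (cvk xi^-1)) => s hs /=; rewrite in_itv /= andbT => zs; apply: hs; exact: le_trans zs.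
- rewrite relax_out//.
  have -> : (fun n => relax (v n) (z, xi)) = (fun=> 0).
    by apply/funext => n; rewrite relax_out.
  exact: cvg_cst.
Qed.

Lemma moment_cvg (v : nat -> R -> R) u w y : lbmf w ->
  (forall n, measurable_fun setT (v n)) -> measurable_fun setT u ->
  (forall s, 0 <= s -> v n s @[n --> \oo] --> u s) ->
  int (- L) L (fun xi => w xi * relax (v n) (y, xi)) @[n --> \oo] -->
  int (- L) L (fun xi => w xi * relax u (y, xi)).
Proof.
move=> lw mv mu_ vu; have [mw _] := lw.
apply: (@Rintegral_dct _ _ _ _ (fun xi => `|w xi|)) => //.
- by move=> n; apply: measurable_funM => //; case: (bmf_relax_y L mg g01 y (mv n)).
- by apply: measurable_funM => //; case: (bmf_relax_y L mg g01 y mu_).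
- exact/lbmf_integrable/lbmf_norm.
- by move=> n x _; rewrite normrM ler_piMr// relax_bound.
- apply: (aeS (relax_cvg mv mu_ vu)) => x hx _; apply: cvgMr; exact: hx.
Qed.

Variable c : R.
Hypothesis cL : 0 <= c <= L.

(** Started from the constant [- c], which lies below its own image because the
    incoming densities are nonnegative ([equilibrium_le_relax]). *)
Fixpoint iterate (n : nat) : R -> R := if n is n'.+1 then mean (iterate n') else (fun=> - c).

Lemma measurable_iterate n : measurable_fun setT (iterate n).
Proof. by elim: n => [|n IHn] /=; [exact: measurable_cst|exact: measurable_mean]. Qed.
Let mi := measurable_iterate.

Lemma iterate_bound n y : `|iterate n y| <= L.
Proof.
case: n => [|n] /=; last exact: mean_bound.
by case/andP: cL => c0 cL'; rewrite normrN ger0_norm.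
Qed.
Let iL := iterate_bound.

Lemma equilibrium_le_relax y xi : equilibrium (- c) xi <= relax (fun=> - c) (y, xi).
Proof.
have mc : measurable_fun setT (fun _ : R => - c) by exact: measurable_cst.
have [c0 cL'] := andP cL.
rewrite relax_max; set z := Num.max y 0.
have z0 : 0 <= z by rewrite /z le_max lexx orbT.
have [h|h|h] := velocityP L xi.
- have [xi0 _] := andP h; rewrite equilibrium_pos//.
  have -> : (xi < - c) = false by apply/negbTE; rewrite -leNgt (le_trans _ (ltW xi0))// oppr_le0.
  by have := relax_range L g01 z xi mc; rewrite /kinetic_range xi0 => /andP[].
- rewrite relax_neg// backward_cst//.
  by case/andP: h => _ h; rewrite invr_lt0.
- rewrite relax_out//; move: h; rewrite negb_and -leNgt normr_le0 => /orP[/eqP->|h].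
    by rewrite equilibrium_zero.
  by rewrite (@equilibrium_out _ L)// normrN ger0_norm.
Qed.

Lemma iterate_incr n y : iterate n y <= iterate n.+1 y.
Proof.
elim: n y => [|n IHn] y.
  have cL' : `|- c| <= L by rewrite normrN ger0_norm; case/andP: cL.
  rewrite /= -[leLHS](int_equilibrium0 cL'); apply: int_le.
  - exact/bmf_lbmf/bmf_equilibrium1.
  - exact/bmf_lbmf/bmf_relax_y/measurable_cst.
  - by move=> xi _; exact: equilibrium_le_relax.
by apply: mean_le => //; exact: (mi n.+1).
Qed.

Lemma iterate_nd y : nondecreasing_seq (fun n => iterate n y).
Proof. by apply/nondecreasing_seqP => n; exact: iterate_incr. Qed.

(** By monotonicity every mild state above [- c] bounds all iterates. *)
Lemma iterate_minimal v n y : mild v -> (forall s, 0 <= s -> - c <= v s) ->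
  0 <= y -> iterate n y <= v y.
Proof.
move=> mildv vc; elim: n y => [|n IHn] y y0; first exact: vc.
by case: (mildv) => mv vE; rewrite /= vE; apply: mean_le => //; exact: mi.
Qed.

Definition limit_state y := limn (fun n => iterate n y).

Lemma iterate_cvg y : iterate n y @[n --> \oo] --> limit_state y.
Proof.
apply: nondecreasing_is_cvgn; first exact: iterate_nd.
exists L => _ [n _ <-]; exact: le_trans (ler_norm _) (iL n y).
Qed.

Lemma measurable_limit_state : measurable_fun setT limit_state.
Proof.
apply: (@measurable_fun_cvg _ _ _ _ (fun n => iterate n)) => //.
by move=> y _; exact: iterate_cvg.
Qed.

Lemma limit_state_mild : mild limit_state.
Proof.
split; first exact: measurable_limit_state.
move=> y.
have h1 : iterate n.+1 y @[n --> \oo] --> limit_state y.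
  by rewrite (cvg_shiftS (fun n => iterate n y)); exact: iterate_cvg.
have := @moment_cvg iterate limit_state (fun=> 1) y (lbmf_cst 1) mi measurable_limit_state (fun s _ => @iterate_cvg s).
have -> : (fun n => int (- L) L (fun xi => 1 * relax (iterate n) (y, xi))) = (fun n => iterate n.+1 y).
  by apply/funext => n /=; apply: int_eq => x _; rewrite mul1r.
have -> : int (- L) L (fun xi => 1 * relax limit_state (y, xi)) = mean limit_state y.
  by apply: int_eq => x _; rewrite mul1r.
move=> h2; exact: (cvg_unique _ h1 h2).
Qed.

Lemma limit_state_ge y : - c <= limit_state y.
Proof.
apply: (@nondecreasing_cvgn_le _ (fun n => iterate n y) (iterate_nd y) _ 0%N).
by apply/cvg_ex; exists (limit_state y); exact: iterate_cvg.
Qed.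

Lemma limit_state_minimal v y : mild v -> (forall s, 0 <= s -> - c <= v s) ->
  0 <= y -> limit_state y <= v y.
Proof.
move=> mildv vc y0; rewrite /limit_state; apply: limr_le.
  by apply/cvg_ex; exists (limit_state y); exact: iterate_cvg.
by near=> n; exact: iterate_minimal.
Unshelve. all: by end_near. Qed.

(** Once [v <= b] the incoming data are forgotten: the excess of the density
    over [M(b)] decays at the rate [1 / xi], which is larger than [1 / L]. *)
Lemma relax_decay v b Y y xi : measurable_fun setT v -> `|b| <= L -> 0 <= Y -> Y <= y ->
  (forall s, Y <= s -> v s <= b) ->
  relax v (y, xi) <= equilibrium b xi + expR (- (L^-1 * (y - Y))).
Proof.
move=> mv bL Y0 Yy vb; have y0 := le_trans Y0 Yy.
have bv := bmf_equilibrium2 xi mv; have lv := bmf_lbmf bv.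
have [h|h|h] := velocityP L xi.
- have [x0 xL] := andP h; have k0 : 0 < xi^-1 by rewrite invr_gt0.
  rewrite relax_pos// /duhamel.
  have lk := lbmf_kexp xi^-1 lv.
  rewrite (@int_chasles _ 0 Y y)//.
  have h1 : int 0 Y (kexp xi^-1 (fun s => equilibrium (v s) xi)) <= expR (xi^-1 * Y) - 1.
    have := int_expR xi^-1 Y0; rewrite mulr0 expR0 => <-.
    apply: int_le => //; first exact: lbmf_kexpR.
    move=> s _; rewrite /kexp ler_piMr ?mulr_ge0 ?expR_ge0//; first exact: ltW.
    exact: le_trans (ler_norm _) (kinetic_range_norm (equilibrium_range _ _)).
  have h2 : int Y y (kexp xi^-1 (fun s => equilibrium (v s) xi)) <=
     equilibrium b xi * (expR (xi^-1 * y) - expR (xi^-1 * Y)).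
    rewrite -int_expR// -intZ; last exact: lbmf_kexpR.
    apply: int_le => //; first by apply: lbmfMl; exact: lbmf_kexpR.
    move=> s /andP[Ys _]; rewrite /kexp [leRHS]mulrC ler_wpM2l ?mulr_ge0 ?expR_ge0//.
      exact: ltW.
    by apply: equilibrium_le; exact: vb.
  have g1 := g01 xi.
  have eb0 : 0 <= equilibrium b xi by rewrite equilibrium_pos// ler0n.
  set E := equilibrium b xi in h2 eb0 *.
  apply: (@le_trans _ _ (expR (- (xi^-1 * y)) * (expR (xi^-1 * Y) + E * expR (xi^-1 * y)))).
    rewrite ler_wpM2l ?expR_ge0//.
    have := mulr_ge0 eb0 (expR_ge0 (xi^-1 * Y)).
    by case/andP: g1; lra.
  have -> : expR (- (xi^-1 * y)) * (expR (xi^-1 * Y) + E * expR (xi^-1 * y)) =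
      E * (expR (xi^-1 * y) * expR (- (xi^-1 * y))) + expR (- (xi^-1 * (y - Y))).
    have -> : - (xi^-1 * (y - Y)) = - (xi^-1 * y) + xi^-1 * Y by ring.
    by rewrite expRD; ring.
  rewrite expRxMexpNx_1 mulr1 lerD2l ler_expR lerN2 ler_wpM2r ?subr_ge0//.
  by rewrite lef_pV2 ?posrE// ltW.
- have k0 : xi^-1 < 0 by case/andP: h => _ h; rewrite invr_lt0.
  rewrite relax_neg// ler_wpDr ?expR_ge0//.
  rewrite -[leRHS](@backward_cst _ xi^-1 _ y)//; apply: backward_le => //.
    exact: bmf_cst.
  by move=> s ys; apply: equilibrium_le; apply: vb; exact: le_trans ys.
- rewrite relax_out//; move: h; rewrite negb_and -leNgt normr_le0 => /orP[/eqP->|h].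
    by rewrite equilibrium_zero add0r expR_ge0.
  by rewrite (@equilibrium_out _ L)// add0r expR_ge0.
Qed.

Lemma iterate_decay n e : 0 < e -> exists2 Y, 0 <= Y & forall y, Y <= y -> iterate n y <= - c + e.
Proof.
elim: n e => [|n IHn] e e0; first by exists 0 => // y _; rewrite /= lerDl ltW.
(* [d <= L] keeps the level [- c + d] in [- L, L]. *)
pose d := Num.min (e / 2) L.
have d0 : 0 < d by rewrite lt_min divr_gt0.
have [Y Y0 HY] := IHn d d0.
have [c0 cL'] := andP cL.
have bL : `|- c + d| <= L.
  have h1 : d <= L by rewrite ge_min lexx orbT.
  by rewrite ler_norml; apply/andP; split; lra.
have e1 : 0 < e / 2 / (2 * L) by rewrite !divr_gt0 ?mulr_gt0.
have k0 : - L^-1 < 0 by rewrite oppr_lt0 invr_gt0.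
have /cvgrPdist_le/(_ _ e1)[M [_ hM]] := cvg_expR_neg k0.
have ML : 0 <= Num.max M 0 + 1 by rewrite addr_ge0// le_max lexx orbT.
exists (Y + (Num.max M 0 + 1)); first by rewrite addr_ge0.
move=> y yY; have Yy : Y <= y by rewrite (le_trans _ yY)// lerDl.
have : iterate n.+1 y <= int (- L) L (fun xi => equilibrium (- c + d) xi + expR (- (L^-1 * (y - Y)))).
  apply: int_le.
  - exact/bmf_lbmf/bmf_relax_y.
  - by apply: lbmfD; [exact/bmf_lbmf/bmf_equilibrium1|exact: lbmf_cst].
  - by move=> xi _; apply: relax_decay.
move/le_trans; apply.
rewrite intD ?int_equilibrium0 ?int_cst//; last 2 first.
  exact/bmf_lbmf/bmf_equilibrium1.
  exact: lbmf_cst.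
rewrite -addrA lerD2l.
have h1 : d <= e / 2 by rewrite ge_min lexx.
have : M < y - Y.
  rewrite ltrBrDl (lt_le_trans _ yY)// ltrD2l (le_lt_trans (_ : M <= Num.max M 0))//.
    by rewrite le_max lexx.
  by rewrite ltrDl.
move=> /hM; rewrite sub0r normrN ger0_norm ?expR_ge0// mulNr => h2.
have L2 : 0 < 2 * L by rewrite mulr_gt0.
have : expR (- (L^-1 * (y - Y))) * (2 * L) <= e / 2.
  by rewrite -ler_pdivlMr.
have -> : L - - L = 2 * L by ring.
by lra.
Qed.

Lemma flux_ge_square v y : measurable_fun setT v -> mean v y ^+ 2 / 2 <= flux v y.
Proof.
move=> mv.
have := @flux_defect _ L (mean v y) (fun xi => relax v (y, xi)) (mean_bound L0 mg g01 y mv)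
  (bmf_relax_y L mg g01 y mv) (fun xi => relax_range L g01 y xi mv) erefl.
rewrite -subr_ge0 => <-; apply: int_ge0 => x _; exact: mulr_ge0.
Qed.

(** At a large [Y] the iterates are close to [- c], so the flux is nearly at
    least [c^2 / 2] there by [flux_ge_square]; and the flux is nonincreasing
    in [y] because [iterate n <= mean (iterate n)]. *)
Lemma iterate_flux n : c ^+ 2 / 2 <= flux (iterate n) 0.
Proof.
have lin (x y z t e : R) : x - 2 * t + z <= y -> 0 <= z -> t <= e -> x / 2 <= e + y / 2.
  by lra.
have [c0 cL'] := andP cL.
apply/ler_addgt0Pl => e e0.
(* [d <= c] makes squaring antitone up to [- c + d], and [d * c <= e]. *)
pose d := Num.min c (e / (L + 1)).
have [d0|d0] := leP d 0.
  have c00 : c = 0.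
    apply/eqP; rewrite eq_le c0 andbT.
    move: d0; rewrite /d ge_min => /orP[//|]; rewrite leNgt divr_gt0//.
    by rewrite ltr_wpDr.
  rewrite c00 expr0n mul0r addr_ge0// ?(ltW e0)//.
  apply: le_trans (flux_ge_square 0 (mi n)).
  by rewrite divr_ge0// sqr_ge0.
have [Y Y0 HY] := iterate_decay n.+1 d0.
have h1 := HY Y (lexx Y).
have h2 : - c <= iterate n.+1 Y by exact: (iterate_nd Y (leq0n n.+1)).
have h3 := flux_ge_square Y (mi n); rewrite -/(iterate n.+1 Y) in h3.
have h4 : flux (iterate n) Y <= flux (iterate n) 0.
  rewrite -subr_le0 flux_balance//.
  have li m : lbmf (iterate m) by apply: bmf_lbmf; split; [exact: mi|exists L => s; exact: iL].
  have := @int_le_cst _ 0 Y (fun s => iterate n s - iterate n.+1 s) 0 Y0 (lbmfB (li n) (li n.+1)).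
  by rewrite mul0r; apply => s _; rewrite subr_le0; exact: iterate_incr.
have dc : d <= c by rewrite ge_min lexx.
have de : d * c <= e.
  have : d <= e / (L + 1) by rewrite ge_min lexx orbT.
  rewrite ler_pdivlMr; last by rewrite ltr_wpDr.
  move=> h; apply: le_trans h; apply: ler_wpM2l; first exact: ltW.
  by rewrite (le_trans cL')// lerDl.
set a := iterate n.+1 Y in h1 h2 h3; clearbody a d.
have h5 : (c - d) ^+ 2 <= a ^+ 2.
  rewrite -[leRHS]sqrrN ler_sqr ?nnegrE ?oppr_ge0 ?subr_ge0//.
    by rewrite lerNr opprB addrC.
  by rewrite (le_trans h1)// addrC subr_le0.
have h6 := sqr_ge0 d; have h7 : (c - d) ^+ 2 = c ^+ 2 - 2 * (d * c) + d ^+ 2 by ring.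
rewrite h7 in h5; apply: (le_trans _ (lerD (lexx e) h4)); apply: (le_trans _ (lerD (lexx e) h3)).
exact: lin h5 h6 de.
Qed.

Lemma limit_state_flux_ge : c ^+ 2 / 2 <= flux limit_state 0.
Proof.
have h := @moment_cvg iterate limit_state id 0 (@lbmf_id R) mi measurable_limit_state
   (fun s _ => @iterate_cvg s).
rewrite -[leRHS](cvg_lim _ h)//; apply: limr_ge.
  by apply/cvg_ex; eexists; exact: h.
by near=> n; exact: iterate_flux.
Unshelve. all: by end_near. Qed.

Hypothesis cg : int 0 L (fun xi => xi * g xi) <= c ^+ 2 / 2.

(** If the limit at infinity of the limit state is [- w] with [w^2 / 2] its flux,
    then [w <= c] because the state is at least [- c]; otherwise its flux is the
    incoming one, which is at most [c^2 / 2]. *)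
Lemma limit_state_flux : flux limit_state 0 = c ^+ 2 / 2.
Proof.
have [c0 cL'] := andP cL.
apply/eqP; rewrite eq_le limit_state_flux_ge andbT.
set W := flux limit_state 0.
have W0 : 0 <= W by apply: le_trans limit_state_flux_ge; rewrite divr_ge0// sqr_ge0.
have [->|Wn0] := eqVneq W 0; first by rewrite divr_ge0// sqr_ge0.
have {}W0 : 0 < W by rewrite lt_neqAle eq_sym Wn0.
pose w := Num.sqrt (2 * W).
have w0 : 0 < w by rewrite sqrtr_gt0 mulr_gt0.
have Ww : W = w ^+ 2 / 2 by rewrite sqr_sqrtr ?mulr_ge0 ?(ltW W0)//; field.
have [pos|neg] := mild_dichotomy L0 mg g01 limit_state_mild w0 Ww.
  by rewrite /W (mild_nonneg_flux L0 mg g01 limit_state_mild pos).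
have wc : w <= c.
  apply/ler_addgt0Pl => e e0; have [Y Y0 HY] := neg e e0.
  have := HY Y (lexx Y); have := limit_state_ge Y.
  by rewrite ltr_norml => h1 /andP[h2 h3]; lra.
by rewrite Ww ler_wpM2r// ler_sqr ?nnegrE// ltW.
Qed.

(** The two densities are ordered, so equal fluxes force equality wherever the
    sign of [xi] is constant and the other half is known to agree: first the
    outgoing half at 0, then at all [y] by [backward_eq_later], then the
    incoming half. *)
Lemma mild_eq_limit_state u : mild u -> flux u 0 = c ^+ 2 / 2 ->
  relax u = relax limit_state.
Proof.
move=> mildu fu; have [c0 cL'] := andP cL.
have [mu_ uE] := mildu.
have ml := measurable_limit_state.
have uc s : 0 <= s -> - c <= u s.
  move=> s0; have := mild_defect_ge0 L0 mg g01 mildu s0; rewrite fu => h.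
  rewrite lerNl; apply: le_trans (_ : `|u s| <= _); first by rewrite -normrN ler_norm.
  by rewrite -ler_sqr ?nnegrE// real_normK ?num_real//; lra.
have lu s : 0 <= s -> limit_state s <= u s by move=> s0; exact: limit_state_minimal.
have lr y xi : relax limit_state (y, xi) <= relax u (y, xi) by exact: relax_le.
have lbd y : lbmf (fun xi => relax u (y, xi) - relax limit_state (y, xi)).
  by apply: lbmfB; exact/bmf_lbmf/bmf_relax_y.
have lbx y : lbmf (fun xi => xi * (relax u (y, xi) - relax limit_state (y, xi))).
  by apply: lbmfM; first exact: lbmf_id.
have bal y : 0 <= y -> int (- L) L (fun xi => xi * (relax u (y, xi) - relax limit_state (y, xi))) = 0.
  move=> y0; have := mild_flux L0 mg g01 limit_state_mild y0; have := mild_flux L0 mg g01 mildu y0.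
  rewrite fu limit_state_flux /flux => h1 h2.
  under eq_Rintegral do rewrite mulrBr.
  by rewrite intB ?h1 ?h2 ?subrr//; exact: lbmf_xrelax.
have neg0 : {ae mu, forall xi, - L <= xi <= 0 -> relax u (0, xi) - relax limit_state (0, xi) = 0}.
  have := bal 0 (lexx 0); rewrite (@int_chasles _ _ 0)// -[X in _ + X]int_oo//.
  rewrite (@eq_Rintegral _ _ _ mu `]0, L[%classic (fun=> 0)); last first.
    by move=> x; rewrite inE /= in_itv /= => h; rewrite !relax0// subrr mulr0.
  rewrite Rintegral_cst// mul0r addr0 => h.
  have h0 : int (- L) 0 (fun xi => - (xi * (relax u (0, xi) - relax limit_state (0, xi)))) = 0.
    under eq_Rintegral do rewrite -mulN1r.
    by rewrite intZ// h mulr0.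
  have := int_eq0_ae (lbmfN (lbx 0)) _ h0 => H.
  have {}H : {ae mu, forall x, - L <= x <= 0 -> - (x * (relax u (0, x) - relax limit_state (0, x))) = 0}.
    by apply: H => x /andP[_ x0]; rewrite -mulNr mulr_ge0 ?oppr_ge0 ?subr_ge0.
  apply: (aeS H) => x hx xL; move: (hx xL) => /eqP; rewrite oppr_eq0 mulf_eq0.
  by move=> /orP[/eqP->|/eqP//]; rewrite !relax_out ?subrr// normr0 ltxx.
have negy y : 0 <= y -> {ae mu, forall xi, - L <= xi <= 0 -> relax u (y, xi) = relax limit_state (y, xi)}.
  move=> y0; apply: (aeS neg0) => x hx xL; move: (hx xL) => /eqP; rewrite subr_eq0 => /eqP.
  have [h|h|h] := velocityP L x; last by rewrite !relax_out.
    by case/andP: h => h _; case/andP: xL => _ /(lt_le_trans h); rewrite ltxx.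
  rewrite !relax_neg// => H; apply/esym.
  have k0 : x^-1 < 0 by case/andP: h => _ h; rewrite invr_lt0.
  apply: (backward_eq_later k0 _ _ _ y0 (esym H)).
  - exact: bmf_equilibrium2.
  - exact: bmf_equilibrium2.
  - by move=> s s0; apply: equilibrium_le; exact: lu.
have posy y : 0 <= y -> {ae mu, forall xi, 0 <= xi <= L -> relax u (y, xi) = relax limit_state (y, xi)}.
  move=> y0; have := bal y y0; rewrite (@int_chasles _ _ 0)//.
  rewrite (int_ae_eq (lbx y) (lbmf_cst 0)); last first.
    by apply: (aeS (negy y y0)) => x hx /hx ->; rewrite subrr mulr0.
  rewrite int_cst// mul0r add0r => h.
  have := int_eq0_ae (lbx y) _ h => H.
  have {}H : {ae mu, forall x, 0 <= x <= L -> x * (relax u (y, x) - relax limit_state (y, x)) = 0}.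
    by apply: H => x /andP[x0 _]; rewrite mulr_ge0 ?subr_ge0.
  apply: (aeS H) => x hx xL; move: (hx xL) => /eqP; rewrite mulf_eq0 subr_eq0.
  by move=> /orP[/eqP->|/eqP//]; rewrite !relax_out// normr0 ltxx.
apply: relax_ext => // s s0.
rewrite uE; have [_ ->] := limit_state_mild.
apply: int_ae_eq; try exact/bmf_lbmf/bmf_relax_y.
apply: (aeI (negy s s0) (posy s s0)) => x h1 h2 /andP[x1 x2].
have [x0|x0] := leP x 0; first by apply: h1; rewrite x1.
by apply: h2; rewrite (ltW x0).
Qed.

End Iteration.

(** * Smooth bump functions *)
Section SmoothReal.
Context {R : realType}.
Implicit Types f g : R -> R.

Fixpoint Cn n f : Prop := if n is n'.+1 then
  exists2 f', (forall x : R, is_derive x (1 : R) f (f' x)) & Cn n' f' else continuous f.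

Definition Cinf f := forall n, Cn n f.

Lemma is_derive_continuous f f' : (forall x : R, is_derive x (1 : R) f (f' x)) -> continuous f.
Proof.
move=> df x; apply/differentiable_continuous/derivable1_diffP; by case: (df x).
Qed.

Lemma Cn_continuous n f : Cn n f -> continuous f.
Proof. by case: n => // n [f' df _]; exact: is_derive_continuous df. Qed.

Lemma Cn_weak n f : Cn n.+1 f -> Cn n f.
Proof.
elim: n f => [|n IHn] f; first exact: (@Cn_continuous 1).
by move=> [f' df Cf']; exists f' => //; exact: IHn.
Qed.

Lemma Cn_cst n c : Cn n (fun=> c).
Proof.
elim: n c => [|n IHn] c /=; first by move=> x; exact: cvg_cst.
by exists (fun=> 0) => // x; exact: is_derive_cst.
Qed.

Lemma CnD n f g : Cn n f -> Cn n g -> Cn n (fun x => f x + g x).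
Proof.
elim: n f g => [|n IHn] f g /=; first by move=> cf cg x; apply: cvgD; [exact: cf|exact: cg].
move=> [f' df Cf] [g' dg Cg]; exists (fun x => f' x + g' x); last exact: IHn.
by move=> x; exact: (is_deriveD (df x) (dg x)).
Qed.

Lemma CnM n f g : Cn n f -> Cn n g -> Cn n (fun x => f x * g x).
Proof.
elim: n f g => [|n IHn] f g; first by move=> cf cg x; apply: cvgM; [exact: cf|exact: cg].
move=> Cf Cg; have Wf := Cn_weak Cf; have Wg := Cn_weak Cg.
case: Cf Cg => [f' df Cf'] [g' dg Cg'].
exists (fun x => f x * g' x + g x * f' x); last by apply: CnD; exact: IHn.
by move=> x; exact: (is_deriveM (df x) (dg x)).
Qed.

Lemma Cn_affine n f k c : Cn n f -> Cn n (fun x => f (k * x + c)).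
Proof.
elim: n f => [|n IHn] f /=.
  move=> cf x; apply: (continuous_comp (f := fun x => k * x + c)); last exact: cf.
  by apply: cvgD; [exact: mulrl_continuous|exact: cvg_cst].
move=> [f' df Cf]; exists (fun x => k * f' (k * x + c)).
  move=> x; have dl : is_derive x (1 : R) (fun x => k * x + c) k.
    have := is_deriveD (is_deriveZ k (is_derive_id x (1 : R))) (is_derive_cst c x (1 : R)).
    by rewrite addr0 /GRing.scale /= mulr1.
  by have := @is_derive1_comp _ f (fun x => k * x + c) x _ _ (df (k * x + c)) dl; rewrite mulrC.
by apply: CnM; [exact: Cn_cst|exact: IHn].
Qed.

Lemma Cn_expR n f : Cn n f -> Cn n (fun x => expR (f x)).
Proof.
elim: n f => [|n IHn] f.
  by move=> cf x; apply: (continuous_comp (cf x)); exact: continuous_expR.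
move=> Cf; have Wf := Cn_weak Cf; case: Cf => [f' df Cf'].
exists (fun x => f' x * expR (f x)); last by apply: CnM => //; exact: IHn.
by move=> x; have := @is_derive1_comp _ expR f x _ _ (is_derive_expR (f x)) (df x); rewrite mulrC.
Qed.

(** The powers [k] make the family stable under derivation up to linear
    combinations.  At 0 the difference quotient of [flat k] is [flat k.+1], and
    every member is bounded by a multiple of [x], so the derivative there is 0. *)
Definition flat (k : nat) (x : R) : R := if 0 < x then x^-1 ^+ k * expR (- x^-1) else 0.

Lemma flat_ge0 k x : 0 <= flat k x.
Proof.
by rewrite /flat; case: ifP => // x0; rewrite mulr_ge0 ?expR_ge0// exprn_ge0// invr_ge0 ltW.
Qed.

Lemma flat_le k x : 0 <= x -> flat k x <= k.+1`!%:R * x.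
Proof.
rewrite /flat le_eqVlt => /predU1P[<-|x0]; first by rewrite ltxx mulr0.
rewrite x0; have z0 : 0 <= x^-1 by rewrite invr_ge0 ltW.
have f0 : 0 < (k.+1)`!%:R :> R by rewrite ltr0n fact_gt0.
have := expR_ge1Dxn k z0 => h.
have : x^-1 ^+ k.+1 <= (k.+1)`!%:R * expR (x^-1).
  by rewrite mulrC -ler_pdivrMr//; apply: le_trans h; rewrite lerDr.
rewrite -(ler_pM2r (expR_gt0 (- x^-1))) -mulrA expRxMexpNx_1 mulr1 exprS -mulrA => h2.
by rewrite -ler_pdivrMr// mulrC.
Qed.

Lemma is_derive_flat k (x : R) :
  is_derive x (1 : R) (flat k) (- k%:R * flat k.+1 x + flat k.+2 x).
Proof.
have [x0|x0|<-] := ltgtP 0 x.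
- have xn0 : x != 0 by rewrite gt_eqF.
  have d1 : is_derive x (1 : R) (fun y : R => y^-1) (- x ^- 2).
    have := is_deriveV xn0 (is_derive_id x (1 : R)).
    by rewrite /GRing.scale /= mulr1.
  have d2 : is_derive x (1 : R) (fun y : R => - y^-1) (x ^- 2).
    by have := is_deriveN d1; rewrite opprK.
  have d3 := @is_derive1_comp _ expR (fun y : R => - y^-1) x _ _ (is_derive_expR (- x^-1)) d2.
  have d4 := is_deriveX k d1.
  have d5 := is_deriveM d4 d3.
  have -> : - k%:R * flat k.+1 x + flat k.+2 x =
    ((fun y : R => y^-1) ^+ k) x *: (expR (- x^-1) * x ^- 2) +
     (expR \o (fun y : R => - y^-1)) x *: ((k%:R * x^-1 ^+ k.-1) *: - x ^- 2).
    rewrite /flat x0 /GRing.scale /=.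
    have -> : ((fun y : R => y^-1) ^+ k) x = x^-1 ^+ k.
      by elim: (k) => [|n IHn]; rewrite ?expr0// exprS /= [in RHS]exprS -IHn.
    case: (k) => [|n] /=; rewrite ?exprS ?expr0; set e := expR _; by field.
  have [dd vv] := d5.
  have E : {near x, ((fun y : R => y^-1) ^+ k) * (expR \o (fun y : R => - y^-1)) =1 flat k}.
    near=> y; have y0 : 0 < y.
      by near: y; apply: (@cvgr_gt _ _ _ _ id x); first exact: cvg_id.
    rewrite /flat y0 /=; congr (_ * _).
    by elim: (k) => [|n IHn]; rewrite ?expr0// exprS /= [in RHS]exprS -IHn.
  apply: DeriveDef; first exact: (near_eq_derivable E dd).
  by rewrite -(near_eq_derive _ E).
- have -> : - k%:R * flat k.+1 x + flat k.+2 x = 0.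
    by rewrite /flat ltNge (ltW x0) mulr0 addr0.
  have [dd vv] := is_derive_cst (0 : R) x (1 : R).
  have E : {near x, (cst 0) =1 flat k}.
    near=> y; have y0 : y < 0.
      by near: y; apply: (@cvgr_lt _ _ _ _ id x); first exact: cvg_id.
    by rewrite /flat ltNge (ltW y0).
  apply: DeriveDef; first exact: (near_eq_derivable E dd).
  by rewrite -(near_eq_derive _ E).
- have -> : - k%:R * flat k.+1 0 + flat k.+2 0 = 0 :> R.
    by rewrite /flat ltxx mulr0 addr0.
  have h : h^-1 *: ((flat k \o shift 0) (h *: (1 : R)) - flat k 0) @[h --> 0^'] --> (0 : R).
    have -> : (fun h : R => h^-1 *: ((flat k \o shift 0) (h *: (1 : R)) - flat k 0)) = flat k.+1.
      apply/funext => t; rewrite /= /GRing.scale /= mulr1 addr0 /flat ltxx subr0.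
      by case: ifP => t0; rewrite ?mulr0// exprS mulrA.
    apply: cvg_within_filter; apply/cvgrPdist_le => e e0; near=> t.
    rewrite sub0r normrN ger0_norm ?flat_ge0//.
    have [t0|t0] := leP 0 t; last by rewrite /flat ltNge (ltW t0) /= ltW.
    have f0 : 0 < (k.+2)`!%:R :> R by rewrite ltr0n fact_gt0.
    apply: (le_trans (flat_le _ t0)); rewrite mulrC -ler_pdivlMr//.
    rewrite -(ger0_norm t0) -normrN -[- t]sub0r; near: t.
    apply: (@cvgr_dist_le _ R^o _ _ _ id 0); first exact: cvg_id.
    by rewrite divr_gt0// ltr0n fact_gt0.
  apply: DeriveDef; first by apply/cvg_ex; exists 0; exact: h.
  exact: cvg_lim h.
Unshelve. all: by end_near. Qed.

Lemma Cn_flat n k : Cn n (flat k).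
Proof.
elim: n k => [|n IHn] k; first exact: is_derive_continuous (is_derive_flat k).
exists (fun x => - k%:R * flat k.+1 x + flat k.+2 x); first exact: is_derive_flat.
by apply: CnD => //; apply: CnM => //; exact: Cn_cst.
Qed.

(** As [n] grows this increases to the indicator of ]a, b[; the convergence is
    what allows to replace test functions by indicators. *)
Definition bump (a b : R) (n : nat) (x : R) : R :=
  1 - expR (- n%:R * (flat 0 (x - a) * flat 0 (b - x))).

Lemma Cinf_bump a b n : Cinf (bump a b n).
Proof.
move=> m; apply: CnD; first exact: Cn_cst.
have -> : (fun x => - expR (- n%:R * (flat 0 (x - a) * flat 0 (b - x)))) =
  (fun x => (-1) * expR (- n%:R * (flat 0 (1 * x + - a) * flat 0 (-1 * x + b)))).
  by apply/funext => x; rewrite !mulN1r mul1r [- x + b]addrC.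
apply: CnM; first exact: Cn_cst.
apply: Cn_expR; apply: CnM; first exact: Cn_cst.
by apply: CnM; apply: Cn_affine; exact: Cn_flat.
Qed.

Lemma bump_out a b n x : ~~ (a < x < b) -> bump a b n x = 0.
Proof.
rewrite negb_and -!leNgt => h; rewrite /bump.
suff -> : flat 0 (x - a) * flat 0 (b - x) = 0 by rewrite mulr0 expR0 subrr.
case/orP: h => h.
  by have -> : flat 0 (x - a) = 0; rewrite ?mul0r// /flat subr_gt0 ltNge h.
by have -> : flat 0 (b - x) = 0; rewrite ?mulr0// /flat subr_gt0 ltNge h.
Qed.

Lemma bump_range a b n x : 0 <= bump a b n x <= 1.
Proof.
rewrite /bump subr_ge0 lerBlDr lerDl expR_ge0 andbT -expR0 ler_expR mulNr oppr_le0.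
by rewrite !mulr_ge0// flat_ge0.
Qed.

Lemma bump_cvg a b x : a < x < b -> bump a b n x @[n --> \oo] --> (1 : R).
Proof.
move=> /andP[ax xb].
set p := flat 0 (x - a) * flat 0 (b - x).
have p0 : 0 < p by rewrite /p /flat !subr_gt0 ax xb !expr0 !mul1r mulr_gt0// expR_gt0.
rewrite -[X in _ --> X]subr0; apply: cvgB; first exact: cvg_cst.
have pn : - p < 0 by rewrite oppr_lt0.
have /cvgrPdist_le h := cvg_expR_neg pn.
apply/cvgrPdist_le => e e0; have [M [_ hM]] := h e e0.
near=> n; have -> : - n%:R * p = - p * n%:R by ring.
apply: hM; near: n; exact: nbhs_infty_gtr.
Unshelve. all: by end_near. Qed.

Lemma bump_gt0 a b n x : a < x < b -> 0 < bump a b n.+1 x.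
Proof.
move=> /andP[ax xb]; rewrite /bump subr_gt0 -expR0 ltr_expR mulNr oppr_lt0.
by rewrite /flat !subr_gt0 ax xb !expr0 !mul1r !mulr_gt0// expR_gt0.
Qed.

End SmoothReal.

(** * Products as test functions *)
Section TestFunctions.
Context {R : realType}.

(** The directional derivative of a product is a sum of two products; finite
    sums of products are stable, which gives all iterated derivatives at once. *)
Inductive tensor : (R * R -> R) -> Prop :=
| tensor_prod a b : Cinf a -> Cinf b -> tensor (fun p => a p.1 * b p.2)
| tensor_add f g : tensor f -> tensor g -> tensor (fun p => f p + g p).

Lemma Cinf_derive (a : R -> R) : Cinf a ->
  (forall x : R, is_derive x (1 : R) a ('D_1 a x)) /\ Cinf (fun x => 'D_1 a x).
Proof.
move=> Ca.
have E n : exists2 a', (forall x : R, is_derive x (1 : R) a (a' x)) & Cn n a' by exact: Ca n.+1.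
split.
  by move=> x; have [a' da _] := E 0%N; apply: DeriveDef => //; case: (da x).
move=> n; have [a' da Ca'] := E n.
have -> // : (fun x => 'D_1 a x) = a'.
by apply/funext => x; case: (da x).
Qed.

Lemma is_derive_dir (a : R -> R) (x v d : R) : is_derive x (1 : R) a d ->
  is_derive x v a (v * d).
Proof.
move=> [da va]; have df : differentiable a x by apply/derivable1_diffP.
apply: DeriveDef; first exact: diff_derivable.
rewrite deriveE// -[v in LHS]mulr1 -[v * 1]/(v *: (1 : R)) linearZ /=.
by rewrite -va deriveE.
Qed.

Lemma is_derive_fst (a : R -> R) (p v : R * R) d : is_derive p.1 v.1 a d ->
  is_derive p v (fun q : R * R => a q.1) d.
Proof. by move=> [da va]; apply: DeriveDef; [exact: da|exact: va]. Qed.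

Lemma is_derive_snd (a : R -> R) (p v : R * R) d : is_derive p.2 v.2 a d ->
  is_derive p v (fun q : R * R => a q.2) d.
Proof. by move=> [da va]; apply: DeriveDef; [exact: da|exact: va]. Qed.

Lemma is_derive_prod (a b : R -> R) (p v : R * R) (da db : R) :
  is_derive p.1 (1 : R) a da -> is_derive p.2 (1 : R) b db ->
  is_derive p v (fun q : R * R => a q.1 * b q.2) (v.1 * (da * b p.2) + v.2 * (a p.1 * db)).
Proof.
move=> ha hb.
have h1 := is_derive_fst (v := v) (is_derive_dir v.1 ha).
have h2 := is_derive_snd (v := v) (is_derive_dir v.2 hb).
have := is_deriveM h1 h2; rewrite /GRing.scale /=.
set d := (X in is_derive _ _ _ X -> _); set d' := (X in _ -> is_derive _ _ _ X).
by have -> : d = d' by rewrite /d /d'; ring.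
Qed.

Lemma tensor_continuous f : tensor f -> continuous f.
Proof.
elim=> [a b Ca Cb|g h _ IHg _ IHh] p; last by apply: cvgD; [exact: IHg|exact: IHh].
apply: cvgM.
  by apply: (continuous_comp (f := fst)); [exact: cvg_fst|exact: (Cn_continuous (Ca 0%N))].
by apply: (continuous_comp (f := snd)); [exact: cvg_snd|exact: (Cn_continuous (Cb 0%N))].
Qed.

Lemma tensor_derive f v : tensor f -> (forall p, derivable f p v) /\ tensor ('D_v f).
Proof.
elim=> [a b Ca Cb|g h _ [dg tg] _ [dh th]].
  have [da Cda] := Cinf_derive Ca; have [db Cdb] := Cinf_derive Cb.
  have D p := is_derive_prod v (da p.1) (db p.2).
  split; first by move=> p; case: (D p).
  have -> : 'D_v (fun p : R * R => a p.1 * b p.2) =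
    (fun p => (v.1 * 'D_1 a p.1) * b p.2 + a p.1 * (v.2 * 'D_1 b p.2)).
    apply/funext => p; have [_ ->] := D p; ring.
  have CM c (q : R -> R) : Cinf q -> Cinf (fun x => c * q x).
    by move=> Cq n; apply: CnM => //; exact: Cn_cst.
  apply: (tensor_add (f := fun p => v.1 * 'D_1 a p.1 * b p.2)).
    exact: (tensor_prod (CM v.1 _ Cda) Cb).
  exact: (tensor_prod Ca (CM v.2 _ Cdb)).
split; first by move=> p; exact: derivableD.
have -> : 'D_v (fun p : R * R => g p + h p) = (fun p => 'D_v g p + 'D_v h p).
  by apply/funext => p; rewrite deriveD.
exact: tensor_add.
Qed.

Lemma tensor_smooth f : tensor f -> smooth f.
Proof.
move=> tf vs.
have tvs : tensor (iter_derive vs f).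
  by elim: vs => [//|v vs IH] /=; exact: (tensor_derive v IH).2.
split; first exact: tensor_continuous.
by move=> p v; exact: (tensor_derive v tvs).1.
Qed.

Lemma test_function_prod (a b : R -> R) (l r l' r' : R) (Omega : set (R * R)) :
  Cinf a -> Cinf b -> (forall x, ~~ (l <= x <= r) -> a x = 0) ->
  (forall x, ~~ (l' <= x <= r') -> b x = 0) ->
  `[l, r] `*` `[l', r'] `<=` Omega ->
  test_function Omega (fun p => a p.1 * b p.2).
Proof.
move=> Ca Cb a0 b0 sub.
have K : compact ((`[l, r] : set R) `*` (`[l', r'] : set R)).
  by apply: compact_setX; exact: segment_compact.
have cK : closed ((`[l, r] : set R) `*` (`[l', r'] : set R)).
  by apply: compact_closed => //; exact: norm_hausdorff.
have sK : closure [set p | a p.1 * b p.2 != 0] `<=` `[l, r] `*` `[l', r'].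
  rewrite closureE => p; apply; split => // -[x y] /=.
  rewrite mulf_eq0 negb_or => /andP[ax bx]; split => /=; rewrite in_itv /=.
    by apply: contraNT ax => /a0 ->.
  by apply: contraNT bx => /b0 ->.
split.
- exact/tensor_smooth/tensor_prod.
- by apply: subclosed_compact K sK; exact: closed_closure.
- exact: subset_trans sK sub.
Qed.

End TestFunctions.

(** * Localization of identities tested against bumps *)
Section Localization.
Context {R : realType}.
Local Notation mu := (@lebesgue_measure R).
Local Notation "'int' a b f" := (Rintegral mu [set` `[(a : R), (b : R)]] f)
  (at level 10, a, b, f at level 9).

Lemma lbmf_compact_support (f : R -> R) (l r : R) : lbmf f ->
  (forall x, ~~ (l <= x <= r) -> f x = 0) -> bmf f.
Proof.
move=> [mf hf] f0; split => //.
have [C hC] := hf (Num.max `|l| `|r|); exists `|C| => x.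
case: (boolP (l <= x <= r)) => [lxr|/f0 ->]; last by rewrite normr0.
exact: le_trans (hC x (norm_le_max lxr)) (ler_norm _).
Qed.

Lemma exists_ae (P : R -> Prop) (a b : R) : a < b -> {ae mu, forall x, P x} ->
  exists2 x, a < x < b & P x.
Proof.
move=> ab [N [mN N0 PN]]; apply: contrapT => h.
have sub : (`]a, b[ : set R) `<=` N.
  move=> x /=; rewrite in_itv /= => xab; apply: PN => /= Px; apply: h.
  by exists x.
have : (mu (`]a, b[ : set R) <= mu N)%E.
  by apply: le_measure; [exact: mem_set|exact: mem_set|].
rewrite N0 lebesgue_measure_itv /= lte_fin ab -EFinB lee_fin subr_le0.
by rewrite leNgt ab.
Qed.

(** Rational endpoints are countably many, so that the exceptional sets for
    functions depending on a parameter can be gathered.  All integrals from [l]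
    vanish by density, and Lebesgue's differentiation theorem concludes. *)
Lemma ae_zero_rat (q : R -> R) (l r : R) : lbmf q ->
  (forall a b : rat, l < ratr a -> ratr a < ratr b :> R -> ratr b < r -> int (ratr a) (ratr b) q = 0) ->
  {ae mu, forall x, l < x < r -> q x = 0}.
Proof.
move=> lq q0.
have [rl|lr] := leP r l.
  by apply: aeW => x /andP[h1 h2]; have := lt_le_trans (lt_trans h1 h2) rl; rewrite ltxx.
have [C0 hC0] := lq.2 (Num.max `|l| `|r|); pose C := `|C0| + 1.
have C1 : 0 < C by rewrite ltr_wpDl.
have hC x : l <= x <= r -> `|q x| <= C.
  move=> /norm_le_max/hC0 h; apply: (le_trans h).
  by rewrite (le_trans (ler_norm _))// lerDl.
have P0 x : l < x < r -> int l x q = 0.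
  move=> /andP[lx xr]; apply/eqP; rewrite -normr_le0; apply/ler_addgt0Pl => e e0.
  rewrite addr0.
  pose d := Num.min ((x - l) / 2) (e / (2 * C)).
  have d0 : 0 < d by rewrite lt_min !divr_gt0 ?subr_gt0 ?mulr_gt0.
  have dx : d <= (x - l) / 2 by rewrite ge_min lexx.
  have de : d * (2 * C) <= e by rewrite -ler_pdivlMr ?mulr_gt0// ge_min lexx orbT.
  clearbody d.
  have ld : l < l + d by rewrite ltrDl.
  have xd : x - d < x by rewrite ltrBlDr ltrDl.
  have [a] := rat_in_itvoo ld; rewrite in_itv /= => /andP[la ald].
  have [b] := rat_in_itvoo xd; rewrite in_itv /= => /andP[xb bx].
  have ab : ratr a <= ratr b :> R by lra.
  rewrite (@int_chasles _ l (ratr a))//; [|exact: ltW|by lra].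
  rewrite (@int_chasles _ (ratr a) (ratr b))//; last exact: ltW.
  have -> : int (ratr a) (ratr b) q = 0.
    move: ab; rewrite le_eqVlt => /predU1P[->|ab]; first exact: int_xx.
    by apply: q0 => //; exact: lt_trans xr.
  rewrite add0r (le_trans (ler_normD _ _))//.
  have h1 : `|int l (ratr a) q| <= C * (ratr a - l).
    by apply: int_norm_le => //; [exact: ltW|move=> z /andP[z1 z2]; apply: hC; apply/andP; split; lra].
  have h2 : `|int (ratr b) x q| <= C * (x - ratr b).
    by apply: int_norm_le => //; [exact: ltW|move=> z /andP[z1 z2]; apply: hC; apply/andP; split; lra].
  have h3 : C * (ratr a - l) <= C * d by rewrite ler_pM2l//; lra.
  have h4 : C * (x - ratr b) <= C * d by rewrite ler_pM2l//; lra.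
  have h5 : d * (2 * C) = C * d + C * d by ring.
  rewrite h5 in de; apply: le_trans de.
  by apply: lerD; [exact: le_trans h1 h3|exact: le_trans h2 h4].
pose f := q \_ `[l, r].
have mD : measurable (`[l, r] : set R) by exact: measurable_itv.
have iq : mu.-integrable `[l, r] (EFin \o q) by exact: lbmf_integrable.
have ifT : mu.-integrable setT (EFin \o f).
  by rewrite /f -restrict_EFin; apply/integrable_restrict => //; rewrite setTI.
have lf := integrable_locally mD iq.
have iy (y : R) : mu.-integrable [set` Interval (BLeft l) (BRight y)] (EFin \o f).
  by apply: integrableS ifT.
have H := FTC1 iy lf.
apply: (aeS H) => x hx xlr; have /andP[lx xr] := xlr.
have lx' : (BLeft l < BRight x)%E by rewrite /Order.lt /=.
have [_ fx] := hx lx'.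
have -> : q x = f x.
  by rewrite /f /patch mem_set//= in_itv /= !ltW.
rewrite -fx derive1E.
have E : {near x, (cst 0) =1 (fun x => \int[mu]_(t in [set` Interval (BLeft l) (BRight x)]) f t)}.
  near=> y.
  have yl : l < y by near: y; apply: (@cvgr_gt _ _ _ _ id x); first exact: cvg_id.
  have yr : y < r by near: y; apply: (@cvgr_lt _ _ _ _ id x); first exact: cvg_id.
  rewrite -[LHS](P0 y) ?yl//; apply: eq_Rintegral => t; rewrite inE /= in_itv /= => /andP[lt ty].
  by rewrite /f /patch mem_set//= in_itv /= lt (le_trans ty (ltW yr)).
rewrite -(near_eq_derive _ E); exact: derive_cst.
Unshelve. all: by end_near. Qed.

Lemma bump_limit (q : R -> R) (l r a b : R) : lbmf q -> l <= a -> a <= b -> b <= r ->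
  int l r (fun x => bump a b n x * q x) @[n --> \oo] --> int a b q.
Proof.
move=> lq la ab br.
have mi : measurable (`]a, b[ : set R) by exact: measurable_itv.
have -> : int a b q = int l r (fun x => \1_(`]a, b[) x * q x).
  have lfi : lbmf (fun x => \1_(`]a, b[ : set R) x * q x).
    by apply: lbmfM => //; exact/bmf_lbmf/bmf_indic.
  rewrite (@int_chasles _ l a r)// ?(le_trans ab)// (@int_chasles _ a b r)//.
  have z (c d : R) : (forall x, c < x < d -> ~~ (a < x < b)) -> int c d (fun x => \1_(`]a, b[ : set R) x * q x) = 0.
    move=> h; apply: int_oo0 => // x /h /negbTE xab.
    by rewrite indicE memNset ?mul0r//= in_itv /= xab.
  rewrite z ?add0r; last by move=> x /andP[_ xa]; rewrite negb_and -leNgt ltW.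
  rewrite [X in _ + X]z ?addr0; last by move=> x /andP[bx _]; rewrite negb_and -!leNgt (ltW bx) orbT.
  rewrite -int_oo// -[RHS]int_oo//; apply: eq_Rintegral => x xab.
  by rewrite indicE xab mul1r.
have [mq _] := lq.
apply: (@Rintegral_dct _ _ (fun n x => bump a b n x * q x) _ (fun x => `|q x|)) => //.
- move=> n; apply: measurable_funM => //; apply: continuous_measurable_fun.
  exact: (Cn_continuous (Cinf_bump a b n 0)).
- by apply: measurable_funM => //; exact: measurable_indic.
- exact/lbmf_integrable/lbmf_norm.
- move=> n x _; rewrite normrM ler_piMl//.
  by have /andP[h1 h2] := bump_range a b n x; rewrite ger0_norm.
- apply: aeW => x _; apply: cvgMl; rewrite indicE.
  case: (boolP (a < x < b)) => h.
    by rewrite mem_set; [exact: bump_cvg|rewrite /= in_itv].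
  rewrite memNset; last by rewrite /= in_itv /=; exact/negP.
  by under eq_fun do rewrite bump_out//; exact: cvg_cst.
Qed.

End Localization.

(** * From the distributional equation to the integrated equation *)
Section Primitive.
Context {R : realType}.
Local Notation mu := (@lebesgue_measure R).
Local Notation "'int' a b f" := (Rintegral mu [set` `[(a : R), (b : R)]] f)
  (at level 10, a, b, f at level 9).

(** Vanishing near 0 makes the primitive constant there, also to the left of 0
    where the integral over an empty interval is 0. *)
Lemma is_derive_prim (q : R -> R) (l : R) : continuous q -> 0 < l ->
  (forall x, x < l -> q x = 0) ->
  forall x : R, is_derive x (1 : R) (fun y : R => int 0 y q) (q x).
Proof.
move=> cq l0 q0 x; have lq := continuous_lbmf cq.
have [xl|lx] := ltP x l.
  rewrite q0//.
  have [dd vv] := is_derive_cst (0 : R) x (1 : R).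
  have E : {near x, (cst 0) =1 (fun y : R => int 0 y q)}.
    near=> y; have yl : y < l by near: y; apply: (@cvgr_lt _ _ _ _ id x); first exact: cvg_id.
    by rewrite int_eq0// => z /andP[_ zy]; apply: q0; exact: le_lt_trans yl.
  apply: DeriveDef; first exact: (near_eq_derivable E dd).
  by rewrite -(near_eq_derive _ E).
have x0 : 0 < x by exact: lt_le_trans lx.
have xx : x < x + 1 by rewrite ltrDl.
have iq : mu.-integrable [set` Interval (BLeft 0) (BRight (x + 1))] (EFin \o q).
  exact: lbmf_integrable.
have a0 : (BLeft (0%R : R) < BRight x)%E by rewrite /Order.lt /=.
have [dd vv] := continuous_FTC1 xx iq a0 (cq x).
apply: DeriveDef; first exact: dd.
by rewrite -vv derive1E.
Unshelve. all: by end_near. Qed.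

Lemma Cinf_prim (q : R -> R) (l : R) : Cinf q -> 0 < l ->
  (forall x, x < l -> q x = 0) -> Cinf (fun y : R => int 0 y q).
Proof.
move=> Cq l0 q0 n; have dq := is_derive_prim (Cn_continuous (Cq 0%N)) l0 q0.
by apply: Cn_weak; exists q.
Qed.

Lemma bump_int_gt0 (a b : R) n : a < b -> 0 < int a b (bump a b n.+1).
Proof.
move=> ab; have lb : lbmf (bump a b n.+1).
  exact/continuous_lbmf/(Cn_continuous (Cinf_bump a b n.+1 0)).
have b0 x : 0 <= bump a b n.+1 x by case/andP: (bump_range a b n.+1 x).
rewrite lt_neqAle eq_sym; apply/andP; split; last exact: int_ge0.
apply/negP => /eqP z; have := int_eq0_ae lb (fun x _ => b0 x) z => h.
have [x xab hx] := exists_ae ab h; have := bump_gt0 n xab.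
by case/andP: xab => xa xb; rewrite hx ?ltxx// !ltW.
Qed.

End Primitive.

Section IntegratedEquation.
Context {R : realType}.
Local Notation mu := (@lebesgue_measure R).
Local Notation "'int' a b f" := (Rintegral mu [set` `[(a : R), (b : R)]] f)
  (at level 10, a, b, f at level 9).
Variables (L : R) (F : R * R -> R).
Hypothesis bF : bmf F.

Definition density y := int (- L) L (fun xi => F (y, xi)).
Let u := density.

Let mu_ : measurable_fun setT u.
Proof. by have [] := bmf_Rintegral2 bF (finite_mset_itv true false (- L) L). Qed.

Definition source (p : R * R) := equilibrium (u p.1) p.2 - F p.

Let bG : bmf source.
Proof.
apply: bmfB => //; apply: bmf_equilibrium; last exact: measurable_snd.
exact: (measurableT_comp mu_ measurable_fst).
Qed.

Hypothesis weak : forall (a a' b : R -> R) (l r l' r' : R), 0 < l -> - L < l' -> r' < L ->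
  Cinf a -> Cinf a' -> Cinf b -> (forall x : R, is_derive x (1 : R) a (a' x)) ->
  (forall x, ~~ (l <= x <= r) -> a x = 0) -> (forall x, ~~ (l <= x <= r) -> a' x = 0) ->
  (forall x, ~~ (l' <= x <= r') -> b x = 0) ->
  int (- L) L (fun xi => b xi * int 0 r (fun y => xi * F (y, xi) * a' y + source (y, xi) * a y)) = 0.

(* The test functions in [y] are primitives of [a'_ = bump - kappa rho0]: the
   constant [kappa] makes the integral of [a'_] zero, so that they have compact
   support in ]0, +oo[. *)
Let rho0 : R -> R := bump 1 2 1.
Let I0 := int 1 2 rho0.
Let I0_gt0 : 0 < I0. Proof. by apply: bump_int_gt0; lra. Qed.

Let lbump (a b : R) n : lbmf (bump a b n).
Proof. exact/continuous_lbmf/(Cn_continuous (Cinf_bump a b n 0)). Qed.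

Let kappa (a b : R) n := int a b (bump a b n) / I0.
Let a'_ (a b : R) n (x : R) := bump a b n x - kappa a b n * rho0 x.
Let a_ (a b : R) n (y : R) := int 0 y (a'_ a b n).
Let l_ (a : R) := Num.min a 1.
Let r_ (b : R) := Num.max b 2.

Let la' (a b : R) n : lbmf (a'_ a b n).
Proof. by apply: lbmfB; [exact: lbump|apply: lbmfMl; exact: lbump]. Qed.

Let Ca' (a b : R) n : Cinf (a'_ a b n).
Proof.
move=> m; have -> : a'_ a b n = (fun x => bump a b n x + (- kappa a b n) * rho0 x).
  by apply/funext => x; rewrite /a'_ mulNr.
apply: CnD; first exact: Cinf_bump.
by apply: CnM; [exact: Cn_cst|exact: Cinf_bump].
Qed.

Let a'0 (a b : R) n x : ~~ (l_ a <= x <= r_ b) -> a'_ a b n x = 0.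
Proof.
move=> h; rewrite /a'_ /rho0 !bump_out ?mulr0 ?subr0//.
  apply: contra h => /andP[h1 h2]; rewrite /l_ /r_ ge_min le_max.
  by rewrite (ltW h1) (ltW h2) !orbT.
apply: contra h => /andP[h1 h2]; rewrite /l_ /r_ ge_min le_max.
by rewrite (ltW h1) (ltW h2).
Qed.

Let int_supp (c d r : R) (f : R -> R) : lbmf f -> 0 < c -> c <= d -> d <= r ->
  (forall x, ~~ (c < x < d) -> f x = 0) -> int 0 r f = int c d f.
Proof.
move=> lf c0 cd dr f0.
rewrite (@int_chasles _ 0 c r)//; [|exact: ltW|exact: le_trans dr].
rewrite (@int_chasles _ c d r)// int_oo0//; last first.
  by move=> x /andP[_ xc]; apply: f0; rewrite negb_and -!leNgt (ltW xc).
rewrite add0r [X in _ + X]int_oo0 ?addr0//.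
by move=> x /andP[dx _]; apply: f0; rewrite negb_and -!leNgt (ltW dx) orbT.
Qed.

Let int_a' (a b : R) n : 0 < a -> a <= b -> int 0 (r_ b) (a'_ a b n) = 0.
Proof.
move=> a0 ab; have lr := lbmfMl (kappa a b n) (lbump 1 2 1).
rewrite intB ?intZ//; try exact: lbump.
rewrite (@int_supp a b _ _ (lbump a b n) a0 ab)//; last 2 first.
- by rewrite /r_ le_max lexx.
- by move=> x; exact: bump_out.
rewrite (@int_supp 1 2 _ _ (lbump 1 2 1) ltr01)//.
- by rewrite -/rho0 -/I0 /kappa divfK ?subrr// gt_eqF.
- by rewrite ler1n.
- by rewrite /r_ le_max lexx orbT.
- by move=> x; exact: bump_out.
Qed.

Let l_gt0 (a : R) : 0 < a -> 0 < l_ a.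
Proof. by move=> a0; rewrite /l_ lt_min a0 ltr01. Qed.

Let a0_ (a b : R) n x : 0 < a -> a <= b -> ~~ (l_ a <= x <= r_ b) -> a_ a b n x = 0.
Proof.
move=> a0 ab; rewrite negb_and -!ltNge => /orP[h|h].
  apply: int_eq0 => z /andP[_ zx]; apply: a'0; rewrite negb_and -ltNge.
  by rewrite (le_lt_trans zx h).
rewrite /a_ (@int_chasles _ 0 (r_ b) x) ?(ltW h)//; last first.
  by rewrite /r_ le_max orbC ler0n.
rewrite int_a'// add0r; apply: int_oo0 => // z /andP[rz _]; apply: a'0.
by rewrite negb_and -!ltNge rz orbT.
Qed.

Let q_ (a b : R) n xi := int 0 (r_ b) (fun y => xi * F (y, xi) * a'_ a b n y + source (y, xi) * a_ a b n y).

Let ba' (a b : R) n : bmf (a'_ a b n).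
Proof. exact: (lbmf_compact_support (la' a b n) (@a'0 a b n)). Qed.

Let ba (a b : R) n : 0 < a -> a <= b -> bmf (a_ a b n).
Proof.
move=> a0 ab; apply: (@lbmf_compact_support _ _ (l_ a) (r_ b)).
  exact: lbmf_prim.
by move=> x; exact: a0_.
Qed.

Let lF xi : lbmf (fun y => F (y, xi)).
Proof. exact/bmf_lbmf/(bmf_pair1 xi bF). Qed.
Let lG xi : lbmf (fun y => source (y, xi)).
Proof. exact/bmf_lbmf/(bmf_pair1 xi bG). Qed.

Let q_E (a b : R) n xi : q_ a b n xi =
  xi * int 0 (r_ b) (fun y => F (y, xi) * a'_ a b n y) + int 0 (r_ b) (fun y => source (y, xi) * a_ a b n y).
Proof.
have l1 := lbmfM (lF xi) (la' a b n).
rewrite -intZ// -intD.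
- by apply: int_eq => y _; rewrite mulrA.
- exact: lbmfMl.
- by apply: lbmfM => //; exact: lbmf_prim.
Qed.

Let lq (a b : R) n : 0 < a -> a <= b -> lbmf (q_ a b n).
Proof.
move=> a0 ab.
have -> : q_ a b n = (fun xi => xi * int 0 (r_ b) (fun y => F (y, xi) * a'_ a b n y) +
   int 0 (r_ b) (fun y => source (y, xi) * a_ a b n y)).
  by apply/funext => xi; exact: q_E.
apply: lbmfD; last first.
  apply/bmf_lbmf/(bmf_Rintegral1 (f := fun p => source p * a_ a b n p.1)).
    by apply: bmfM => //; exact: (bmf_comp measurable_fst (ba n a0 ab)).
  exact: finite_mset_itv.
apply: lbmfM; first exact: lbmf_id.
apply/bmf_lbmf/(bmf_Rintegral1 (f := fun p => F p * a'_ a b n p.1)).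
  by apply: bmfM => //; exact: (bmf_comp measurable_fst (ba' a b n)).
exact: finite_mset_itv.
Qed.

Let q_ae0 (a b : R) n : 0 < a -> a <= b -> {ae mu, forall xi, - L < xi < L -> q_ a b n xi = 0}.
Proof.
move=> a0 ab; apply: ae_zero_rat; first exact: lq.
move=> c d Lc cd dL.
have h := bump_limit (lq n a0 ab) (ltW Lc) (ltW cd) (ltW dL).
rewrite -(cvg_lim _ h)//.
have -> : (fun m => int (- L) L (fun x => bump (ratr c) (ratr d) m x * q_ a b n x)) = (fun=> 0).
  apply/funext => m.
  apply: (weak (l := l_ a) (r := r_ b) (l' := ratr c) (r' := ratr d)) => //.
  - exact: l_gt0.
  - apply: (Cinf_prim (Ca' a b n) (l_gt0 a0)) => x xl; apply: a'0.
    by rewrite negb_and -!ltNge xl.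
  - exact: Cinf_bump.
  - apply: (is_derive_prim (Cn_continuous (Ca' a b n 0)) (l_gt0 a0)) => x xl; apply: a'0.
    by rewrite negb_and -!ltNge xl.
  - by move=> x; exact: a0_.
  - by move=> x; exact: a'0.
  - move=> x h2; apply: bump_out; apply: contra h2 => /andP[h3 h4].
    by rewrite !ltW.
exact: lim_cst.
Qed.

Let q_all0 : {ae mu, forall xi, - L < xi < L -> forall (n : nat) (a b : rat),
   0 < ratr a :> R -> ratr a < ratr b :> R -> q_ (ratr a) (ratr b) n xi = 0}.
Proof.
(* A single null set serves the countably many triples (n, a, b). *)
pose P (k : nat) (xi : R) := - L < xi < L -> if @unpickle (nat * (rat * rat))%type k is Some (n, (a, b)) then
  0 < ratr a :> R -> ratr a < ratr b :> R -> q_ (ratr a) (ratr b) n xi = 0 else True.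
have : {ae mu, forall xi, forall k, P k xi}.
  apply/ae_foralln => k; rewrite /P.
  case: unpickle => [[n [a b]]|]; last exact: aeW.
  have [a0|a0] := ltP 0 (ratr a : R); last by apply: aeW.
  have [ab|ab] := ltP (ratr a : R) (ratr b : R); last by apply: aeW.
  by apply: (aeS (q_ae0 n a0 (ltW ab))) => xi h /h.
move=> h; apply: (aeS h) => xi hP xiL n a b a0 ab.
by have := hP (pickle (n, (a, b))) xiL; rewrite pickleK; apply.
Qed.

Let R0 (y : R) := int 0 y rho0.

(** Average with weight [rho0 / I0] of [xi * F (y, xi)] minus the integral of the
    source up to [y], a quantity that the integrated equation makes constant in
    [y].  An integration by parts has moved the inner integral onto [rho0], which
    makes the measurability in [xi] visible. *)
Definition trace_flux xi := (xi * int 0 2 (fun y => F (y, xi) * rho0 y) -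
   int 0 2 (fun s => source (s, xi) * (I0 - R0 s))) / I0.

Let K xi (y : R) := xi * F (y, xi) - int 0 y (fun s => source (s, xi)).
Let lK xi : lbmf (K xi).
Proof. by apply: lbmfB; [exact: lbmfMl|exact/lbmf_prim/lG]. Qed.

Let int_rho0 (r : R) (f : R -> R) : lbmf f -> 2 <= r ->
   int 0 r (fun y => rho0 y * f y) = int 1 2 (fun y => rho0 y * f y).
Proof.
move=> lf r2; apply: int_supp => //.
- by apply: lbmfM => //; exact: lbump.
- by rewrite ler1n.
- by move=> x h; rewrite /rho0 bump_out ?mul0r.
Qed.

Let int_rho0_1 (r : R) : 2 <= r -> int 0 r rho0 = I0.
Proof.
move=> r2; apply: int_supp => //.
- exact: lbump.
- by rewrite ler1n.
- by move=> x h; rewrite /rho0 bump_out.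
Qed.

Let trace_fluxE xi : trace_flux xi = int 1 2 (fun y => rho0 y * K xi y) / I0.
Proof.
congr (_ / _).
have l2 : 0 <= 2 :> R by rewrite ler0n.
have lr : lbmf rho0 by exact: lbump.
have lP := lbmf_prim (lG xi).
have lR0 : lbmf R0 by exact: lbmf_prim.
rewrite -(int_rho0 (lK xi) (lexx 2)).
have -> : int 0 2 (fun y => rho0 y * K xi y) =
   xi * int 0 2 (fun y => F (y, xi) * rho0 y) - int 0 2 (fun y => rho0 y * int 0 y (fun s => source (s, xi))).
  have lFr : lbmf (fun y => F (y, xi) * rho0 y) by exact: lbmfM.
  rewrite -intZ// -intB; [|exact: lbmfMl|exact: lbmfM].
  by apply: int_eq => y _; rewrite /K; ring.
congr (_ - _).
have := int_by_parts l2 lr (lG xi).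
rewrite (int_rho0_1 (lexx 2)) => H.
have -> : int 0 2 (fun s => source (s, xi) * (I0 - R0 s)) =
  I0 * int 0 2 (fun s => source (s, xi)) - int 0 2 (fun s => source (s, xi) * R0 s).
  have lGR : lbmf (fun s => source (s, xi) * R0 s) by apply: lbmfM.
  rewrite -intZ// -intB//; last exact: lbmfMl.
  by apply: int_eq => s _; ring.
by rewrite -H addrK.
Qed.

(** The du Bois-Reymond lemma in [y], for almost every [xi]: what is orthogonal to
    all functions of zero integral is constant. *)
Lemma weak_integral : {ae mu, forall xi, - L < xi < L -> {ae mu, forall y, 0 < y ->
  xi * F (y, xi) = trace_flux xi + int 0 y (fun s => source (s, xi))}}.
Proof.
apply: (aeS q_all0) => xi hq xiL; have {hq} := hq xiL => hq.
have h1 (n : nat) (a b : rat) : 0 < ratr a :> R -> ratr a < ratr b :> R ->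
  int (ratr a) (ratr b) (fun x => bump (ratr a) (ratr b) n x * K xi x) =
  int (ratr a) (ratr b) (fun x => bump (ratr a) (ratr b) n x * trace_flux xi).
  move=> a0 ab; have := hq n a b a0 ab; rewrite q_E.
  set al : R := ratr a in a0 ab *; set be : R := ratr b in ab *.
  have r0 : 0 <= r_ be by rewrite /r_ le_max ler0n orbT.
  have ler2 : 2 <= r_ be by rewrite /r_ le_max lexx orbT.
  have lerb : be <= r_ be by rewrite /r_ le_max lexx.
  have := int_by_parts r0 (la' al be n) (lG xi).
  rewrite (int_a' n a0 (ltW ab)) mul0r -/(a_ al be n) => H.
  have lP := lbmf_prim (lG xi).
  have lFa : lbmf (fun y => F (y, xi) * a'_ al be n y) by exact: lbmfM.
  have laP : lbmf (fun s => a'_ al be n s * int 0 s (fun r => source (r, xi))) by exact: lbmfM.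
  have lbK : lbmf (fun y => bump al be n y * K xi y) by apply: lbmfM => //; exact: lbump.
  have lrK : lbmf (fun y => rho0 y * K xi y) by apply: lbmfM => //; exact: lbump.
  move=> H2.
  have H3 : int 0 (r_ be) (fun y => bump al be n y * K xi y - kappa al be n * (rho0 y * K xi y)) = 0.
    rewrite -[RHS]H2.
    have -> : int 0 (r_ be) (fun y => source (y, xi) * a_ al be n y) =
       - int 0 (r_ be) (fun s => a'_ al be n s * int 0 s (fun r => source (r, xi))).
      by apply/eqP; rewrite -addr_eq0 addrC; apply/eqP.
    rewrite -intZ// -intB//; last exact: lbmfMl.
    by apply: int_eq => y _; rewrite /a'_ /K; ring.
  move: H3; rewrite intB//; last exact: lbmfMl.
  rewrite intZ// (int_rho0 (lK xi) ler2).
  rewrite (int_supp lbK a0 (ltW ab) lerb); last by move=> x h; rewrite bump_out ?mul0r.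
  move=> /eqP; rewrite subr_eq0 => /eqP ->.
  have -> : int al be (fun x => bump al be n x * trace_flux xi) = trace_flux xi * int al be (bump al be n).
    by rewrite -intZ; [apply: int_eq => x _; rewrite mulrC|exact: lbump].
  by rewrite trace_fluxE /kappa; ring.
have h2 (a b : rat) : 0 < ratr a :> R -> ratr a < ratr b :> R ->
  int (ratr a) (ratr b) (fun x => K xi x - trace_flux xi) = 0.
  move=> a0 ab.
  have c1 := bump_limit (lK xi) (lexx (ratr a : R)) (ltW ab) (lexx (ratr b : R)).
  have c2 := bump_limit (lbmf_cst (trace_flux xi)) (lexx (ratr a : R)) (ltW ab) (lexx (ratr b : R)).
  rewrite intB//; last exact: lbmf_cst.
  have E : (fun n => int (ratr a) (ratr b) (fun x => bump (ratr a) (ratr b) n x * K xi x)) =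
      (fun n => int (ratr a) (ratr b) (fun x => bump (ratr a) (ratr b) n x * trace_flux xi)).
    by apply/funext => n; exact: h1.
  rewrite E in c1.
  have -> : int (ratr a) (ratr b) (K xi) = int (ratr a) (ratr b) (fun=> trace_flux xi).
    exact: (cvg_unique _ c1 c2).
  exact: subrr.
have lKt : lbmf (fun x => K xi x - trace_flux xi) by apply: lbmfB => //; exact: lbmf_cst.
have h3 (N : nat) : {ae mu, forall y, 0 < y < N%:R -> K xi y - trace_flux xi = 0}.
  by apply: ae_zero_rat => // a b a0 ab _; exact: h2.
have /ae_foralln h4 := h3.
apply: (aeS h4) => y hy y0.
have := hy (Num.trunc y).+1; rewrite y0 truncnS_gt => /(_ isT) /eqP.
by rewrite /K subr_eq0 subr_eq => /eqP.
Qed.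

End IntegratedEquation.

(** * Identification of the constants and of the state *)
Section WeakToMild.
Context {R : realType}.
Local Notation mu := (@lebesgue_measure R).
Local Notation "'int' a b f" := (Rintegral mu [set` `[(a : R), (b : R)]] f)
  (at level 10, a, b, f at level 9).
Variables (L V : R) (g : R -> R) (F : R * R -> R).
Hypothesis L0 : 0 < L.
Hypothesis mg : measurable_fun setT g.
Hypothesis g01 : forall xi, 0 <= g xi <= 1.
Hypothesis bF : bmf F.
Hypothesis rF : forall p, kinetic_range p.2 (F p).
Let Lge0 : 0 <= L. Proof. exact: ltW. Qed.
Let Lle0 : - L <= 0. Proof. by rewrite oppr_le0. Qed.
Let LL : - L <= L. Proof. exact: le_trans Lle0 Lge0. Qed.

Notation u := (density L F).
Notation source := (source L F).
Notation trace_flux := (trace_flux L F).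

Let mu_ : measurable_fun setT u.
Proof. by have [] := bmf_Rintegral2 bF (finite_mset_itv true false (- L) L). Qed.

Let bG : bmf source.
Proof.
apply: bmfB => //; apply: bmf_equilibrium; last exact: measurable_snd.
exact: (measurableT_comp mu_ measurable_fst).
Qed.

Let lG xi : lbmf (fun y => source (y, xi)).
Proof. exact/bmf_lbmf/(bmf_pair1 xi bG). Qed.

Hypothesis integral_eq : {ae mu, forall xi, - L < xi < L -> {ae mu, forall y, 0 < y ->
  xi * F (y, xi) = trace_flux xi + int 0 y (fun s => source (s, xi))}}.
Hypothesis trace : forall e, 0 < e -> exists2 d, 0 < d &
  {ae mu, forall y, 0 < y < d -> int 0 L (fun xi => `|F (y, xi) - g xi|) <= e}.
Hypothesis fluxF : {ae mu, forall y, 0 < y -> int (- L) L (fun xi => xi * F (y, xi)) = V}.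

Let lbump (a b : R) n : lbmf (bump a b n).
Proof. exact/continuous_lbmf/(Cn_continuous (Cinf_bump a b n 0)). Qed.

Lemma lbmf_trace_flux : lbmf trace_flux.
Proof.
have bt c (h : R -> R) : lbmf h -> bmf (fun p : R * R => \1_(`[0, c]) p.1 * h p.1).
  move=> lh; apply: (bmf_comp (f := fun y => \1_(`[0, c]) y * h y) measurable_fst).
  apply: (@lbmf_compact_support _ _ 0 c).
    by apply: lbmfM => //; exact/bmf_lbmf/bmf_indic.
  by move=> x h0; rewrite indicE memNset ?mul0r//= in_itv /=; exact/negP.
have E c (h k : R -> R) : int 0 c (fun y => k y * (\1_(`[0, c]) y * h y)) = int 0 c (fun y => k y * h y).
  by apply: int_eq => x xc; rewrite indicE mem_set ?mul1r//= in_itv.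
have I1 (f : R * R -> R) c (h : R -> R) : bmf f -> lbmf h ->
  lbmf (fun xi => int 0 c (fun y => f (y, xi) * h y)).
  move=> bf lh.
  have -> : (fun xi => int 0 c (fun y => f (y, xi) * h y)) =
    (fun xi => int 0 c (fun y => f (y, xi) * (\1_(`[0, c]) y * h y))).
    by apply/funext => xi; rewrite E.
  apply/bmf_lbmf/(bmf_Rintegral1 (f := fun p => f p * (\1_(`[0, c]) p.1 * h p.1))).
    by apply: bmfM => //; exact: bt.
  exact: finite_mset_itv.
apply: lbmfM; last exact: lbmf_cst.
apply: lbmfB.
  by apply: lbmfM; [exact: lbmf_id|apply: I1 => //; exact: lbump].
apply: I1 => //; apply: lbmfB; first exact: lbmf_cst.
exact/lbmf_prim/lbump.
Qed.

Let source_bound p : `|source p| <= 1.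
Proof.
by apply: (@kinetic_range_dist _ p.2); [exact: equilibrium_range|exact: rF].
Qed.

Let int_source y xi : 0 <= y -> `|int 0 y (fun s => source (s, xi))| <= y.
Proof.
move=> y0; have := @int_norm_le _ 0 y (fun s => source (s, xi)) 1 y0 (lG xi).
by rewrite mul1r subr0; apply => x _; exact: source_bound.
Qed.

(** The source is bounded by 1.  Fubini exchanges the two quantifiers over null
    sets: the integrated equation holds for almost every [xi], the trace is
    about almost every [y]. *)
Lemma trace_flux_close : {ae mu, forall y, 0 < y -> {ae mu, forall xi, - L < xi < L ->
  `|xi * F (y, xi) - trace_flux xi| <= y}}.
Proof.
pose A : set (R * R) := [set p | [&& 0 < p.1, - L < p.2, p.2 < L & p.1 < `|p.2 * F p - trace_flux p.2|]].
have mA : measurable A.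
  have mb : measurable_fun setT (fun p : R * R => [&& 0 < p.1, - L < p.2, p.2 < L & p.1 < `|p.2 * F p - trace_flux p.2|]).
    have m1 := @measurable_fst _ _ R R; have m2 := @measurable_snd _ _ R R.
    have [mF _] := bF; have [mt _] := lbmf_trace_flux.
    have m3 : measurable_fun setT (fun p : R * R => `|p.2 * F p - trace_flux p.2|).
      apply: (measurableT_comp (@normr_measurable R setT)); apply: measurable_funB.
        exact: measurable_funM.
      exact: (measurableT_comp mt).
    apply: measurable_and; first by apply: measurable_fun_ltr => //; exact: measurable_cst.
    apply: measurable_and; first by apply: measurable_fun_ltr => //; exact: measurable_cst.
    apply: measurable_and; first by apply: measurable_fun_ltr => //; exact: measurable_cst.
    exact: measurable_fun_ltr.
  exact: measurable_set_bool mb.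
have h : {ae mu, forall xi, {ae mu, forall y, ~ A (y, xi)}}.
  apply: (aeS integral_eq) => xi hxi.
  case: (boolP (- L < xi < L)) => [xiL|xiL].
    apply: (aeS (hxi xiL)) => y hy; rewrite /A /= => /and4P[y0 _ _].
    by rewrite hy// addrAC subrr add0r ltNge int_source// ltW.
  apply: aeW => y; rewrite /A /= => /and4P[_ h1 h2 _].
  by move: xiL; rewrite h1 h2.
have := ae_leb2_1 (ae2_leb2 mA h) => h2.
apply: (aeS h2) => y hy y0; apply: (aeS hy) => xi hA /andP[h3 h4].
by rewrite leNgt; apply/negP => h5; apply: hA; rewrite /A /= y0 h3 h4.
Qed.

(** At a small [y] where both the trace and [trace_flux_close] are available,
    the distance of [trace_flux] to [xi * g] is controlled by [y] and by the
    distance of [F (y, .)] to [g]; these bounds hold almost everywhere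
    only, and the minimum below makes them hold everywhere. *)
Lemma trace_flux_data : {ae mu, forall xi, 0 <= xi <= L -> trace_flux xi = xi * g xi}.
Proof.
have lt := lbmf_trace_flux.
have lg : lbmf g.
  by split=> // y; exists 1 => x _; have /andP[h1 h2] := g01 x; rewrite ger0_norm.
have lxg : lbmf (fun xi => xi * g xi) by apply: lbmfM => //; exact: lbmf_id.
have ld : lbmf (fun xi => `|trace_flux xi - xi * g xi|) by exact/lbmf_norm/lbmfB.
have I0 : int 0 L (fun xi => `|trace_flux xi - xi * g xi|) = 0.
  apply/eqP; rewrite eq_le; apply/andP; split; last by apply: int_ge0.
  apply/ler_addgt0Pl => e e0; rewrite addr0.
  have e1 : 0 < e / (2 * L) by rewrite divr_gt0 ?mulr_gt0.
  have [d d0 hd] := trace e1.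
  have m0 : 0 < Num.min d (e / (2 * L)) by rewrite lt_min d0.
  have [y /andP[y0 ym] [hy1 hy2]] := exists_ae m0
    (aeI (S := fun y => _ /\ _) hd trace_flux_close (fun x h1 h2 => conj h1 h2)).
  move: ym; rewrite lt_min => /andP[yd ye].
  have {}hy1 := hy1 (introT andP (conj y0 yd)); have {}hy2 := hy2 y0.
  have lFy : lbmf (fun xi => F (y, xi)) by exact/bmf_lbmf/(bmf_pair2 y bF).
  have lFg : lbmf (fun xi => `|F (y, xi) - g xi|) by exact/lbmf_norm/lbmfB.
  have lm : lbmf (fun xi => Num.min `|trace_flux xi - xi * g xi| (y + L * `|F (y, xi) - g xi|)).
    have l1 := lbmfD (lbmf_cst y) (lbmfMl L lFg).
    split.
      by apply: (measurable_minr (f := fun xi => `|trace_flux xi - xi * g xi|)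
        (g := fun xi => y + L * `|F (y, xi) - g xi|)); [case: ld|case: l1].
    move=> z; have [C hC] := ld.2 z; have [C' hC'] := l1.2 z; exists (Num.max C C') => x xz.
    rewrite le_max; case: (leP `|trace_flux x - x * g x| _) => _; first by rewrite hC.
    by rewrite hC' ?orbT.
  rewrite (int_ae_eq ld lm); last first.
    have n0L : {ae mu, forall x : R, x != 0 /\ x != L}.
      apply: (aeI (ae_null (measurable_set1 (0 : R)) (lebesgue_measure_set1 0))
        (ae_null (measurable_set1 L) (lebesgue_measure_set1 L))) => x h1 h2.
      by split; apply/eqP.
    apply: (aeI hy2 n0L).
    move=> x hx [xn0 xnL] /andP[x0 xL]; apply/esym/min_idPl.
    have x0' : 0 < x by rewrite lt_neqAle eq_sym xn0.
    have xL' : x < L by rewrite lt_neqAle xnL.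
    have h1 : `|x * F (y, x) - trace_flux x| <= y.
      by apply: hx; rewrite xL' andbT (le_lt_trans Lle0).
    have -> : trace_flux x - x * g x = - (x * F (y, x) - trace_flux x) + x * (F (y, x) - g x) by ring.
    rewrite (le_trans (ler_normD _ _))// normrN lerD// normrM (ger0_norm x0).
    by rewrite ler_wpM2r.
  apply: (@le_trans _ _ (int 0 L (fun xi => y + L * `|F (y, xi) - g xi|))).
    apply: int_le => //; first by apply: lbmfD; [exact: lbmf_cst|exact: lbmfMl].
    by move=> x _; rewrite ge_min lexx orbT.
  rewrite intD; [|exact: lbmf_cst|exact: lbmfMl].
  rewrite int_cst// intZ// subr0.
  have -> : e = e / (2 * L) * L + L * (e / (2 * L)) by field; rewrite gt_eqF.
  by apply: lerD; [rewrite ler_wpM2r// ltW|rewrite ler_wpM2l].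
have := int_eq0_ae ld (fun x _ => normr_ge0 _) I0 => h.
by apply: (aeS h) => x hx /hx/eqP; rewrite normr_eq0 subr_eq0 => /eqP.
Qed.

Lemma ae_and_positive (xi : R) (P : R -> Prop) : {ae mu, forall y, 0 < y -> P y} ->
  forall z, 0 < z -> exists2 y, z < y & P y.
Proof.
move=> h z z0; have zz : z < z + 1 by rewrite ltrDl.
have [y /andP[zy _] Py] := exists_ae zz h.
by exists y => //; apply: Py; exact: lt_trans zy.
Qed.

(** A solution of the integrated equation is given by Duhamel's formula; the
    initial value is [g xi] for [xi > 0], and boundedness fixes it for
    [xi < 0]. *)
Lemma slice_relax : {ae mu, forall xi, - L < xi < L -> {ae mu, forall y, 0 < y ->
  F (y, xi) = relax L g u (y, xi)}}.
Proof.
have n0 := ae_null (measurable_set1 (0 : R)) (lebesgue_measure_set1 0).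
have n1 : {ae mu, forall xi : R, xi != 0 /\ (0 <= xi <= L -> trace_flux xi = xi * g xi)}.
  by apply: (aeI n0 trace_flux_data) => x h1 h2; split => //; apply/eqP.
apply: (aeI integral_eq n1) => xi hxi [xin0 tfg] xiL; have {}hxi := hxi xiL.
pose m s := equilibrium (u s) xi.
have bm : bmf m by exact: bmf_equilibrium2.
have lm := bmf_lbmf bm.
pose c := trace_flux xi / xi.
pose f y := c + xi^-1 * int 0 y (fun s => source (s, xi)).
have lP := lbmf_prim (lG xi).
have lf : lbmf f by apply: lbmfD; [exact: lbmf_cst|exact: lbmfMl].
have Ff : {ae mu, forall y, 0 < y -> F (y, xi) = f y}.
  apply: (aeS hxi) => y hy y0; apply: (mulfI xin0); rewrite hy// /f /c.
  by rewrite mulrDr mulrCA mulfV// mulr1 mulrA mulfV// mul1r.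
have lFx : lbmf (fun y => F (y, xi)) by exact/bmf_lbmf/(bmf_pair1 xi bF).
have fE z : 0 <= z -> f z - c = xi^-1 * int 0 z (fun s => m s - f s).
  move=> z0; rewrite /f addrAC subrr add0r; congr (_ * _).
  apply: int_ae_eq; [exact: lG|exact: lbmfB|].
  apply: (aeI Ff n0) => s hs sn0 /andP[s0 _]; rewrite /source /= hs// lt_neqAle s0 andbT eq_sym.
  exact/eqP.
have fD y : 0 <= y -> f y = duhamel xi^-1 c m y by move=> y0; apply: ode_duhamel.
apply: (aeS Ff) => y hy y0; rewrite hy// fD ?(ltW y0)//.
have [x0|x0|x0] := ltgtP 0 xi; last by move: xin0; rewrite -x0 eqxx.
- rewrite relax_pos ?(ltW y0)//; last by rewrite x0; case/andP: xiL.
  congr duhamel; rewrite /c tfg ?mulKr ?unitfE//; last by rewrite (ltW x0) /= ltW//; case/andP: xiL.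
  by rewrite mulrC mulKf.
- have k0 : xi^-1 < 0 by rewrite invr_lt0.
  rewrite relax_neg ?(ltW y0)//; last by rewrite x0 andbT; case/andP: xiL.
  rewrite backwardE ?(ltW y0)//; congr duhamel.
  apply: (@bounded_duhamel _ _ _ _ 1 k0 bm) => n.
  have n1_gt0 : 0 < n.+1%:R :> R by rewrite ltr0n.
  have [z nz Fz] := ae_and_positive xi Ff n1_gt0.
  have z0 : 0 <= z by rewrite ltW// (lt_trans n1_gt0).
  exists z; split.
    by rewrite (le_trans _ (ltW nz))// ler_nat.
  by rewrite -fD// -Fz; exact: (kinetic_range_norm (rF (z, xi))).
Qed.

Hypothesis Fout : forall p, ~~ (`|p.2| < L) -> F p = 0.

Lemma weak_eq_relax : {ae @leb2 R, forall p, 0 < p.1 -> F p = relax L g u p}.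
Proof.
pose A : set (R * R) := [set p | (0 < p.1) && (F p != relax L g u p)].
have mr := measurable_relax L mg mu_.
have mA : measurable A.
  have mb : measurable_fun setT (fun p : R * R => (0 < p.1) && ~~ (F p == relax L g u p)).
    have [mF _] := bF.
    apply: measurable_and.
      by apply: measurable_fun_ltr; [exact: measurable_cst|exact: measurable_fst].
    by apply: measurable_neg; apply: measurable_fun_eqr.
  exact: measurable_set_bool mb.
have h : {ae mu, forall xi, {ae mu, forall y, ~ A (y, xi)}}.
  apply: (aeS slice_relax) => xi hxi.
  case: (boolP (- L < xi < L)) => xiL.
    by apply: (aeS (hxi xiL)) => y hy; rewrite /A /= => /andP[/hy -> ]; rewrite eqxx.
  apply: aeW => y; rewrite /A /= Fout ?relax_out ?eqxx ?andbF//=; last by rewrite ltr_norml.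
  by rewrite negb_and orbC ltr_norml xiL.
apply: (aeS (ae2_leb2 mA h)) => p hp p0; apply/eqP; apply/negPn/negP => hn.
by apply: hp; rewrite /A /= p0.
Qed.

Lemma relax_ae_ext (v w : R -> R) : measurable_fun setT v -> measurable_fun setT w ->
  {ae mu, forall s, 0 < s -> v s = w s} -> relax L g v = relax L g w.
Proof.
move=> mv mw vw; apply/funext => -[y xi]; rewrite relax_max [RHS]relax_max.
set z := Num.max y 0; have z0 : 0 <= z by rewrite /z le_max lexx orbT.
have n0 := ae_null (measurable_set1 (0 : R)) (lebesgue_measure_set1 0).
have vw0 : {ae mu, forall s, 0 <= s -> v s = w s}.
  apply: (aeI vw n0) => s h /eqP sn0 s0; apply: h.
  by rewrite lt_neqAle eq_sym sn0.
have be (t : R -> R) : measurable_fun setT t -> bmf (fun s => equilibrium (t s) xi).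
  by move=> mt; exact: bmf_equilibrium2.
have [h|h|h] := velocityP L xi.
- rewrite !relax_pos// /duhamel; congr (_ * (_ + _)); apply: int_ae_eq.
  + exact/lbmf_kexp/bmf_lbmf/be.
  + exact/lbmf_kexp/bmf_lbmf/be.
  + by apply: (aeS vw0) => s hs /andP[s0 _]; rewrite /kexp hs.
- rewrite !relax_neg// /backward; congr (- (_ * _)).
  rewrite /tail /Rintegral; congr fine.
  have E : {ae mu, forall s, (`[z, +oo[%classic : set R) s ->
     (EFin \o kexp xi^-1 (fun s => equilibrium (v s) xi)) s = (EFin \o kexp xi^-1 (fun s => equilibrium (w s) xi)) s}.
    apply: (aeS vw0) => s hs; rewrite /= in_itv /= andbT => zs.
    by rewrite /kexp hs// (le_trans z0 zs).
  apply: ae_eq_integral => //.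
  + apply/measurable_EFinP; apply: measurable_funTS.
    by have [] := lbmf_kexp xi^-1 (bmf_lbmf (be v mv)).
  + apply/measurable_EFinP; apply: measurable_funTS.
    by have [] := lbmf_kexp xi^-1 (bmf_lbmf (be w mw)).
- by rewrite !relax_out.
Qed.

(** The density of [F] satisfies the fixed point equation at almost every
    position; [mean u] is the representative that satisfies it at all positions,
    and [relax] does not see the difference. *)
Lemma weak_mild : exists v, [/\ mild L g v, flux L g v 0 = V &
  {ae @leb2 R, forall p, 0 < p.1 -> F p = relax L g v p}].
Proof.
pose v := mean L g u.
have mv : measurable_fun setT v by exact: measurable_mean.
have Fr := weak_eq_relax.
have Fr1 := ae_leb2_1 Fr.
have slice y : lbmf (fun xi => F (y, xi)) by exact/bmf_lbmf/(bmf_pair2 y bF).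
have uv : {ae mu, forall s, 0 < s -> u s = v s}.
  apply: (aeS Fr1) => s hs s0; apply: int_ae_eq => //.
    exact/bmf_lbmf/bmf_relax_y.
  by apply: (aeS hs) => xi h _; exact: h.
have rE : relax L g u = relax L g v by exact: relax_ae_ext.
have mildv : mild L g v.
  split; first exact: mv.
  by move=> y; rewrite -[v y]/(mean L g u y) /mean rE.
exists v; split; [exact: mildv| |]; last first.
  by apply: (aeS Fr) => p h p0; rewrite (h p0) rE.
have [y /andP[y0 _] [h1 h2]] := exists_ae (ltr01 : (0 : R) < 1)
    (aeI (S := fun y => _ /\ _) Fr1 fluxF (fun x h1 h2 => conj h1 h2)).
rewrite -(mild_flux L0 mg g01 mildv (ltW y0)) -(h2 y0).
apply/esym/int_ae_eq.
- by apply: lbmfM; first exact: lbmf_id.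
- exact: lbmf_xrelax.
- by apply: (aeS h1) => xi h _; rewrite (h y0) rE.
Qed.

End WeakToMild.

(** * Representatives of the data and of the solution *)
Section ClippedSolution.
Context {R : realType}.
Local Notation mu := (@lebesgue_measure R).
Local Notation "'int' a b f" := (Rintegral mu [set` `[(a : R), (b : R)]] f)
  (at level 10, a, b, f at level 9).

Lemma Lfun_measurable d (T : measurableType d) (m : {measure set T -> \bar R}) p (f : T -> R) :
  f \in Lfun m p -> measurable_fun setT f.
Proof. by rewrite inE => /andP[]; rewrite inE. Qed.

Lemma Rintegral_ae_eq d (T : measurableType d) (m : {measure set T -> \bar R}) (D : set T) (f h : T -> R) :
  measurable D -> measurable_fun setT f -> measurable_fun setT h ->
  {ae m, forall p, D p -> f p = h p} -> \int[m]_(p in D) f p = \int[m]_(p in D) h p.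
Proof.
move=> mD mf mh fh; rewrite /Rintegral; congr fine; apply: ae_eq_integral => //.
- by apply/measurable_EFinP; apply: measurable_funTS.
- by apply/measurable_EFinP; apply: measurable_funTS.
- by apply: (aeS fh) => p hp Dp; rewrite hp.
Qed.

Lemma Rintegral_support d (T : measurableType d) (m : {measure set T -> \bar R}) (A B : set T) (f : T -> R) :
  (forall p, ~ A p -> f p = 0) -> (forall p, ~ B p -> f p = 0) ->
  \int[m]_(p in A) f p = \int[m]_(p in B) f p.
Proof.
move=> fA fB; rewrite Rintegral_mkcond [RHS]Rintegral_mkcond; congr (Rintegral _ _ _).
apply/funext => p; rewrite /patch; case: ifPn => pA; case: ifPn => pB //.
  by apply: fB => /mem_set; exact/negP.
by apply/esym/fA => /mem_set; exact/negP.
Qed.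

Lemma ae_fst (Q : R -> Prop) : {ae mu, forall y, Q y} -> {ae @leb2 R, forall p, Q p.1}.
Proof.
move=> [N [mN N0 QN]]; exists (N `*` setT); split.
- exact: measurableX.
- rewrite /leb2 product_measure1E//.
  by have := N0; rewrite /= => ->; rewrite mul0e.
- by move=> p /= h; split => //; apply: QN.
Qed.

Lemma ae_snd (Q : R -> Prop) : {ae mu, forall y, Q y} -> {ae @leb2 R, forall p, Q p.2}.
Proof.
move=> [N [mN N0 QN]]; exists (setT `*` N); split.
- exact: measurableX.
- rewrite /leb2 product_measure1E//.
  by have := N0; rewrite /= => ->; rewrite mule0.
- by move=> p /= h; split => //; apply: QN.
Qed.

Lemma ae_neq (c : R) : {ae mu, forall x, x != c}.
Proof.
apply: (aeS (ae_null (measurable_set1 c) (lebesgue_measure_set1 c))) => x h.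
exact/eqP.
Qed.

Definition clip (x : R) := Num.max 0 (Num.min x 1).

Lemma clip_range x : 0 <= clip x <= 1.
Proof. by rewrite /clip le_max lexx /= ge_max ler01 ge_min lexx orbT. Qed.

Lemma clip_id x : 0 <= x <= 1 -> clip x = x.
Proof. by move=> /andP[x0 x1]; rewrite /clip min_l// max_r. Qed.

Lemma measurable_clip d (T : measurableType d) (f : T -> R) :
  measurable_fun setT f -> measurable_fun setT (fun x => clip (f x)).
Proof.
move=> mf; apply: (measurable_maxr (f := fun=> 0) (g := fun x => Num.min (f x) 1)).
  exact: measurable_cst.
by apply: (measurable_minr (f := f) (g := fun=> 1)) => //; exact: measurable_cst.
Qed.

(** The constraints on [g] and [F] hold almost everywhere; clipping gives
    representatives for which they hold everywhere. *)
Definition clip_data (g : R -> R) xi := clip ((g \_ `]0, +oo[) xi).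

Definition clip_kinetic (L : R) (F : R * R -> R) (p : R * R) :=
  let x := (F \_ half_plane) p in
  if 0 < p.2 < L then clip x else if - L < p.2 < 0 then - clip (- x) else 0.

Variables (L V : R) (g : R -> R) (F : R * R -> R).
Hypothesis L0 : 0 < L.
Hypothesis Vg : admissible L V g.

Let g1 := clip_data g.
Let g0 := g \_ `]0, +oo[.

Lemma measurable_data0 : measurable_fun setT g0.
Proof. by case: Vg => _ /Lfun_measurable. Qed.

Lemma measurable_clip_data : measurable_fun setT g1.
Proof. by apply: measurable_clip; exact: measurable_data0. Qed.

Lemma clip_data_range xi : 0 <= g1 xi <= 1.
Proof. exact: clip_range. Qed.

Lemma clip_data_ae : {ae mu, forall xi, 0 < xi -> g1 xi = g xi}.
Proof.
case: Vg => _ _ gr _ _; apply: (aeS gr) => xi h x0.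
rewrite /g1 /clip_data /patch mem_set//= ?in_itv/= ?x0// clip_id//.
exact: h.
Qed.

Lemma clip_data_flux : int 0 L (fun xi => xi * g1 xi) = \int[mu]_(xi in `[0, L]) (xi * g xi).
Proof.
transitivity (int 0 L (fun xi => xi * g0 xi)).
  apply: Rintegral_ae_eq => //.
  - by apply: measurable_funM => //; exact: measurable_clip_data.
  - by apply: measurable_funM => //; exact: measurable_data0.
  - apply: (aeI clip_data_ae (ae_neq 0)) => x h xn0; rewrite /= in_itv /= => /andP[x0 _].
    have x1 : 0 < x by rewrite lt_neqAle eq_sym xn0.
    by rewrite h// /g0 /patch mem_set//= in_itv /= x1.
apply: int_eq => x /andP[x0 _]; rewrite /g0 /patch.
case: ifPn => // /negP h; have -> : x = 0; last by rewrite !mul0r.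
apply/eqP; rewrite eq_le x0 andbT leNgt; apply/negP => x1; apply: h.
by rewrite inE /= in_itv /= x1.
Qed.

Hypothesis sol : layer_solution L V g F.

Let F0 := F \_ half_plane.
Let F1 := clip_kinetic L F.

Lemma half_planeE (p : R * R) : half_plane p = (0 < p.1) :> Prop.
Proof.
apply/propext; rewrite /half_plane /=; split; first by case; rewrite in_itv /= andbT.
by move=> h; split => //; rewrite in_itv /= h.
Qed.

Lemma F0E p : 0 < p.1 -> F0 p = F p.
Proof. by move=> p0; rewrite /F0 /patch mem_set// half_planeE. Qed.

Lemma measurable_F0 : measurable_fun setT F0.
Proof. by case: sol => /Lfun_measurable. Qed.

Lemma clip_kinetic_range p : kinetic_range p.2 (F1 p).
Proof.
have n x : - 1 <= - clip (- x) <= 0.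
  by have /andP[h1 h2] := clip_range (- x); rewrite lerN2 h2 oppr_le0.
rewrite /F1 /clip_kinetic; case: ifPn => [/andP[p0 _]|_].
  by rewrite /kinetic_range p0 clip_range.
case: ifPn => [/andP[_ p0]|_].
  by rewrite /kinetic_range (lt_gtF p0) p0 n.
by rewrite /kinetic_range; do 2?[case: ifP => _]; rewrite ?lexx ?ler01 ?lerN10 ?eqxx.
Qed.

Lemma clip_kinetic_out p : ~~ (`|p.2| < L) -> F1 p = 0.
Proof.
rewrite ltr_norml => /negP h; rewrite /F1 /clip_kinetic.
case: ifPn => [/andP[p0 pL]|_].
  by exfalso; apply: h; rewrite pL (lt_trans _ p0)// oppr_lt0.
case: ifPn => [/andP[p0 pL]|//].
by exfalso; apply: h; rewrite p0 (lt_trans pL).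
Qed.

Lemma bmf_clip_kinetic : bmf F1.
Proof.
split; last by exists 1 => p; exact: (kinetic_range_norm (clip_kinetic_range p)).
have m2 := @measurable_snd _ _ R R.
apply: measurable_fun_ifT.
- by apply: measurable_and; apply: measurable_fun_ltr => //; exact: measurable_cst.
- by apply: measurable_clip; exact: measurable_F0.
- apply: measurable_fun_ifT; last exact: measurable_cst.
    by apply: measurable_and; apply: measurable_fun_ltr => //; exact: measurable_cst.
  apply: measurableT_comp => //; apply: measurable_clip.
  by apply: measurableT_comp => //; exact: measurable_F0.
Qed.

Lemma clip_kinetic_ae : {ae @leb2 R, forall p, 0 < p.1 -> F p = F1 p}.
Proof.
case: sol => _ [Fout Fr] _ _ _.
have n1 : {ae mu, forall x : R, `|x| != L}.
  apply: (aeI (ae_neq L) (ae_neq (- L))) => x h1 h2.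
  by apply/eqP => xL; move: h1 h2; case: (ger0P x) xL => _ <-; rewrite ?opprK eqxx.
have n2 := ae_snd n1; have n3 := ae_snd (ae_neq 0).
have n4 : {ae @leb2 R, forall p, `|p.2| != L /\ p.2 != 0} by apply: (aeI n2 n3) => p h1 h2; split.
have H : {ae @leb2 R, forall p, half_plane p -> (L < `|p.2| -> F p = 0) /\ (0 <= Num.sg p.2 * F p <= 1)}.
  by apply: (aeI Fout Fr) => p h1 h2 hp; split; [exact: h1|exact: h2].
apply: (aeI n4 H) => p [pL pn0] {}H p0.
have {H} [H1 H2] : (L < `|p.2| -> F p = 0) /\ (0 <= Num.sg p.2 * F p <= 1).
  by apply: H; rewrite half_planeE.
have [pl|Lp|/eqP] := ltgtP `|p.2| L; last by rewrite (negbTE pL).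
  rewrite /F1 /clip_kinetic -/F0 F0E//; move: pl; rewrite ltr_norml => /andP[h1 h2].
  move: H2; have [p2|p2|/eqP] := ltgtP 0 p.2; last by rewrite eq_sym (negbTE pn0).
    by rewrite gtr0_sg// mul1r h2 /= => h; rewrite clip_id.
  by rewrite ltr0_sg// mulN1r h1 /= => h; rewrite clip_id ?opprK.
by rewrite H1// clip_kinetic_out// -leNgt ltW.
Qed.

Lemma slices_ae : {ae mu, forall y, 0 < y -> {ae mu, forall xi, F (y, xi) = F1 (y, xi)}}.
Proof.
by apply: (aeS (ae_leb2_1 clip_kinetic_ae)) => y h y0; apply: (aeS h) => xi; exact.
Qed.

Lemma measurable_slice0 y : measurable_fun setT (fun xi => F0 (y, xi)).
Proof. by apply: (measurableT_comp measurable_F0); exact: pair1_measurable. Qed.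

Lemma measurable_slice1 y : measurable_fun setT (fun xi => F1 (y, xi)).
Proof. by have [] := bmf_pair2 y bmf_clip_kinetic. Qed.

Lemma density0_ae : {ae mu, forall y, 0 < y -> int (- L) L (fun xi => F0 (y, xi)) = density L F1 y}.
Proof.
apply: (aeS slices_ae) => y hy y0; apply: Rintegral_ae_eq => //.
- exact: measurable_slice0.
- exact: measurable_slice1.
- by apply: (aeS (hy y0)) => xi h _; rewrite F0E.
Qed.

Lemma clip_flux : {ae mu, forall y, 0 < y -> int (- L) L (fun xi => xi * F1 (y, xi)) = V}.
Proof.
case: sol => _ _ _ _ fl.
apply: (aeI slices_ae fl) => y hy fy y0; rewrite -(fy y0).
transitivity (int (- L) L (fun xi => xi * F0 (y, xi))).
  apply: Rintegral_ae_eq => //.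
  - by apply: measurable_funM => //; exact: measurable_slice1.
  - by apply: measurable_funM => //; exact: measurable_slice0.
  - by apply: (aeS (hy y0)) => xi h _; rewrite F0E// h.
by apply: int_eq => xi _; rewrite F0E.
Qed.

Lemma clip_trace e : 0 < e -> exists2 d, 0 < d &
  {ae mu, forall y, 0 < y < d -> int 0 L (fun xi => `|F1 (y, xi) - g1 xi|) <= e}.
Proof.
case: sol => _ _ _ tr _ e0; have [d d0 hd] := tr e e0; exists d => //.
apply: (aeI slices_ae hd) => y hy hyd yd; have /andP[y0 _] := yd.
have {}hyd := hyd yd; have {}hy := hy y0.
have m0 : measurable_fun setT (fun xi => `|F0 (y, xi) - g0 xi|).
  apply: measurableT_comp => //; apply: measurable_funB; first exact: measurable_slice0.
  exact: measurable_data0.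
have m1 : measurable_fun setT (fun xi => `|F1 (y, xi) - g1 xi|).
  apply: measurableT_comp => //; apply: measurable_funB; first exact: measurable_slice1.
  exact: measurable_clip_data.
have l1 : lbmf (fun xi => `|F1 (y, xi) - g1 xi|).
  apply/bmf_lbmf/bmf_norm/bmfB; first exact: (bmf_pair2 y bmf_clip_kinetic).
  split; first exact: measurable_clip_data.
  by exists 1 => x; have /andP[h1 h2] := clip_data_range x; rewrite ger0_norm.
rewrite -int_oo//.
have -> : Rintegral mu [set` `]0, L[] (fun xi => `|F1 (y, xi) - g1 xi|) =
   Rintegral mu [set` `]0, L[] (fun xi => `|F0 (y, xi) - g0 xi|).
  apply: Rintegral_ae_eq => //.
  apply: (aeI hy clip_data_ae) => xi h1 h2; rewrite /= in_itv /= => /andP[x0 _].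
  rewrite F0E// -h1 -[g1 xi]/(g1 xi) h2//; congr (`|_ - _|).
  by rewrite /g0 /patch mem_set//= in_itv /= x0.
rewrite /Rintegral.
have E : (\int[mu]_(x in `]0%R, L[) (`|F0 (y, x) - g0 x|)%:E = \int[@lebesgue_measure R]_(xi in `]0%R, L[) `|F (y, xi) - g xi|%:E)%E.
  apply: eq_integral => xi; rewrite inE /= in_itv /= => /andP[x0 _].
  by rewrite F0E// /g0 /patch mem_set//= in_itv /= x0.
rewrite E; move: hyd; set I := (X in (X < _)%E -> _) => hI.
have I0 : (0 <= I)%E by apply: integral_ge0 => x _; rewrite lee_fin.
have If : I \is a fin_num by rewrite ge0_fin_numE// (lt_trans hI) ?ltry.
by rewrite -lee_fin fineK// ltW.
Qed.

Lemma clip_weak (a a' b : R -> R) (l r l' r' : R) : 0 < l -> - L < l' -> r' < L ->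
  Cinf a -> Cinf a' -> Cinf b -> (forall x : R, is_derive x (1 : R) a (a' x)) ->
  (forall x, ~~ (l <= x <= r) -> a x = 0) -> (forall x, ~~ (l <= x <= r) -> a' x = 0) ->
  (forall x, ~~ (l' <= x <= r') -> b x = 0) ->
  int (- L) L (fun xi => b xi * int 0 r (fun y => xi * F1 (y, xi) * a' y + source L F1 (y, xi) * a y)) = 0.
Proof.
move=> l0 Ll rL Ca Ca' Cb da a0 a'0 b0.
case: sol => _ _ kin _ _.
pose D : set (R * R) := `]0, +oo[ `*` `]-L, L[.
pose D' : set (R * R) := `[0, r] `*` `[-L, L].
have mD : measurable D by apply: measurableX; exact: measurable_itv.
pose phi (p : R * R) := a p.1 * b p.2.
have tphi : test_function D phi.
  apply: (@test_function_prod _ a b l r l' r') => //.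
  move=> -[y xi] [/=]; rewrite !in_itv /= => /andP[h1 h2] /andP[h3 h4].
  split; rewrite /= in_itv /= ?andbT; first exact: lt_le_trans h1.
  by rewrite (lt_le_trans Ll h3) (le_lt_trans h4 rL).
have [db _] := Cinf_derive Cb.
have Dphi p : 'D_((1, 0) : R * R) phi p = a' p.1 * b p.2.
  have [_ ->] := is_derive_prod ((1, 0) : R * R) (da p.1) (db p.2).
  by rewrite /= mul1r mul0r addr0.
have ba : bmf a by apply: lbmf_compact_support a0; exact: continuous_lbmf (Cn_continuous (Ca 0%N)).
have ba' : bmf a' by apply: lbmf_compact_support a'0; exact: continuous_lbmf (Cn_continuous (Ca' 0%N)).
have bb : bmf b by apply: lbmf_compact_support b0; exact: continuous_lbmf (Cn_continuous (Cb 0%N)).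
have bxb : bmf (fun xi : R => xi * b xi).
  apply: (@lbmf_compact_support _ _ l' r').
    by apply: lbmfM; [exact: lbmf_id|exact: bmf_lbmf].
  by move=> x /b0 ->; rewrite mulr0.
have bF1 := bmf_clip_kinetic.
have bS : bmf (source L F1).
  apply: bmfB => //; apply: bmf_equilibrium; last exact: measurable_snd.
  apply: (measurableT_comp _ measurable_fst).
  by have [] := bmf_Rintegral2 bF1 (finite_mset_itv true false (- L) L).
pose k1 (p : R * R) := (p.2 * b p.2) * (F1 p * a' p.1).
pose k2 (p : R * R) := source L F1 p * (a p.1 * b p.2).
have bk1 : bmf k1.
  apply: bmfM; first exact: (bmf_comp measurable_snd bxb).
  by apply: bmfM => //; exact: (bmf_comp measurable_fst ba').
have bk2 : bmf k2.
  apply: bmfM => //; apply: bmfM; first exact: (bmf_comp measurable_fst ba).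
  exact: (bmf_comp measurable_snd bb).
have outD (f : R -> R) p : (forall x, ~~ (l <= x <= r) -> f x = 0) -> ~ D p -> f p.1 * b p.2 = 0.
  move=> f0 hD; have [p0|p0] := leP p.1 0.
    by rewrite f0 ?mul0r// negb_and -ltNge (le_lt_trans p0).
  rewrite b0 ?mulr0//; apply/negP => /andP[h1 h2]; apply: hD; split => /=; rewrite in_itv /= ?p0//.
  by rewrite (lt_le_trans Ll h1) (le_lt_trans h2 rL).
have outD' (f : R -> R) p : (forall x, ~~ (l <= x <= r) -> f x = 0) -> ~ D' p -> f p.1 * b p.2 = 0.
  move=> f0 hD; case: (boolP (l <= p.1 <= r)) => [/andP[h1 h2]|/f0 ->]; last by rewrite mul0r.
  rewrite b0 ?mulr0//; apply/negP => /andP[h3 h4]; apply: hD; split => /=; rewrite in_itv /=.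
    by rewrite h2 (le_trans (ltW l0) h1).
  by rewrite (le_trans (ltW Ll) h3) (le_trans h4 (ltW rL)).
have k1E p : k1 p = p.2 * F1 p * (a' p.1 * b p.2) by rewrite /k1; ring.
have I1 : \int[leb2]_(p in D) (p.2 * F p * 'D_((1, 0) : R * R) phi p) = \int[@leb2 R]_(p in D') k1 p.
  transitivity (\int[@leb2 R]_(p in D) (p.2 * F0 p * (a' p.1 * b p.2))).
    apply: eq_Rintegral => p; rewrite inE => -[/=]; rewrite in_itv /= andbT => p0 _.
    by rewrite Dphi F0E.
  transitivity (\int[@leb2 R]_(p in D) k1 p).
    apply: Rintegral_ae_eq => //.
    - apply: measurable_funM; first by apply: measurable_funM; [exact: measurable_snd|exact: measurable_F0].
      apply: measurable_funM; first exact: (measurableT_comp ba'.1 measurable_fst).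
      exact: (measurableT_comp bb.1 measurable_snd).
    - by case: bk1.
    - apply: (aeS clip_kinetic_ae) => p h [/=]; rewrite in_itv /= andbT => p0 _.
      by rewrite k1E F0E// h.
  by apply: Rintegral_support => p hp; rewrite k1E; [rewrite (outD a')//|rewrite (outD' a')//]; rewrite mulr0.
have I2 : \int[leb2]_(p in D) ((equilibrium_op L F p - F p) * phi p) = \int[@leb2 R]_(p in D') k2 p.
  transitivity (\int[@leb2 R]_(p in D) ((equilibrium (int (- L) L (fun z => F0 (p.1, z))) p.2 - F0 p) * phi p)).
    apply: eq_Rintegral => p; rewrite inE => -[/=]; rewrite in_itv /= andbT => p0 _.
    rewrite F0E// /equilibrium_op; congr ((equilibrium _ _ - _) * _).
    by apply: eq_Rintegral => z _; rewrite F0E.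
  transitivity (\int[@leb2 R]_(p in D) k2 p).
    apply: Rintegral_ae_eq => //.
    - apply: measurable_funM.
        apply: measurable_funB; last exact: measurable_F0.
        have [] // := @bmf_equilibrium R _ _ (fun p : R * R => int (- L) L (fun z => F0 (p.1, z))) snd.
        have mI := measurable_Rintegral2 measurable_F0 (finite_mset_itv true false (- L) L).1.
        exact: (measurableT_comp mI measurable_fst).
      apply: measurable_funM; first exact: (measurableT_comp ba.1 measurable_fst).
      exact: (measurableT_comp bb.1 measurable_snd).
    - by case: bk2.
    - apply: (aeI clip_kinetic_ae (ae_fst density0_ae)) => p h1 h2 [/=]; rewrite in_itv /= andbT => p0 _.
      by rewrite h2// F0E// h1.
  by apply: Rintegral_support => p hp; rewrite /k2; [rewrite (outD a)//|rewrite (outD' a)//]; rewrite mulr0.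
have := kin phi tphi; rewrite -/D I1 I2 => H.
have fA := finite_mset_itv true false 0 r; have fB := finite_mset_itv true false (- L) L.
have E : \int[@leb2 R]_(p in D') (k1 p + k2 p) = 0.
  have mD' : measurable D' by apply: measurableX; exact: measurable_itv.
  have foo : (@leb2 R D' < +oo)%E.
    rewrite /leb2 product_measure1E//.
    by apply: lte_mul_pinfty => //; [rewrite ge0_fin_numE//; case: fA | case: fB].
  by rewrite RintegralD ?bmf_integrable// -H subrr.
rewrite -[RHS]E (Rintegral_leb2_2 (bmfD bk1 bk2) fA fB).
apply: int_eq => xi _; rewrite -intZ.
  by apply: int_eq => y _; rewrite /k1 /k2 /=; ring.
have l1 (f : R * R -> R) : bmf f -> lbmf (fun y => f (y, xi)) by move=> bf; exact/bmf_lbmf/(bmf_pair1 xi bf).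
apply: lbmfD; apply: lbmfM; try exact: bmf_lbmf.
  by apply: lbmfMl; exact: l1.
exact: l1.
Qed.

Lemma layer_solution_mild : exists v, [/\ mild L g1 v, flux L g1 v 0 = V &
  {ae @leb2 R, forall p, half_plane p -> F p = relax L g1 v p}].
Proof.
have bF1 := bmf_clip_kinetic.
have wi := @weak_integral R L F1 bF1 clip_weak.
have [v [mv fv Fv]] := @weak_mild R L V g1 F1 L0 measurable_clip_data clip_data_range bF1
  clip_kinetic_range wi clip_trace clip_flux clip_kinetic_out.
exists v; split; [exact: mv|exact: fv|].
apply: (aeI clip_kinetic_ae Fv) => p h1 h2; rewrite half_planeE => p0.
by rewrite (h1 p0) (h2 p0).
Qed.

End ClippedSolution.

(** * Continuous functions on the plane *)
Section Plane.
Context {R : realType}.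
Local Notation mu := (@lebesgue_measure R).
Local Notation "'int' a b f" := (Rintegral mu [set` `[(a : R), (b : R)]] f)
  (at level 10, a, b, f at level 9).

(** Open sets of the plane are countable unions of rational boxes, so the
    product sigma-algebra contains them. *)
Lemma open_prod_measurable (A : set (R * R)) : open A -> measurable A.
Proof.
move=> oA.
pose box (q : rat * rat * rat) : set (R * R) :=
  ball (ratr q.1.1 : R) (ratr q.2 : R) `*` ball (ratr q.1.2 : R) (ratr q.2 : R).
have -> : A = \bigcup_(q in [set q | box q `<=` A]) box q.
  apply/seteqP; split; last by move=> p [q]; exact.
  move=> [x y] Axy; have /nbhs_ballP[e /= e0 eA] : nbhs (x, y) A by exact: open_nbhs_nbhs.
  have e2 : 0 < e / 2 by rewrite divr_gt0.
  have [r] := rat_in_itvoo e2; rewrite in_itv /= => /andP[r0 re].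
  have close (z : R) : exists q : rat, `|z - ratr q| < ratr r.
    have zr : z - ratr r < z + ratr r by lra.
    have [q] := rat_in_itvoo zr; rewrite in_itv /= => /andP[h1 h2]; exists q.
    by rewrite ltr_distlC; apply/andP; split; lra.
  have [a ha] := close x; have [b hb] := close y.
  exists (a, b, r) => /=; last first.
    by split => /=; rewrite /ball /= distrC.
  move=> [z t] [/= hz ht]; apply: eA; split => /=.
    rewrite -ball_normE /= in hz *; have := ler_distD (ratr a) x z; lra.
  rewrite -ball_normE /= in ht *; have := ler_distD (ratr b) y t; lra.
rewrite bigcup_mkcond; apply: countable_bigcupT_measurable => [|q].
  exact: countableP.
case: ifP => // _; apply: measurableX; exact: measurable_ball.
Qed.

Lemma continuous_measurable2 (f : R * R -> R) : continuous f -> measurable_fun setT f.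
Proof.
move=> cf; apply: (measurability _ (RGenOpens.measurableE R)).
move=> /= _ [_ [a [b ->]] <-]; rewrite setTI; apply: open_prod_measurable.
by apply: open_comp; [move=> x _; exact: cf|exact: interval_open].
Qed.

Lemma bmf_continuous_support (f : R * R -> R) (K : set (R * R)) : continuous f -> compact K ->
  (forall p, ~ K p -> f p = 0) -> bmf f.
Proof.
move=> cf cK f0; split; first exact: continuous_measurable2.
have /compact_bounded[M [_ hM]] := continuous_compact (continuous_subspaceT cf) cK.
exists (`|M| + 1) => p; have [Kp|Kp] := pselect (K p); last by rewrite f0// normr0.
apply: (hM (`|M| + 1)) => /=; last by exists p.
by rewrite (le_lt_trans (ler_norm _))// ltrDl.
Qed.

Lemma is_derive_slice (f : R * R -> R) (y xi : R) : derivable f (y, xi) (1, 0) ->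
  is_derive y (1 : R) (fun z => f (z, xi)) ('D_((1, 0) : R * R) f (y, xi)).
Proof.
move=> df.
have E : (fun h : R => h^-1 *: (((fun z => f (z, xi)) \o shift y) (h *: (1 : R)) - f (y, xi))) =
   (fun h : R => h^-1 *: ((f \o shift (y, xi)) (h *: ((1, 0) : R * R)) - f (y, xi))).
  apply/funext => h /=; congr (_ *: (f _ - _)).
  rewrite /shift /=; congr pair.
  by rewrite /= scaler0 add0r.
apply: DeriveDef; first by rewrite /derivable E.
by rewrite /derive E.
Qed.

End Plane.

(** * Mild states solve the layer problem *)
Section Converse.
Context {R : realType}.
Local Notation mu := (@lebesgue_measure R).
Local Notation "'int' a b f" := (Rintegral mu [set` `[(a : R), (b : R)]] f)
  (at level 10, a, b, f at level 9).

Variables (L V : R) (g : R -> R).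
Hypothesis L0 : 0 < L.
Hypothesis Vg : admissible L V g.

Let g1 := clip_data g.
Let g0 := g \_ `]0, +oo[.
Let mg : measurable_fun setT g1 := measurable_clip_data Vg.
Let g01 : forall xi, 0 <= g1 xi <= 1 := clip_data_range g.

Variable u : R -> R.
Hypothesis mildu : mild L g1 u.
Hypothesis fluxu : flux L g1 u 0 = V.

Let mu_ : measurable_fun setT u. Proof. by case: mildu. Qed.
Let uL s : `|u s| <= L := mild_bound L0 mg g01 mildu s.
Let F := relax L g1 u.
Let bF : bmf F := bmf_relax L mg g01 mu_.

Lemma relax_equilibrium_op p : equilibrium_op L F p = equilibrium (u p.1) p.2.
Proof. by rewrite /equilibrium_op; congr equilibrium; case: mildu => _ ->. Qed.

(** Integration by parts along one velocity.  As [A] vanishes at both ends, [a]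
    has zero integral and the constant [xi * F (0, xi)] drops out. *)
Lemma relax_weak_slice (a A : R -> R) (r xi : R) : 0 <= r ->
  (forall y : R, is_derive y (1 : R) A (a y)) -> continuous a -> A 0 = 0 -> A r = 0 ->
  int 0 r (fun y => xi * F (y, xi) * a y + (equilibrium (u y) xi - F (y, xi)) * A y) = 0.
Proof.
move=> r0 dA ca A0 Ar.
pose b s := equilibrium (u s) xi - F (s, xi).
have la : lbmf a := continuous_lbmf ca.
have lF : lbmf (fun y => F (y, xi)) := bmf_lbmf (bmf_pair1 xi bF).
have lb : lbmf b by apply: lbmfB => //; exact/bmf_lbmf/bmf_equilibrium2.
have AE y : 0 <= y -> A y = int 0 y a by move=> y0; rewrite (int_FTC2 dA ca y0) A0 subr0.
have lA : lbmf A.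
  apply: continuous_lbmf => x; apply/differentiable_continuous/derivable1_diffP.
  by case: (dA x).
have FE y : 0 <= y -> xi * F (y, xi) = xi * F (0, xi) + int 0 y b.
  move=> y0; apply/eqP; rewrite addrC -subr_eq -mulrBr; apply/eqP.
  exact: (relax_ode _ xi mu_ uL y0).
have h := int_by_parts r0 la lb.
have iar : int 0 r a = 0 by rewrite -AE.
rewrite iar mul0r in h.
transitivity (int 0 r (fun y => (xi * F (0, xi)) * a y + (a y * int 0 y b + b y * int 0 y a))).
  apply: int_eq => y /andP[y0 _]; rewrite FE// -AE//.
  by rewrite -/(b y); ring.
have lpa := lbmf_prim la; have lpb := lbmf_prim lb.
rewrite intD; last 2 first.
- exact: lbmfMl.
- by apply: lbmfD; apply: lbmfM.
by rewrite intZ// intD ?iar ?mulr0 ?add0r//; apply: lbmfM.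
Qed.

Lemma relax_kinetic : kinetic_equation L F.
Proof.
move=> phi [sm cK KO]; set K := closure _ in cK KO.
pose D : set (R * R) := `]0, +oo[ `*` `]-L, L[.
pose dphi := 'D_((1, 0) : R * R) phi.
have [cphi dfphi] := sm [::]; have [cdphi _] := sm [:: ((1, 0) : R * R)].
rewrite /= in cphi dfphi cdphi.
have p0 p : ~ K p -> phi p = 0.
  by move=> Kp; apply: contrapT => /eqP pn; apply: Kp; exact: subset_closure.
have d0 p : ~ K p -> dphi p = 0.
  move=> Kp; have E : {near p, (cst 0) =1 phi}.
    have : open (~` K) by apply: closed_openC; exact: closed_closure.
    move=> oK; have : nbhs p (~` K) by exact: open_nbhs_nbhs.
    by apply: filterS => q Kq; rewrite p0.
  by rewrite /dphi -(near_eq_derive _ E) derive_cst.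
have bphi : bmf phi := bmf_continuous_support cphi cK p0.
have bdphi : bmf dphi := bmf_continuous_support cdphi cK d0.
have [r r0 Kr] : exists2 r, 0 <= r & forall p, K p -> `|p.1| <= r.
  have /compact_bounded[M [_ hM]] := cK; exists (`|M| + 1) => [|p Kp]; first by rewrite addr_ge0.
  apply: (@le_trans _ _ `|p|); first by rewrite prod_normE le_max lexx.
  by apply: hM => //; rewrite (le_lt_trans (ler_norm _))// ltrDl.
(* The bound [r] is increased so that [phi] vanishes at the right end. *)
pose D' : set (R * R) := `[0, r + 1] `*` `[-L, L].
have KD p : ~ D p -> ~ K p by move=> h /KO.
have KD' p : ~ D' p -> ~ K p.
  move=> h Kp; apply: h; have := KO p Kp; have := Kr p Kp; case: p {Kp} => y xi /= h [/=].
  rewrite !in_itv /= andbT => y0 /andP[h1 h2]; split; rewrite /= in_itv /=.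
    by rewrite (ltW y0) (le_trans (le_trans (ler_norm _) h))// lerDl.
  by rewrite !ltW.
pose k1 p := p.2 * F p * dphi p.
pose k2 p := (equilibrium (u p.1) p.2 - F p) * phi p.
have mD : measurable D by apply: measurableX; exact: measurable_itv.
have mD' : measurable D' by apply: measurableX; exact: measurable_itv.
have bk2 : bmf k2.
  apply: bmfM => //; apply: bmfB => //.
  by apply: bmf_equilibrium; [exact: (measurableT_comp mu_ measurable_fst)|exact: measurable_snd].
have bx : bmf (fun p : R * R => p.2 * dphi p).
  have [m [C hC]] := bdphi; split; first by apply: measurable_funM => //; exact: measurable_snd.
  exists (L * C) => p; have [Kp|Kp] := pselect (K p); last first.
    rewrite d0// mulr0 normr0 mulr_ge0 ?(ltW L0)//.
    exact: le_trans (normr_ge0 _) (hC p).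
  rewrite normrM ler_pM//.
  have [_ /=] := KO p Kp; rewrite in_itv /= => /andP[h1 h2].
  by rewrite ler_norml !ltW.
have bk1 : bmf k1.
  have -> : k1 = (fun p => F p * (p.2 * dphi p)) by apply/funext => p; rewrite /k1; ring.
  exact: bmfM.
have I1 : \int[@leb2 R]_(p in D) k1 p = \int[@leb2 R]_(p in D') k1 p.
  by apply: Rintegral_support => p hp; rewrite /k1 d0 ?mulr0//; [exact: KD|exact: KD'].
have I2 : \int[@leb2 R]_(p in D) ((equilibrium_op L F p - F p) * phi p) = \int[@leb2 R]_(p in D') k2 p.
  transitivity (\int[@leb2 R]_(p in D) k2 p).
    by apply: eq_Rintegral => p _; rewrite relax_equilibrium_op.
  by apply: Rintegral_support => p hp; rewrite /k2 p0 ?mulr0//; [exact: KD|exact: KD'].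
rewrite I2 -/D -/dphi -/k1 I1; apply/eqP; rewrite eq_sym -subr_eq0 opprK addrC; apply/eqP.
have fA := finite_mset_itv true false 0 (r + 1); have fB := finite_mset_itv true false (- L) L.
have foo : (@leb2 R D' < +oo)%E.
  rewrite /leb2 product_measure1E//.
  by apply: lte_mul_pinfty => //; [rewrite ge0_fin_numE//; case: fA | case: fB].
rewrite -RintegralD ?bmf_integrable//.
rewrite (Rintegral_leb2_2 (bmfD bk1 bk2) fA fB).
apply: int_eq0 => xi _; rewrite /k1 /k2 /=.
have z y : ~ (0 < y <= r) -> phi (y, xi) = 0.
  move=> hy; apply: p0 => Kp; apply: hy; have [/=] := KO _ Kp.
  rewrite in_itv /= andbT => y0 _; rewrite y0 /=.
  exact: le_trans (ler_norm _) (Kr _ Kp).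
apply: (relax_weak_slice (A := fun y => phi (y, xi)) (a := fun y => dphi (y, xi))).
- by rewrite addr_ge0.
- by move=> y; apply: is_derive_slice; exact: dfphi.
- move=> y; apply: (continuous_comp (f := fun y : R => (y, xi))); last exact: cdphi.
  exact: (cvg_pair (f := id) (g := fun=> xi) cvg_id (cvg_cst xi)).
- by apply: z; rewrite ltxx.
- by apply: z => /andP[_]; rewrite gerDl ler10.
Qed.

Lemma relax_trace : trace0_on `]0, L[ F g.
Proof.
move=> e e0; pose d := e / 4; have d0 : 0 < d by rewrite divr_gt0.
exists (e * d / (8 * L)); first by rewrite !(divr_gt0, mulr_gt0).
apply: (aeS (ae_neq 0)) => y _ /andP[y0 yd].
pose h xi := `|F (y, xi) - g1 xi|.
have bg1 : bmf g1.
  by split => //; exists 1 => x; have /andP[h1 h2] := g01 x; rewrite ger0_norm.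
have bh : bmf h by apply/bmf_norm/bmfB => //; exact: bmf_relax_y.
have -> : (\int[mu]_(xi in `]0%R, L[) `|F (y, xi) - g xi|%:E = \int[mu]_(xi in `]0%R, L[) (h xi)%:E)%E.
  transitivity (\int[mu]_(xi in `]0%R, L[) `|F (y, xi) - g0 xi|%:E)%E.
    apply: eq_integral => xi; rewrite inE /= in_itv /= => /andP[x0 _].
    by rewrite /g0 /patch mem_set//= in_itv /= x0.
  have mgg := measurable_data0 Vg.
  apply: ae_eq_integral => //.
  - apply/measurable_EFinP; apply: measurable_funTS; apply: measurableT_comp => //.
    by apply: measurable_funB => //; case: (bmf_relax_y L mg g01 y mu_).
  - by apply/measurable_EFinP; apply: measurable_funTS; case: bh.
  - apply: (aeS (clip_data_ae Vg)) => xi hx; rewrite /= in_itv /= => /andP[x0 _].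
    by rewrite /h -/g1 in hx *; rewrite hx// /g0 /patch mem_set//= in_itv /= x0.
have ih : mu.-integrable (`]0, L[ : set R) (EFin \o h).
  by have [h1 h2] := finite_mset_itv false true 0 L; exact: bmf_integrable.
rewrite -[X in (X < _)%E]fineK; last exact: integrable_fin_num.
rewrite lte_fin -[X in X < _]/(Rintegral mu [set` `]0, L[] h).
have -> : Rintegral mu [set` `]0, L[] h = Rintegral mu [set` `]0, L[] (fun xi => `|F (y, xi) - F (0, xi)|).
  apply: eq_Rintegral => xi; rewrite inE /= in_itv /= => hx.
  by rewrite /h [F (0, xi)]relax0.
rewrite int_oo; last by apply/bmf_lbmf/bmf_norm/bmfB; exact: (bmf_relax_y L mg g01).
have lF : lbmf (fun xi => `|F (y, xi) - F (0, xi)|).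
  by apply/bmf_lbmf/bmf_norm/bmfB; exact: bmf_relax_y.
have := relax_dist L0 mg g01 y 0 mu_ uL d0.
rewrite (@int_chasles _ _ 0 L)//; [|by rewrite oppr_le0 ltW|exact: ltW].
have pos : 0 <= int (- L) 0 (fun xi => `|F (y, xi) - F (0, xi)|) by exact: int_ge0.
rewrite subr0 gtr0_norm//.
have : 2 * L * y / d < e / 4.
  rewrite ltr_pdivrMr// mulrC.
  have -> : y * (2 * L) = y * (8 * L) / 4 by field.
  have -> : e / 4 * d = e * d / 4 by field.
  by rewrite ltr_pM2r ?invr_gt0//; rewrite -ltr_pdivlMr ?mulr_gt0.
have dE : 2 * d = e / 2 by rewrite /d; field.
rewrite dE -/F; move: pos; lra.
Qed.

Lemma relax_layer_solution : layer_solution L V g F.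
Proof.
split.
- apply/andP; split; rewrite inE /=.
    by apply/(measurable_restrictT _ _).1; [rewrite /half_plane; exact: measurableX|apply: measurable_funTS; case: bF].
  rewrite /finite_norm unlock /=; case: ifP => // _.
  apply: (@le_lt_trans _ _ 1%E); last exact: ltry.
  apply: ess_sup_inf.ess_sup_ler => p /=; rewrite lee_fin /patch.
  by case: ifP => _; rewrite ?normr0 ?ler01//; exact: relax_bound.
- split; apply: aeW.
    move=> [y xi] _ /= h; apply: relax_out.
    by apply/negP => /andP[_]; rewrite ltNge (ltW h).
  move=> [y xi] _ /=; have := relax_range L g01 y xi mu_; rewrite -/F /kinetic_range.
  have [x0|x0|<-] := ltgtP 0 xi.
  + by rewrite gtr0_sg// mul1r.
  + by rewrite ltr0_sg// mulN1r oppr_ge0 lerNl andbC.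
  + by rewrite sgr0 mul0r lexx ler01.
- exact: relax_kinetic.
- exact: relax_trace.
- by apply: aeW => y y0; rewrite -fluxu -(mild_flux L0 mg g01 mildu (ltW y0)).
Qed.

End Converse.

(** * Convergence in L1 and the layer theorem *)
Section L1.
Context {R : realType}.
Local Notation mu := (@lebesgue_measure R).
Local Notation "'int' a b f" := (Rintegral mu [set` `[(a : R), (b : R)]] f)
  (at level 10, a, b, f at level 9).

Lemma L1_dist_supported (L : R) (f h : R -> R) : bmf f -> bmf h ->
  (forall xi, ~~ (`|xi| < L) -> f xi = 0) -> (forall xi, ~~ (`|xi| < L) -> h xi = 0) ->
  L1_dist f h = (int (- L) L (fun xi => `|f xi - h xi|))%:E.
Proof.
move=> bf bh f0 h0; have bd := bmf_norm (bmfB bf bh).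
have [mI Ioo] := finite_mset_itv true false (- L) L.
rewrite /L1_dist Lnorm1 /Rintegral fineK; last first.
  by apply: integrable_fin_num => //; exact: bmf_integrable.
rewrite [RHS]integral_mkcond; apply: eq_integral => x _; rewrite /patch.
case: ifPn => // /negP hx; rewrite /= f0 ?h0 ?subrr ?normr0//.
  by apply/negP => xL; apply: hx; rewrite inE /= in_itv /= -ler_norml ltW.
by apply/negP => xL; apply: hx; rewrite inE /= in_itv /= -ler_norml ltW.
Qed.

Lemma Lfun1_supported (L : R) (f : R -> R) : bmf f ->
  (forall xi, ~~ (`|xi| < L) -> f xi = 0) -> f \in Lfun mu 1.
Proof.
move=> bf f0; apply/andP; split; rewrite inE /=; first by case: bf.
rewrite /finite_norm; have := L1_dist_supported bf (bmf_cst 0) f0 (fun _ _ => erefl).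
rewrite /L1_dist; have -> : (f \- cst 0)%R = f by apply/funext => x /=; rewrite subr0.
by move=> ->; rewrite ltry.
Qed.

Lemma cvg_L1_squeeze (T : Type) (G : set_system T) (FG : Filter G) (f : T -> R) :
  (forall e, 0 < e -> \forall t \near G, 0 <= f t <= e) -> (f t)%:E @[t --> G] --> 0%E.
Proof.
move=> h; apply: cvg_EFin; first by apply: nearW.
apply/cvgrPdist_le => e e0; apply: filterS (h e e0) => t /andP[h1 h2] /=.
by rewrite sub0r normrN ger0_norm.
Qed.

Lemma int_equilibrium_dist (L u w : R) : `|u| <= L -> `|w| <= L ->
  int (- L) L (fun xi => `|equilibrium u xi - equilibrium w xi|) = `|u - w|.
Proof.
wlog uw : u w / u <= w => [H uL wL|uL wL].
  have [uw|/ltW wu] := leP u w; first exact: H.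
  rewrite distrC -H//; apply: int_eq => x _; exact: distrC.
rewrite distrC ger0_norm ?subr_ge0//.
have l x : lbmf (@equilibrium R x) by exact/bmf_lbmf/bmf_equilibrium1.
transitivity (int (- L) L (fun xi => equilibrium w xi - equilibrium u xi)).
  by apply: int_eq => x _; rewrite distrC ger0_norm// subr_ge0 equilibrium_le.
by rewrite intB// !int_equilibrium0.
Qed.

Variables (L : R) (g : R -> R).
Hypothesis L0 : 0 < L.
Hypothesis mg : measurable_fun setT g.
Hypothesis g01 : forall xi, 0 <= g xi <= 1.
Variable u : R -> R.
Hypothesis mildu : mild L g u.

Let mu_ : measurable_fun setT u. Proof. by case: mildu. Qed.
Let uL s : `|u s| <= L := mild_bound L0 mg g01 mildu s.
Let F := relax L g u.
Let bF y : bmf (fun xi => F (y, xi)) := bmf_relax_y L mg g01 y mu_.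

Lemma relax_outside y xi : ~~ (`|xi| < L) -> F (y, xi) = 0.
Proof. by move=> h; apply: relax_out; rewrite negb_and h orbT. Qed.

Lemma relax_Lfun y : (fun xi => F (y, xi)) \in Lfun mu 1.
Proof. by apply: (Lfun1_supported (bF y)) => xi; exact: relax_outside. Qed.

Lemma relax_L1_continuous y :
  L1_dist (fun xi => F (z, xi)) (fun xi => F (y, xi)) @[z --> y] --> 0%E.
Proof.
under eq_fun do rewrite (L1_dist_supported (bF _) (bF _) (@relax_outside _) (@relax_outside _)).
apply: cvg_L1_squeeze => e e0; pose d := e / 4; have d0 : 0 < d by rewrite divr_gt0.
have h0 : 0 < e * d / (4 * L) by rewrite !(divr_gt0, mulr_gt0).
near=> z; apply/andP; split; first exact: int_ge0.
apply: (le_trans (relax_dist L0 mg g01 z y mu_ uL d0)).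
have : `|z - y| <= e * d / (4 * L).
  rewrite distrC; near: z.
  by apply: (@cvgr_dist_le _ R^o _ _ _ id y); first exact: cvg_id.
rewrite ler_pdivlMr ?mulr_gt0// => h1.
have : 2 * L * `|z - y| / d <= e / 2.
  by rewrite ler_pdivrMr//; move: h1; set a := `|z - y|; lra.
have dE : 2 * d = e / 2 by rewrite /d; field.
rewrite dE; lra.
Unshelve. all: by end_near. Qed.

(** The distance splits into the distance of [F (y, .)] to its own equilibrium,
    controlled by the defect, and [|u y - w|], the distance between two
    equilibria. *)
Lemma relax_L1_limit w : `|w| <= L ->
  (forall e, 0 < e -> exists2 Y, 0 <= Y & forall y, Y <= y -> `|u y - w| < e) ->
  L1_dist (fun xi => F (y, xi)) (equilibrium w) @[y --> +oo] --> 0%E.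
Proof.
move=> wL hw.
have bM x : bmf (@equilibrium R x) by exact: bmf_equilibrium1.
have eo := equilibrium_out wL.
under eq_fun do rewrite (L1_dist_supported (bF _) (bM w) (@relax_outside _) eo).
apply: cvg_L1_squeeze => e e0; pose d := e / 8; have d0 : 0 < d by rewrite divr_gt0.
have e4 : 0 < e / 4 by rewrite divr_gt0.
have ed : 0 < e / 4 * d by rewrite mulr_gt0.
have [Y1 Y10 H1] := hw _ e4; have [Y2 Y20 H2] := mild_defect_to0 L0 mg g01 mildu ed.
near=> y; apply/andP; split; first exact: int_ge0.
have y1 : Y1 <= y by near: y; apply: nbhs_pinfty_ge; rewrite num_real.
have y2 : Y2 <= y by near: y; apply: nbhs_pinfty_ge; rewrite num_real.
have y0 := le_trans Y10 y1.
have b1 : bmf (fun xi => `|F (y, xi) - equilibrium (u y) xi|) by apply/bmf_norm/bmfB.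
have b2 : bmf (fun xi => `|equilibrium (u y) xi - equilibrium w xi|) by apply/bmf_norm/bmfB.
apply: (@le_trans _ _ (int (- L) L (fun xi => `|F (y, xi) - equilibrium (u y) xi| +
  `|equilibrium (u y) xi - equilibrium w xi|))).
  apply: int_le.
  - by apply/bmf_lbmf/bmf_norm/bmfB.
  - exact/bmf_lbmf/bmfD.
  - by move=> xi _; exact: ler_distD.
rewrite intD; [|exact: bmf_lbmf|exact: bmf_lbmf].
rewrite (int_equilibrium_dist (uL y) wL).
have := mild_dist_equilibrium L0 mg g01 mildu y0 d0.
have := H2 y y2; rewrite -ltr_pdivrMr//.
have := H1 y y1; rewrite -/F.
have dE : 2 * d = e / 4 by rewrite /d; field.
rewrite dE.
set a := `|_|; set b := _ / d; set i := Rintegral _ _ _; clearbody a b i.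
lra.
Unshelve. all: by end_near. Qed.

(** [(c - u)^2 <= c^2 - u^2] for [0 <= u <= c], and the right-hand side is twice
    the defect. *)
Lemma mild_nonneg_limit c : 0 <= c -> flux L g u 0 = c ^+ 2 / 2 ->
  (forall s, 0 <= s -> 0 <= u s) ->
  forall e, 0 < e -> exists2 Y, 0 <= Y & forall y, Y <= y -> `|u y - c| < e.
Proof.
move=> c0 fu upos e e0.
have e2 : 0 < e ^+ 2 / 2 by rewrite divr_gt0 ?exprn_gt0.
have [Y Y0 H] := mild_defect_to0 L0 mg g01 mildu e2; exists Y => // y Yy.
have y0 := le_trans Y0 Yy; have u0 := upos y y0.
have := H y Yy; have := mild_defect_ge0 L0 mg g01 mildu y0; rewrite fu.
set x := u y in u0 *; move=> h1 h2.
have xc : x <= c by rewrite -ler_sqr ?nnegrE//; lra.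
rewrite distrC ger0_norm ?subr_ge0//.
rewrite -ltr_sqr ?nnegrE ?subr_ge0//; last exact: ltW.
have : (c - x) ^+ 2 <= c ^+ 2 - x ^+ 2.
  have -> : c ^+ 2 - x ^+ 2 = (c - x) * (c + x) by ring.
  by rewrite expr2 ler_wpM2l ?subr_ge0//; lra.
lra.
Qed.

End L1.

Theorem proposition3 (R : realType) (L : R) (L_gt0 : 0 < L)
    (V : R) (g : R -> R) (Vg : admissible L V g) :
  [/\ exists F : R * R -> R, layer_solution L V g F,
      forall F G : R * R -> R,
        layer_solution L V g F -> layer_solution L V g G ->
        {ae leb2, forall p, half_plane p -> F p = G p} &
      forall (F : R * R -> R) (u_inf : R),
        layer_solution L V g F -> 0 <= u_inf -> V = u_inf ^+ 2 / 2 ->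
        exists Ft : R * R -> R,
          [/\ L1_continuous_version F Ft,
              V = \int[@lebesgue_measure R]_(xi in `[0, L]) (xi * g xi) ->
                (forall y xi, 0 <= y -> xi <= 0 -> Ft (y, xi) = 0) /\
                L1_dist (fun xi => Ft (y, xi)) (equilibrium u_inf)
                  @[y --> +oo] --> 0%E &
              \int[@lebesgue_measure R]_(xi in `[0, L]) (xi * g xi) < V ->
                L1_dist (fun xi => Ft (y, xi)) (equilibrium (- u_inf))
                  @[y --> +oo] --> 0%E]].
Proof.
pose g1 := clip_data g.
have mg := measurable_clip_data Vg; have g01 := clip_data_range g.
rewrite -/g1 in mg g01.
have [/andP[V0 VL] _ _ _ Vmin] := Vg.
have gV := clip_data_flux Vg; rewrite -/g1 in gV.
have speed c : 0 <= c -> V = c ^+ 2 / 2 -> 0 <= c <= L.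
  move=> c0 Vc; rewrite c0 /= -ler_sqr ?nnegrE//; last exact: ltW.
  by move: VL; rewrite Vc ler_pM2r ?invr_gt0.
pose c := Num.sqrt (2 * V).
have c0 : 0 <= c by exact: sqrtr_ge0.
have Vc : V = c ^+ 2 / 2 by rewrite sqr_sqrtr ?mulr_ge0//; field.
have cL := speed c c0 Vc.
have cg : Rintegral (@lebesgue_measure R) [set` `[0, L]] (fun xi => xi * g1 xi) <= c ^+ 2 / 2.
  by rewrite gV -Vc.
split.
- exists (relax L g1 (limit_state L g1 c)).
  apply: relax_layer_solution => //.
    exact: (limit_state_mild L_gt0 mg g01 cL).
  by rewrite Vc; exact: (limit_state_flux L_gt0 mg g01 cL cg).
- move=> F G sF sG.
  have [u [mu_ fu Fu]] := layer_solution_mild L_gt0 Vg sF.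
  have [v [mv fv Gv]] := layer_solution_mild L_gt0 Vg sG.
  rewrite -/g1 Vc in mu_ fu Fu mv fv Gv.
  rewrite (mild_eq_limit_state L_gt0 mg g01 cL cg mu_ fu) in Fu.
  rewrite (mild_eq_limit_state L_gt0 mg g01 cL cg mv fv) in Gv.
  by apply: (aeI Fu Gv) => p h1 h2 hp; rewrite h1// h2.
move=> F u_inf sF u0 Vu; have /andP[_ uL] := speed u_inf u0 Vu.
have [v [mv fv Fv]] := layer_solution_mild L_gt0 Vg sF; rewrite -/g1 in mv fv Fv.
have vu : flux L g1 v 0 = u_inf ^+ 2 / 2 by rewrite fv.
exists (relax L g1 v); split.
- split; [exact: Fv|by move=> y _; exact: (relax_Lfun mg g01 mv)|move=> y _].
  apply: cvg_trans (relax_L1_continuous L_gt0 mg g01 mv y).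
  by apply: cvg_app; exact: cvg_within.
- move=> VE.
  have vpos : forall s, 0 <= s -> 0 <= v s.
    by apply: (min_flux_nonneg L_gt0 mg g01 mv); rewrite fv gV.
  split.
    move=> y xi y0 xi0; apply: (relax_nonneg_zero mv y0) => // s ys.
    exact: vpos (le_trans y0 ys).
  apply: (relax_L1_limit L_gt0 mg g01 mv); first by rewrite ger0_norm.
  exact: (mild_nonneg_limit L_gt0 mg g01 mv u0 vu vpos).
- move=> VE.
  apply: (relax_L1_limit L_gt0 mg g01 mv); first by rewrite normrN ger0_norm.
  have [un|un] := eqVneq u_inf 0.
    move: VE; rewrite Vu un expr0n mul0r => h; exfalso; move: h; apply/negP; rewrite -leNgt -gV.
    apply: int_ge0 => x /andP[x0 _]; rewrite mulr_ge0//; by case/andP: (g01 x).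
  have u1 : 0 < u_inf by rewrite lt_neqAle eq_sym un.
  have [pos|neg] := mild_dichotomy L_gt0 mg g01 mv u1 vu.
    have := mild_nonneg_flux L_gt0 mg g01 mv pos.
    by rewrite fv gV => E; move: VE; rewrite -E ltxx.
  move=> e e0; have [Y Y0 H] := neg e e0; exists Y => // y Yy.
  by rewrite opprK; exact: H.
Qed.
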